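(* Let $s>0$, $q=s+1$, $\alpha\in(1,q]$, let $L(\cdot)$ be a slowly varying function and $c_1,c_2>0$ constants, and consider the two conditions: $$\text{(lower)}\quad \mathbf E[(Z\wedge x)^q]\ge c_1L(x)x^{q-\alpha}\ \text{ for all }x\ge1,\qquad \text{(upper)}\quad \mathbf E[(Z\wedge x)^q]\le c_2L(x)x^{q-\alpha}\ \text{ for all }x\ge1.$$ Let $g:\mathbb R_+\to\mathbb R_+$ be concave and bounded and such that, for some constants $\kappa_1,\kappa_2>0$ and all $x>0$, $$\frac{x}{(1+\kappa_1x^s)^{1/s}}\le g(x)\le\frac{x}{(1+\kappa_2x^s)^{1/s}}.$$ Let $(R_n)$ be a sequence of positive numbers with $0<\inf_nmR_n\le\sup_nmR_n\le K$ for some $K<\infty$. For each $n$, define $(B_n(u))_{u\in T_n}$ by $B_n(u)=+\infty$ for $u\in\partial T_n$ and $B_n(u)=R_n\sum_{v\leftarrow u}g(B_n(v))$ otherwise, and set $B_n:=B_n(\rho)$. Let $\gamma_n,\tilde\gamma_n$ be the normalizing sequences defined in the context. Then there are constants $c,c'>0$ such that: (i) if (lower) holds, then $\mathbf E[B_n]\le c\,\gamma_n$, and in particular $$\lim_{A\uparrow+\infty}\limsup_{n\to\infty}\mathbf P(B_n\ge A\gamma_n)=0;$$ (ii) if (upper) holds, then $\mathbf E[B_n]\ge c'\,\tilde\gamma_n$, or more precisely $$\lim_{\varepsilon\downarrow0}\limsup_{n\to\infty}\mathbf P(B_n\le\varepsilon\tilde\gamma_n)=0.$$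
   Context: $\mu$ is a probability distribution on $\{0,1,2,\dots\}$ with $\mu(0)=0$, $\mu(1)<1$; $Z\sim\mu$ and $m:=\mathbf E[Z]<\infty$ (so $m>1$). $T$ is the Galton--Watson tree with offspring law $\mu$ and root $\rho$; $T_n$ is the subtree of vertices at distance at most $n$ from the root, $\partial T_n$ is the set of vertices at distance exactly $n$. The notation $v\leftarrow u$ means that $v$ is a child of $u$. $\mathbf P,\mathbf E$ refer to the randomness of the tree. The convention $g(+\infty):=\lim_{x\to\infty}g(x)$ is used. $R_n$ is deterministic, fixed along $T_n$, but may depend on $n$. Normalizing sequences. Let $h:(0,\infty)\to(0,\infty)$ be an increasing bijection such that $h(x)\sim L(1/x)\,x^{\alpha-1}$ as $x\downarrow0$, and let $h^{-1}$ be its inverse. Define $$\gamma_n=\begin{cases}h^{-1}(1-mR_n)\,(mR_n)^n&\text{if }mR_n\in(0,1-\tfrac1n],\\ h^{-1}(1/n)&\text{if }mR_n\in[1-\tfrac1n,1+\tfrac1n],\\ h^{-1}(mR_n-1)&\text{if }mR_n\in[1+\tfrac1n,+\infty),\end{cases}$$ $$\tilde\gamma_n=\begin{cases}h^{-1}(1/n)\,\big(n(1-mR_n)\big)^{1/s}(mR_n)^n&\text{if }mR_n\in(0,1-\tfrac1n],\\ \gamma_n&\text{if }mR_n\in(1-\tfrac1n,+\infty).\end{cases}$$ (At the endpoints common to two ranges, either value may be used; they agree up to multiplicative constants.) *)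

(* Defs.v *)
From HB Require Import structures.
From mathcomp Require Import all_boot all_order all_algebra.
From mathcomp Require Import all_classical all_reals all_analysis.
Set Implicit Arguments.
Unset Strict Implicit.
Unset Printing Implicit Defensive.
Import Order.TTheory GRing.Theory Num.Theory numFieldNormedType.Exports.
Local Open Scope classical_set_scope.
Local Open Scope ring_scope.

Definition mutually_independent {d} {Omega : measurableType d} {R : realType}
    (P : probability Omega R) (I : eqType) (X : I -> Omega -> nat) : Prop :=
  forall (s : seq I) (A : I -> set nat), uniq s ->
    P (\big[setI/setT]_(i <- s) (X i @^-1` A i)) =
    (\prod_(i <- s) P (X i @^-1` A i))%E.

(* E[(Z /\ x)^q] for Z distributed as mu. *)
Definition truncated_moment {R : realType} (mu : probability nat R) (q x : R)
    : \bar R :=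
  ('E_mu[fun k : nat => (Num.min k%:R x `^ q)%R])%E.

(* Ulam--Harris encoding of the Galton--Watson tree: the root is [::], the
   label u potentially has N u children, and those of u are
   [rcons u 0, ..., rcons u (N u).-1]; the tree is the set of labels reachable
   from the root. *)
Definition gw_offspring {d} {Omega : measurableType d} {R : realType}
    (P : probability Omega R) (mu : probability nat R)
    (N : seq nat -> Omega -> nat) : Prop :=
  [/\ forall u, measurable_fun setT (N u),
      forall u (A : set nat), P (N u @^-1` A) = mu A
    & mutually_independent P N].

Definition children (nu : seq nat -> nat) (u : seq nat) : seq (seq nat) :=
  [seq rcons u i | i <- iota 0 (nu u)].

(* The value at -oo is never used. *)
Definition ext_fun {R : realType} (g : R -> R) (x : \bar R) : \bar R :=
  match x with
  | EFin r => (g r)%:E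
  | +oo%E => (lim (g y @[y --> +oo]))%:E
  | -oo%E => 0%E
  end.

(* [B_height g r nu k u] is the value at u when u lies at height k above the
   boundary, i.e. when the tree is cut at generation [size u + k]. *)
Fixpoint B_height {R : realType} (g : R -> R) (r : R) (nu : seq nat -> nat)
    (k : nat) (u : seq nat) : \bar R :=
  match k with
  | 0%N => +oo%E
  | k'.+1 =>
      (r%:E * \sum_(v <- children nu u) ext_fun g (B_height g r nu k' v))%E
  end.

Definition B_tree {R : realType} (g : R -> R) (r : R) (nu : seq nat -> nat)
    (n : nat) (u : seq nat) : \bar R := B_height g r nu (n - size u) u.

Lemma B_tree_boundary {R : realType} (g : R -> R) (r : R) (nu : seq nat -> nat)
    (n : nat) (u : seq nat) :
  size u = n -> B_tree g r nu n u = +oo%E.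
Proof. by move=> <-; rewrite /B_tree subnn. Qed.

Lemma B_tree_interior {R : realType} (g : R -> R) (r : R) (nu : seq nat -> nat)
    (n : nat) (u : seq nat) :
  (size u < n)%N ->
  B_tree g r nu n u =
  (r%:E * \sum_(v <- children nu u) ext_fun g (B_tree g r nu n v))%E.
Proof.
move=> un; rewrite /B_tree.
have -> /= : (n - size u = (n - (size u).+1).+1)%N by rewrite subnSK.
congr (_ * _)%E; rewrite /children !big_map; apply: eq_bigr => i _.
by rewrite size_rcons.
Qed.

Definition B_root {d} {Omega : measurableType d} {R : realType} (g : R -> R)
    (Rn : nat -> R) (N : seq nat -> Omega -> nat) (n : nat) (w : Omega)
    : \bar R :=
  B_tree g (Rn n) (N ^~ w) n [::].

Definition concave_nneg {R : realType} (g : R -> R) : Prop :=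
  forall x y t : R, 0 <= x -> 0 <= y -> 0 <= t <= 1 ->
    t * g x + (1 - t) * g y <= g (t * x + (1 - t) * y).

(* L only matters on [1, +oo[. *)
Definition slowly_varying {R : realType} (L : R -> R) : Prop :=
  [/\ measurable_fun (`[(1 : R), +oo[ : set R) L,
      forall x : R, 1 <= x -> 0 < L x
    & forall l : R, 0 < l -> L (l * x) / L x @[x --> +oo] --> (1 : R)].

Definition increasing_bijection_pos {R : realType} (h : R -> R) : Prop :=
  set_bij `]0, +oo[ `]0, +oo[ h /\
  {in `]0, +oo[%classic &, {homo h : x y / x < y}}.

Definition inv_pos {R : realType} (h : R -> R) : R -> R :=
  'pinv_(fun=> 0) `]0, +oo[ h.

(* A relation rather than a function: at mR_n = 1 - 1/n and mR_n = 1 + 1/n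
   either of the two expressions is allowed. *)
Definition is_gamma {R : realType} (h : R -> R) (m : R) (Rn : nat -> R)
    (n : nat) (y : R) : Prop :=
  let a := m * Rn n in
  [\/ 0 < a <= 1 - n%:R^-1 /\ y = inv_pos h (1 - a) * a ^+ n,
      1 - n%:R^-1 <= a <= 1 + n%:R^-1 /\ y = inv_pos h n%:R^-1
    | 1 + n%:R^-1 <= a /\ y = inv_pos h (a - 1)].

Definition gamma_tilde {R : realType} (s : R) (h : R -> R) (m : R)
    (Rn gamma : nat -> R) (n : nat) : R :=
  let a := m * Rn n in
  if a <= 1 - n%:R^-1
  then inv_pos h n%:R^-1 * (n%:R * (1 - a)) `^ s^-1 * a ^+ n
  else gamma n.

(* Main.v *)
Require Import Defs.
From HB Require Import structures.
From mathcomp Require Import all_boot all_order all_algebra.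
From mathcomp Require Import all_classical all_reals all_analysis.
From mathcomp Require Import measurable_realfun.
From mathcomp Require Import ring lra.
Set Implicit Arguments.
Unset Strict Implicit.
Unset Printing Implicit Defensive.
Import Order.TTheory GRing.Theory Num.Theory numFieldNormedType.Exports.
Local Open Scope classical_set_scope.
Local Open Scope ring_scope.

(** Why the theorem holds.  Write x_k for the mean of the value at height k,
    a = m R_n, and h for the given regularly varying function of index
    alpha - 1.  The value at a vertex is a sum, over its children, of independent
    copies of g(B), so x_(k+1) is a times the mean of g(B_k); both halves compare
    this with a scalar recursion in which h(x) is the relative loss per
    generation.

    Setting.  Offspring numbers are cut at a level X.  All random variables are
    then bounded, and the truncated values [bval] increase to the value on the
    full tree as X grows (they are eventually equal to it, [B_height_bval]).  The
    law of the family of offspring numbers is the product law on labelled trees;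
    it is invariant under independent resampling of the subtree of one child
    ([gw_tree_graft]), which yields the branching property ([Ex_branching]).

    Upper bound.  Given the number of children, Jensen's inequality replaces the
    children's values by their mean ([meang_jensen]), and
    g(t) <= t - c min(t,1)^(s+1) turns the loss into a truncated moment of order
    q = s + 1 at level 1/x, which the moment condition bounds below by h(x)
    ([tmoment_lower]).  Hence x_(k+1) <= a x_k (1 - c h(x_k)).  Such sequences
    satisfy h(x_k) = O(1/k) as long as the drift dominates ([decay_rate]).  For a
    above 1 they settle where h(x) balances a - 1; for a below 1 the drift acts
    for about 1/(1 - a) steps and the decay is geometric afterwards.  This gives
    gamma_n, first for all X and then, by monotone convergence, for the full
    tree; Markov's inequality gives tightness.

    Lower bound.  Let dl be the larger of 1/n and a - 1, and y0 = h^-1(dl).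
    Cutting offspring numbers at a level of order 1/y0 lowers their mean by a
    factor of at least 1 - dl/4, while the truncated moment of order q is at most
    of order dl y0^(-s) ([choose_truncation]).  From g(t) >= t - kappa t^(s+1) one
    obtains y |-> a (1 - dl/4) y (1 - D dl (y/y0)^s) as a minorant of the recursion,
    provided that the moment of order s + 1 of the normalised value B/E[B] is at
    most a constant times that of the offspring number, uniformly in the height
    and in X ([normalized_bval_moment]).  Two facts give this: applying g
    makes the normalised value less dispersed, since g(x)/x decreases
    ([xi_dispersion]), and averaging over more than one child on average
    contracts the moments ([moment_V_of_T]).  The minorant is solved in
    [lower_sequence_bounds]; below criticality the losses form a geometric series
    of ratio a^s, whence the factor (n (1 - a))^(1/s) in the lower normalisation.

    Lower tail.  A moment of order 1 + beta/2, with beta = (alpha - 1)/2, is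
    bounded uniformly in X, so the value exceeds half its mean with probability
    bounded below ([paley_zygmund]).  A vertex with at least two children has a
    small value only if these children do; as the probability of a single child is
    below 1, the lower tail decays geometrically along the last i generations, at the cost
    of a constant factor in the threshold for each ([lower_tail_iter]).  Letting
    i grow after n gives the convergence in probability. *)

(** * Inequalities for real powers *)

Section powR_inequalities.
Context (R : realType).
Implicit Types x y u p A : R.

Lemma powR_le1 x p : 0 <= x <= 1 -> 0 <= p -> x `^ p <= 1.
Proof.
move=> /andP[x0 x1] p0.
rewrite (le_trans (ge0_ler_powR p0 _ _ x1)) ?nnegrE//.
by rewrite powR1.
Qed.

Lemma powR_ge1 x p : 1 <= x -> 0 <= p -> 1 <= x `^ p.
Proof. by move=> x1 p0; rewrite -[leLHS](powRr0 x) ler_powR. Qed.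

Lemma powR_D1 x p : 0 <= x -> 0 < p -> x `^ (1 + p) = x * x `^ p.
Proof.
move=> x0 p0; rewrite powRD ?powRr1//.
by rewrite gt_eqF// addr_gt0.
Qed.

Lemma powR_concave_tangent u p : 0 <= u -> 0 < p <= 1 -> u `^ p <= 1 + p * (u - 1).
Proof.
move=> u0 /andP[p0]; rewrite le_eqVlt => /predU1P[->|p1].
  by rewrite powRr1// mul1r addrC subrK.
have p1' : 0 < 1 - p by rewrite subr_gt0.
have := @conjugate_powR R (u `^ p) 1 p^-1 (1 - p)^-1 (powR_ge0 _ _) ler01.
rewrite !invr_gt0 !invrK => /(_ p0 p1'); rewrite addrC subrK => /(_ erefl).
rewrite powR1 mulr1 -powRrM divff ?gt_eqF// powRr1//; lra.
Qed.

Lemma powR_bernoulli u p : 0 <= u -> 1 <= p -> 1 + p * (u - 1) <= u `^ p.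
Proof.
move=> u0 p1; have p0 : 0 < p by exact: lt_le_trans p1.
have := @powR_concave_tangent (u `^ p) p^-1 (powR_ge0 _ _).
rewrite invr_gt0 p0 invf_le1// p1 => /(_ isT).
rewrite -powRrM divff ?gt_eqF// powRr1// => h.
have := ler_wpM2l (ltW p0) h.
by rewrite mulrDr mulrA divff ?gt_eqF//; lra.
Qed.

(** The constant [A] in front of x^p may be as close to 1 as desired, so that the
    recursion for the moments remains contracting.  Either y is at most a small
    multiple eta of x, with (1 + eta)^p = A, or x is at most y / eta. *)
Lemma powR_add_le p A : 0 < p -> 1 < A -> exists2 C, 0 < C &
  forall x y, 0 <= x -> 0 <= y -> (x + y) `^ p <= A * x `^ p + C * y `^ p.
Proof.
move=> p0 A1; have A0 : 0 < A by exact: lt_trans A1.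
pose eta := A `^ p^-1 - 1.
have eta0 : 0 < eta.
  rewrite subr_gt0.
  have := @gt0_ltr_powR R p^-1; rewrite invr_gt0 => /(_ p0 1 A).
  by rewrite powR1 !nnegrE; apply => //; exact: ltW.
have etaA : (1 + eta) `^ p = A.
  rewrite /eta addrC subrK -powRrM mulVf ?gt_eqF// powRr1//; exact: ltW.
exists ((1 + eta^-1) `^ p).
  by rewrite powR_gt0// addr_gt0// invr_gt0.
move=> x y x0 y0; have [yx|xy] := leP y (eta * x).
  apply: (@le_trans _ _ (A * x `^ p)); last first.
    by rewrite lerDl mulr_ge0 ?powR_ge0.
  have e1 : 0 <= 1 + eta by rewrite addr_ge0// ltW.
  rewrite -etaA -powRM// ge0_ler_powR ?nnegrE ?(ltW p0) ?addr_ge0 ?mulr_ge0//.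
  by rewrite mulrDl mul1r lerD2l.
apply: (@le_trans _ _ ((1 + eta^-1) `^ p * y `^ p)); last first.
  by rewrite lerDr mulr_ge0 ?powR_ge0// ltW.
have e1 : 0 <= 1 + eta^-1 by rewrite addr_ge0// invr_ge0 ltW.
rewrite -powRM// ge0_ler_powR ?nnegrE ?(ltW p0) ?addr_ge0 ?mulr_ge0//.
by rewrite mulrDl mul1r addrC lerD2l mulrC ler_pdivlMr// mulrC ltW.
Qed.

Lemma powR_1D_ge u p : 0 <= u -> 0 <= p -> 1 + p * (u / (1 + u)) <= (1 + u) `^ p.
Proof.
move=> u0 p0; have w0 : 0 < 1 + u by rewrite ltr_wpDr.
rewrite /powR gt_eqF//; apply: le_trans (expR_ge1Dx _).
rewrite lerD2l ler_wpM2l//.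
have h : - ln (1 + u) <= - (u / (1 + u)).
  rewrite -lnV ?posrE//.
  have {1}-> : (1 + u)^-1 = 1 + (- (u / (1 + u))) by field; rewrite gt_eqF.
  apply: le_ln1Dx.
  by rewrite ltrN2 ltr_pdivrMr// mul1r ltrDr.
by move: h; rewrite lerN2.
Qed.

Lemma powR_1D_le u p : 0 <= u -> 0 <= p -> (1 + u) `^ p <= expR (p * u).
Proof.
move=> u0 p0; have w0 : 0 < 1 + u by rewrite ltr_wpDr.
rewrite /powR gt_eqF// ler_expR ler_wpM2l// le_ln1Dx//.
exact: lt_le_trans u0.
Qed.

End powR_inequalities.

(** * Expectation of bounded random variables *)

Section bounded_expectation.
Context d (T : measurableType d) (R : realType) (P : probability T R).
Implicit Types f g : T -> R.

(** Truncating the offspring numbers makes every random variable of the recursion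
    bounded: expectations are then real numbers, and linear on this class without
    further integrability conditions. *)
Definition bounded_rv f :=
  measurable_fun setT f /\ exists M, forall w, `|f w| <= M.

Definition Ex f := \int[P]_w f w.

Lemma bounded_rv_integrable f : bounded_rv f -> P.-integrable setT (EFin \o f).
Proof.
move=> [mf [M fM]]; apply: measurable_bounded_integrable => //.
  by rewrite (le_lt_trans (probability_le1 P measurableT))// ltry.
rewrite /bounded_near; near=> K => w _ /=.
apply: le_trans (fM w) _; near: K; exact: nbhs_pinfty_ge (num_real M).
Unshelve. all: by end_near. Qed.

Lemma bounded_rv_cst (c : R) : bounded_rv (fun=> c).
Proof. by split; [exact: measurable_cst | exists `|c|]. Qed.

Lemma bounded_rvD f g : bounded_rv f -> bounded_rv g ->
  bounded_rv (fun w => f w + g w).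
Proof.
move=> [mf [M fM]] [mg [M' gM]]; split; first exact: measurable_funD.
by exists (M + M') => w; rewrite (le_trans (ler_normD _ _))// lerD.
Qed.

Lemma bounded_rvM f g : bounded_rv f -> bounded_rv g ->
  bounded_rv (fun w => f w * g w).
Proof.
move=> [mf [M fM]] [mg [M' gM]]; split; first exact: measurable_funM.
by exists (M * M') => w; rewrite normrM ler_pM.
Qed.

Lemma bounded_rvZ (c : R) f : bounded_rv f -> bounded_rv (fun w => c * f w).
Proof. by move=> bf; apply: bounded_rvM => //; exact: bounded_rv_cst. Qed.

Lemma bounded_rvN f : bounded_rv f -> bounded_rv (fun w => - f w).
Proof.
move=> bf; rewrite (_ : (fun _ => _) = (fun w => -1 * f w)).
  exact: bounded_rvZ.
by apply/funext => w; rewrite mulN1r.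
Qed.

Lemma bounded_rvB f g : bounded_rv f -> bounded_rv g ->
  bounded_rv (fun w => f w - g w).
Proof. by move=> bf bg; apply: bounded_rvD => //; exact: bounded_rvN. Qed.

Lemma bounded_rv_sum (I : Type) (r : seq I) (p : pred I) (F : I -> T -> R) :
  (forall i, bounded_rv (F i)) ->
  bounded_rv (fun w => \sum_(i <- r | p i) F i w).
Proof.
move=> bF; elim: r => [|i r ih].
  rewrite (_ : (fun _ => _) = (fun=> 0)); first exact: bounded_rv_cst.
  by apply/funext => w; rewrite big_nil.
rewrite (_ : (fun _ => _) = (fun w => (if p i then F i w else 0) +
    \sum_(i <- r | p i) F i w)).
  by apply: bounded_rvD => //; case: (p i) => //; exact: bounded_rv_cst.
by apply/funext => w; rewrite big_cons; case: (p i); rewrite ?add0r.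
Qed.

Lemma bounded_rv_powR f (p : R) : (forall w, 0 <= f w) -> 0 <= p ->
  bounded_rv f -> bounded_rv (fun w => f w `^ p).
Proof.
move=> f0 p0 [mf [M fM]]; split.
  by apply: (@measurableT_comp _ _ _ _ _ _ (@powR R ^~ p)) => //.
exists (M `^ p) => w; rewrite ger0_norm ?powR_ge0//.
by apply: ge0_ler_powR; rewrite ?nnegrE// (le_trans _ (fM w))// ger0_norm.
Qed.

Lemma bounded_rv_indic (A : set T) : measurable A -> bounded_rv (\1_A : T -> R).
Proof.
move=> mA; split; first exact: measurable_indic.
by exists 1 => w; rewrite indicE; case: (_ \in _); rewrite ?normr1 ?normr0.
Qed.

Lemma ExD f g : bounded_rv f -> bounded_rv g ->
  Ex (fun w => f w + g w) = Ex f + Ex g.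
Proof.
by move=> bf bg; rewrite /Ex RintegralD//; exact: bounded_rv_integrable.
Qed.

Lemma ExB f g : bounded_rv f -> bounded_rv g ->
  Ex (fun w => f w - g w) = Ex f - Ex g.
Proof.
by move=> bf bg; rewrite /Ex RintegralB//; exact: bounded_rv_integrable.
Qed.

Lemma ExZ (c : R) f : bounded_rv f -> Ex (fun w => c * f w) = c * Ex f.
Proof.
by move=> bf; rewrite /Ex RintegralZl//; exact: bounded_rv_integrable.
Qed.

Lemma Ex_cst (c : R) : Ex (fun=> c) = c.
Proof.
rewrite /Ex Rintegral_cst//; transitivity (c * 1); last by rewrite mulr1.
by congr (_ * _); exact: (congr1 fine (probability_setT P)).
Qed.

Lemma Ex_sum (I : Type) (r : seq I) (p : pred I) (F : I -> T -> R) :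
  (forall i, bounded_rv (F i)) ->
  Ex (fun w => \sum_(i <- r | p i) F i w) = \sum_(i <- r | p i) Ex (F i).
Proof.
move=> bF; elim: r => [|i r ih].
  rewrite big_nil -[RHS](Ex_cst 0); congr Ex.
  by apply/funext => w; rewrite big_nil.
rewrite big_cons -ih; case: ifPn => pi.
  rewrite -ExD//; last exact: bounded_rv_sum.
  by congr Ex; apply/funext => w; rewrite big_cons pi.
by congr Ex; apply/funext => w; rewrite big_cons (negbTE pi).
Qed.

Lemma Ex_le f g : bounded_rv f -> bounded_rv g ->
  (forall w, f w <= g w) -> Ex f <= Ex g.
Proof.
by move=> bf bg fg; apply: le_Rintegral => //; exact: bounded_rv_integrable.
Qed.

Lemma Ex_ge0 f : (forall w, 0 <= f w) -> 0 <= Ex f.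
Proof. by move=> f0; apply: Rintegral_ge0. Qed.

Lemma Ex_EFin f : bounded_rv f -> (\int[P]_w (f w)%:E = (Ex f)%:E)%E.
Proof.
move=> bf; rewrite /Ex /Rintegral fineK//.
by apply: integrable_fin_num => //; exact: bounded_rv_integrable.
Qed.

Lemma Ex_indic (A : set T) : measurable A -> ((Ex (\1_A))%:E = P A)%E.
Proof.
by move=> mA; rewrite -Ex_EFin ?integral_indic ?setIT//; exact: bounded_rv_indic.
Qed.

(** On the null set, a multiple of its indicator absorbs the difference. *)
Lemma Ex_le_ae f g (A : set T) : measurable A -> P A = 0%E ->
  bounded_rv f -> bounded_rv g ->
  (forall w, ~ A w -> f w <= g w) -> Ex f <= Ex g.
Proof.
move=> mA PA0 bf bg fg.
have bA := bounded_rv_indic mA.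
have [_ [M fM]] := bf; have [_ [M' gM]] := bg.
have bh : bounded_rv (fun w => g w + (M + M') * \1_A w).
  by apply: bounded_rvD => //; exact: bounded_rvZ.
have -> : Ex g = Ex (fun w => g w + (M + M') * \1_A w).
  rewrite ExD//; last exact: bounded_rvZ.
  have /= := Ex_indic mA; rewrite PA0 => -[e]; rewrite ExZ// e.
  by rewrite mulr0 addr0.
apply: Ex_le => // w; rewrite indicE.
case: (boolP (w \in A)) => [_|/negP wA]; last first.
  by rewrite mulr0 addr0 fg// => Aw; apply: wA; rewrite inE.
have := fM w; have := gM w; rewrite mulr1 !ler_norml => /andP[a1 a2] /andP[b1 b2].
lra.
Qed.

End bounded_expectation.

(** * The space of labelled trees and the branching property *)

Definition cylinder (s : seq (seq nat)) (A : seq nat -> set nat) :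
    set (seq nat -> nat) :=
  [set nu | forall v, v \in s -> A v (nu v)].

Definition cylinders : set (set (seq nat -> nat)) :=
  [set C | exists s A, C = cylinder s A].

Definition tree : Type := g_sigma_algebraType cylinders.

HB.instance Definition _ := Measurable.on tree.

Definition subtree (i : nat) (nu : tree) : tree := fun v => nu (i :: v).

(** [graft i (p1, p2)] is the tree p2 in which the subtree of child i is replaced
    by p1. *)
Definition graft (i : nat) (p : tree * tree) : tree := fun v =>
  if v is j :: v' then (if j == i then p.1 v' else p.2 v) else p.2 v.

Lemma subtree_graft i p : subtree i (graft i p) = p.1.
Proof. by apply/funext => v; rewrite /subtree /= eqxx. Qed.

Lemma subtree_graft_neq i j p : j != i -> subtree j (graft i p) = subtree j p.2.
Proof. by move=> /negbTE ji; apply/funext => v; rewrite /subtree /= ji. Qed.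

Lemma cylinderI s t A B : cylinder s A `&` cylinder t B =
  cylinder (s ++ t) (fun v => [set k | (v \in s -> A v k) /\ (v \in t -> B v k)]).
Proof.
apply/seteqP; split => nu /=.
  by move=> [sA tB] v; rewrite mem_cat => _; split => vs; [exact: sA|exact: tB].
by move=> h; split => v vs; have [] := h v; rewrite ?mem_cat ?vs ?orbT//;
  move=> a b; [exact: a|exact: b].
Qed.

Lemma measurable_cylinder s A : measurable (cylinder s A : set tree).
Proof. by apply: sub_sigma_algebra; exists s, A. Qed.

Lemma measurable_label (v : seq nat) :
  measurable_fun setT (fun nu : tree => nu v : nat).
Proof.
move=> _ A _; rewrite setTI.
rewrite (_ : _ @^-1` _ = cylinder [:: v] (fun=> A)); first exact: measurable_cylinder.
by apply/seteqP; split => nu /=; [move=> h u; rewrite inE => /eqP -> |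
  move=> /(_ v); rewrite mem_head; exact].
Qed.

Lemma measurable_into_tree d (T : measurableType d) (F : T -> tree) :
  (forall v, measurable_fun setT (fun w => F w v : nat)) ->
  measurable_fun setT F.
Proof.
move=> mF; apply: (@measurability _ _ _ _ setT F cylinders) => //.
move=> _ [_ [s [A ->]] <-]; rewrite setTI.
rewrite (_ : _ @^-1` _ = \bigcap_(v in [set` s]) ((fun w => F w v) @^-1` A v)).
  apply: fin_bigcap_measurable => // v _.
  by rewrite -[X in measurable X]setTI; exact: mF.
by apply/seteqP; split => w /=; apply.
Qed.

Lemma measurable_subtree i : measurable_fun setT (subtree i).
Proof. by apply: measurable_into_tree => v; exact: measurable_label. Qed.

Lemma measurable_graft i : measurable_fun setT (graft i).
Proof.
apply: measurable_into_tree => -[|j v] /=.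
  exact: (measurableT_comp (measurable_label [::]) measurable_snd).
case: (j == i) => /=.
  exact: (measurableT_comp (measurable_label v) measurable_fst).
exact: (measurableT_comp (measurable_label (j :: v)) measurable_snd).
Qed.

Section branching.
Context (R : realType) (Q : probability tree R) (mu : probability nat R).

(** The product law.  Cylinders generate the sigma-algebra and are stable under
    intersection, so these values determine [Q]. *)
Definition gw_tree := forall s A, uniq s ->
  Q (cylinder s A) = (\prod_(v <- s) mu (A v))%E.

Hypothesis QG : gw_tree.

(** Replacing the subtree of child i by an independent copy preserves the law: the
    constraints of a cylinder split into those on labels starting with i, read in
    the new subtree, and the others, read in the old tree.  Independence of the
    subtree and equality of its law with the law of the whole tree are both
    contained in this invariance. *)
Lemma gw_tree_graft i (A : set tree) : measurable A ->
  Q A = (Q \x Q)%E (graft i @^-1` A).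
Proof.
move=> mA.
have mg := measurable_graft i.
pose Q1 : {measure set tree -> \bar R} := pushforward (Q \x Q)%E (graft i).
pose Q2 := Q1 mg.
rewrite -[RHS]/(Q2 A).
apply: (@measure_unique _ R tree cylinders (fun=> setT)) => //.
- by move=> _ _ [s [B ->]] [t [B' ->]]; rewrite cylinderI; eexists; eexists.
- by move=> _; exists [::], (fun=> setT); apply/seteqP; split.
- by rewrite bigcup_const//; exists 0%N.
- move=> _ [s0 [B ->]].
  pose s := undup s0.
  have -> : cylinder s0 B = cylinder s B.
    by apply/seteqP; split => nu /= h v; have := h v; rewrite mem_undup.
  have us : uniq s by exact: undup_uniq.
  pose s1 := [seq behead v | v <- s & ohead v == Some i].
  pose s2 := [seq v <- s | ohead v != Some i].
  rewrite /Q2 /= /pushforward /=.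
  rewrite (_ : _ @^-1` _ = cylinder s1 (fun v => B (i :: v)) `*` cylinder s2 B).
    rewrite product_measure1E; [|exact: measurable_cylinder..].
    have u2 : uniq s2 by rewrite filter_uniq.
    have u1 : uniq s1.
      rewrite map_inj_in_uniq ?filter_uniq// => -[|a u] [|b v];
        rewrite !mem_filter//= => /andP[/eqP[->] _] /andP[/eqP[->] _] ->//.
    transitivity (\prod_(v <- s1) mu (B (i :: v)) * \prod_(v <- s2) mu (B v))%E;
      last by congr (_ * _)%E; apply/esym; exact: QG.
    rewrite (QG _ us).
    rewrite (bigID (fun v => ohead v == Some i))/= big_map !big_filter.
    congr (_ * _)%E; apply: eq_bigr => -[|a u]//= /eqP[->//].
  apply/seteqP; split => -[n1 n2] /=.
    move=> h; split.
      move=> _ /mapP[[|j v] + ->]; rewrite mem_filter//= => /andP[/eqP[->]] vs.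
      by have := h _ vs; rewrite /= eqxx.
    move=> [|j v]; rewrite mem_filter /=; first by move=> vs; exact: (h _ vs).
    move=> /andP[ji vs]; have := h _ vs => //=.
    by have /negbTE -> : j != i by apply: contra ji => /eqP ->.
  move=> [h1 h2] [|j v] vs /=.
    by apply: h2; rewrite mem_filter.
  case: ifPn => [/eqP ji|ji].
    rewrite ji in vs *; apply: h1; apply/mapP; exists (i :: v) => //.
    by rewrite mem_filter /= eqxx.
  by apply: h2; rewrite mem_filter vs andbT; apply: contra ji => /eqP[->].
- by move=> _; rewrite (le_lt_trans (probability_le1 Q measurableT))// ltry.
Qed.

Lemma Ex_graft i (F : tree -> R) : bounded_rv F ->
  ((Ex Q F)%:E = \int[(Q \x Q)%E]_p (F (graft i p))%:E)%E.
Proof.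
move=> bF; rewrite -Ex_EFin//.
have mg := measurable_graft i.
pose Q1 : {measure set tree -> \bar R} := pushforward (Q \x Q)%E (graft i).
pose Q2 := Q1 mg.
have finQ : ((Q \x Q) setT < +oo)%E.
  rewrite -setXTT product_measure1E// lte_mul_pinfty// ?ge0_fin_numE//.
    by rewrite (le_lt_trans (probability_le1 Q measurableT))// ltry.
  by rewrite (le_lt_trans (probability_le1 Q measurableT))// ltry.
have [mF [M FM]] := bF.
rewrite (@eq_measure_integral _ _ _ setT Q2 Q); last first.
  by move=> A mA _; exact: gw_tree_graft.
rewrite (integral_pushforward mg)//.
- exact/measurable_EFinP.
- rewrite preimage_setT.
  apply: measurable_bounded_integrable => //.
    exact: measurableT_comp.
  rewrite /bounded_near; near=> K => w _ /=.
  apply: le_trans (FM _) _; near: K; exact: nbhs_pinfty_ge (num_real M).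
Unshelve. all: by end_near. Qed.

(** The condition on [H] says that it does not look at the subtree of child i.
    After resampling this subtree, [f] and [H] depend on independent trees. *)
Lemma Ex_branching i (f H : tree -> R) : bounded_rv f -> bounded_rv H ->
  (forall p, H (graft i p) = H p.2) ->
  Ex Q (fun nu => f (subtree i nu) * H nu) = Ex Q f * Ex Q H.
Proof.
move=> bf bH HG; apply: EFin_inj.
have [mf [M fM]] := bf; have [mH [M' HM]] := bH.
have finQ : ((Q \x Q) setT < +oo)%E.
  rewrite -setXTT product_measure1E// lte_mul_pinfty// ?ge0_fin_numE//.
    by rewrite (le_lt_trans (probability_le1 Q measurableT))// ltry.
  by rewrite (le_lt_trans (probability_le1 Q measurableT))// ltry.
rewrite (Ex_graft i); last first.
  apply: bounded_rvM => //; split; last by exists M.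
  exact: (measurableT_comp mf (measurable_subtree i)).
under eq_integral do rewrite subtree_graft HG.
rewrite -(integral12_prod_meas1 (m1 := Q) (m2 := Q)
   (f := fun p : tree * tree => (f p.1 * H p.2)%:E)) /=.
  rewrite /fubini_F /=.
  transitivity (\int[Q]_x (f x * Ex Q H)%:E)%E.
    apply: eq_integral => x _.
    by rewrite Ex_EFin; [rewrite ExZ|exact: bounded_rvZ].
  rewrite Ex_EFin; last by apply: bounded_rvM => //; exact: bounded_rv_cst.
  by congr (_%:E); rewrite mulrC -ExZ//; congr Ex; apply/funext => w; rewrite mulrC.
apply: measurable_bounded_integrable => //.
  apply: measurable_funM.
    exact: (measurableT_comp mf measurable_fst).
  exact: (measurableT_comp mH measurable_snd).
rewrite /bounded_near; near=> K => -[w1 w2] _ /=.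
apply: (@le_trans _ _ (M * M')); first by rewrite normrM ler_pM.
by near: K; exact: nbhs_pinfty_ge (num_real _).
Unshelve. all: by end_near. Qed.

End branching.

(** * The truncated recursion *)

Definition noffspring (X : nat) (nu : tree) : nat := minn (nu [::]) X.

Lemma noffspring_le X nu : (noffspring X nu <= X)%N.
Proof. exact: geq_minr. Qed.

Lemma sum_ord_le (R : realType) (n X : nat) (F : nat -> R) : (n <= X)%N ->
  \sum_(i < n) F i = \sum_(i < X) (i < n)%:R * F i.
Proof.
move=> nX; rewrite (big_ord_widen _ F nX) big_mkcond.
by apply: eq_bigr => i _; case: ifP; rewrite ?mul1r ?mul0r.
Qed.

Section offspring.
Context (R : realType) (Q : probability tree R) (mu : probability nat R).
Hypothesis QG : gw_tree Q mu.

Lemma bounded_rv_offspring X (phi : nat -> R) :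
  bounded_rv (fun nu => phi (noffspring X nu)).
Proof.
split.
  rewrite (_ : (fun _ => _) = (fun j => phi (minn j X)) \o
    (fun nu : tree => nu [::] : nat))//.
  by apply: measurableT_comp => //; exact: measurable_label.
exists (\sum_(j < X.+1) `|phi j|) => nu.
have h : (noffspring X nu < X.+1)%N by rewrite ltnS noffspring_le.
rewrite (bigD1 (Ordinal h))//= lerDl; exact: sumr_ge0.
Qed.

Lemma bounded_rv_label (phi : nat -> R) : (exists M, forall j, `|phi j| <= M) ->
  bounded_rv (fun nu : tree => phi (nu [::])).
Proof.
move=> [M phiM]; split; last by exists M.
rewrite (_ : (fun _ => _) = phi \o (fun nu : tree => nu [::] : nat))//.
by apply: measurableT_comp => //; exact: measurable_label.
Qed.

Lemma Ex_label (phi : nat -> R) : (exists M, forall j, `|phi j| <= M) ->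
  Ex Q (fun nu => phi (nu [::])) = Ex mu phi.
Proof.
move=> phiM; apply: EFin_inj.
have bphi : bounded_rv phi by split => //.
rewrite -!Ex_EFin//; last exact: bounded_rv_label.
have ml := measurable_label [::].
pose Q1 : {measure set nat -> \bar R} := pushforward Q (fun nu : tree => nu [::] : nat).
pose Q2 := Q1 ml.
rewrite -[RHS](@eq_measure_integral _ _ _ setT mu Q2); last first.
  move=> A mA _; rewrite /Q2 /= /pushforward.
  have := QG (s := [:: [::]]) (fun=> A) erefl.
  rewrite big_seq1 => <-; congr (Q _); apply/seteqP; split => nu /=.
    by move=> h v; rewrite inE => /eqP ->.
  by apply; rewrite mem_head.
rewrite (integral_pushforward ml)// preimage_setT.
by apply: bounded_rv_integrable; exact: bounded_rv_label.
Qed.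

Lemma bounded_rv_subtree i (f : tree -> R) : bounded_rv f ->
  bounded_rv (fun nu => f (subtree i nu)).
Proof.
move=> [mf [M fM]]; split; last by exists M.
exact: (measurableT_comp mf (measurable_subtree i)).
Qed.

Lemma bounded_rv_offspring_sum X (F : nat -> tree -> R) :
  (forall i, bounded_rv (F i)) ->
  bounded_rv (fun nu => \sum_(i < noffspring X nu) F i nu).
Proof.
move=> bF; under [X in bounded_rv X]eq_fun do
  rewrite (sum_ord_le (fun i => F i _) (noffspring_le X _)).
apply: bounded_rv_sum => i; apply: bounded_rvM => //.
exact: (bounded_rv_offspring X (fun n => (i < n)%:R)).
Qed.

(** Wald's identity: the number of children is independent of their subtrees. *)
Lemma Ex_offspring_sum X (phi : nat -> R) (f : tree -> R) : bounded_rv f ->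
  Ex Q (fun nu => phi (noffspring X nu) *
                  \sum_(i < noffspring X nu) f (subtree i nu)) =
  Ex Q (fun nu => phi (noffspring X nu) * (noffspring X nu)%:R) * Ex Q f.
Proof.
move=> bf.
have bphi i : bounded_rv (fun nu => phi (noffspring X nu) *
    (i < noffspring X nu)%:R : R).
  exact: (bounded_rv_offspring X (fun n => phi n * (i < n)%:R)).
transitivity (Ex Q (fun nu => \sum_(i < X) f (subtree i nu) *
    (phi (noffspring X nu) * (i < noffspring X nu)%:R))).
  congr Ex; apply/funext => nu.
  rewrite (sum_ord_le (fun i => f (subtree i nu)) (noffspring_le X nu)) mulr_sumr.
  by apply: eq_bigr => i _; ring.
rewrite Ex_sum; last first.
  by move=> i; apply: bounded_rvM => //; exact: bounded_rv_subtree.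
transitivity (\sum_(i < X) Ex Q f *
    Ex Q (fun nu => phi (noffspring X nu) * (i < noffspring X nu)%:R)).
  by apply: eq_bigr => i _; rewrite (Ex_branching QG).
rewrite -mulr_sumr mulrC -Ex_sum//; congr (_ * _); congr Ex; apply/funext => nu.
rewrite -mulr_sumr; congr (_ * _).
rewrite -[in RHS](card_ord (noffspring X nu)) -sumr_const.
rewrite (sum_ord_le (fun=> 1) (noffspring_le X nu)).
by apply: eq_bigr => i _; rewrite mulr1.
Qed.

End offspring.

(** [gi] stands for the value of [g] at infinity: it starts the recursion at the
    boundary and dominates every later contribution. *)
Record conductance (R : realType) (g : R -> R) (gi : R) : Prop := Conductance {
  cond_nd : {homo g : x y / x <= y};
  cond0 : g 0 = 0;
  cond_le : forall x, g x <= gi;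
  cond_gt0 : forall x, 0 < x -> 0 < g x;
  cond_concave : concave_nneg g }.

Section recursion.
Context (R : realType) (Q : probability tree R) (mu : probability nat R).
Hypothesis QG : gw_tree Q mu.
Variables (g : R -> R) (gi : R).
Hypothesis Hg : conductance g gi.

Variables (X : nat) (r : R).
Hypothesis r0 : 0 < r.

Let N := noffspring X.

(** [gval k] is what a child cut at relative generation k contributes to its
    parent, that is g(B), and [bval k] is the value B at height k + 1.  Heights are
    shifted by one because B is infinite at height 0, whereas g(B) is finite
    at all heights. *)
Fixpoint gval (k : nat) (nu : tree) : R :=
  if k is k'.+1 then g (r * \sum_(i < N nu) gval k' (subtree i nu)) else gi.

Definition bval (k : nat) (nu : tree) : R :=
  r * \sum_(i < N nu) gval k (subtree i nu).

Lemma gvalS k nu : gval k.+1 nu = g (bval k nu).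
Proof. by []. Qed.

Lemma g_ge0 x : 0 <= x -> 0 <= g x.
Proof. by move=> x0; rewrite -(cond0 Hg); exact: (cond_nd Hg). Qed.

Lemma gi_gt0 : 0 < gi.
Proof. exact: lt_le_trans (cond_gt0 Hg ltr01) (cond_le Hg 1). Qed.

Lemma gval_ge0 k nu : 0 <= gval k nu.
Proof.
elim: k nu => [|k ih] nu /=; first exact/ltW/gi_gt0.
by apply: g_ge0; rewrite mulr_ge0 ?(ltW r0)// sumr_ge0.
Qed.

Lemma gval_le k nu : gval k nu <= gi.
Proof. by case: k => [//|k]; exact: (cond_le Hg). Qed.

Lemma bval_ge0 k nu : 0 <= bval k nu.
Proof. by rewrite mulr_ge0 ?(ltW r0)// sumr_ge0// => i _; exact: gval_ge0. Qed.

Lemma bounded_gval k : bounded_rv (gval k).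
Proof.
elim: k => [|k ih] /=; first exact: bounded_rv_cst.
have [m1 [M hM]] : bounded_rv (bval k).
  apply: bounded_rvZ; apply: (@bounded_rv_offspring_sum R X
    (fun i nu => gval k (subtree i nu))) => i.
  exact: bounded_rv_subtree.
split; last by exists gi => nu; rewrite ger0_norm ?g_ge0 ?bval_ge0// (cond_le Hg).
apply: (@measurableT_comp _ _ _ _ _ _ g) => //.
by apply: nondecreasing_measurable => // x y; exact: (cond_nd Hg).
Qed.

Lemma bounded_bval k : bounded_rv (bval k).
Proof.
apply: bounded_rvZ; apply: (@bounded_rv_offspring_sum R X
  (fun i nu => gval k (subtree i nu))) => i.
by apply: bounded_rv_subtree; exact: bounded_gval.
Qed.

Definition meanN : R := Ex Q (fun nu => (N nu)%:R).
Definition meang k : R := Ex Q (gval k).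

Lemma Ex_bval k : Ex Q (bval k) = r * (meanN * meang k).
Proof.
rewrite /bval ExZ; last first.
  apply: (@bounded_rv_offspring_sum R X (fun i nu => gval k (subtree i nu))) => i.
  by apply: bounded_rv_subtree; exact: bounded_gval.
congr (_ * _).
transitivity (Ex Q (fun nu => (fun=> 1) (N nu) *
    \sum_(i < N nu) gval k (subtree i nu))).
  by congr Ex; apply/funext => nu; rewrite mul1r.
rewrite [LHS](Ex_offspring_sum QG X (fun=> 1) (bounded_gval k)).
by congr (_ * _); congr Ex; apply/funext => nu; rewrite mul1r.
Qed.

Lemma meang_le k : meang k <= gi.
Proof.
rewrite /meang -[leRHS](Ex_cst Q); apply: Ex_le => [||nu].
- exact: bounded_gval.
- exact: bounded_rv_cst.
- exact: gval_le.
Qed.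

Lemma g_star t x : 0 <= t <= 1 -> 0 <= x -> t * g x <= g (t * x).
Proof.
move=> t01 x0; have := cond_concave Hg x0 (lexx 0) t01.
by rewrite (cond0 Hg) !mulr0 !addr0.
Qed.

Hypothesis meanN_gt0 : 0 < meanN.

Lemma meang_gt0 k : 0 < meang k.
Proof.
elim: k => [|k ih]; first by rewrite /meang Ex_cst gi_gt0.
have [_ [M hM]] := bounded_bval k.
have M0 : 0 <= M by apply: le_trans (hM (fun=> 0%N)).
have M1 : 0 < M + 1 by rewrite ltr_wpDl.
suff : Ex Q (fun nu => g (M + 1) / (M + 1) * bval k nu) <= meang k.+1.
  apply: lt_le_trans; rewrite ExZ; last exact: bounded_bval.
  by rewrite mulr_gt0// ?divr_gt0 ?(cond_gt0 Hg)// Ex_bval !mulr_gt0.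
apply: Ex_le => [||nu].
- by apply: bounded_rvZ; exact: bounded_bval.
- exact: (bounded_gval k.+1).
- rewrite gvalS.
  have h0 := bval_ge0 k nu.
  have h1 : bval k nu <= M.
    by apply: le_trans (hM nu); rewrite ler_norm.
  have M1n : M + 1 != 0 by rewrite gt_eqF.
  have -> : g (M + 1) / (M + 1) * bval k nu = bval k nu / (M + 1) * g (M + 1).
    by field.
  rewrite -[X in _ <= g X](divfK M1n); apply: g_star; last exact: ltW.
  rewrite divr_ge0 ?(ltW M1)//= ler_pdivrMr// mul1r (le_trans h1)// lerDl//.
Qed.

End recursion.

(** * Consequences of concavity *)

Section concave.
Context (R : realType) (g : R -> R).
Hypothesis g_conc : concave_nneg g.

Lemma concave_slope x y z : 0 <= x -> x < y -> y < z ->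
  (g z - g y) / (z - y) <= (g y - g x) / (y - x).
Proof.
move=> x0 xy yz.
have xz := lt_trans xy yz.
have zx : 0 < z - x by rewrite subr_gt0.
pose t := (z - y) / (z - x).
have t01 : 0 <= t <= 1.
  rewrite /t divr_ge0 ?subr_ge0 ?(ltW yz) ?(ltW xz)//= ler_pdivrMr// mul1r.
  by rewrite lerD2l lerN2 ltW.
have := g_conc x0 (ltW (le_lt_trans x0 xz)) t01.
have -> : t * x + (1 - t) * z = y.
  by rewrite /t; field; rewrite gt_eqF.
have -> : 1 - t = (y - x) / (z - x).
  by rewrite /t; field; rewrite gt_eqF.
rewrite /t => h.
rewrite ler_pdivrMr ?subr_gt0// mulrAC ler_pdivlMr ?subr_gt0//.
have := ler_wpM2r (ltW zx) h.
have -> : ((z - y) / (z - x) * g x + (y - x) / (z - x) * g z) * (z - x) =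
  (z - y) * g x + (y - x) * g z by field; rewrite gt_eqF.
lra.
Qed.

(** The slope is the supremum of the slopes of the chords to the right of t. *)
Lemma concave_supporting_line t : 0 < t ->
  exists sigma, forall x, 0 <= x -> g x <= g t + sigma * (x - t).
Proof.
move=> t0.
pose S := [set (g z - g t) / (z - t) | z in [set z | t < z]].
have ubS : ubound S ((g t - g 0) / (t - 0)).
  by move=> _ [z tz <-]; apply: concave_slope.
have S0 : S !=set0 by exists ((g (t + 1) - g t) / (t + 1 - t)); exists (t + 1) => //=; rewrite ltrDl.
exists (sup S) => x x0.
have [xt|tx|->] := ltgtP x t; last by rewrite subrr mulr0 addr0.
- have : sup S <= (g t - g x) / (t - x).
    apply: ge_sup => // _ [z tz <-]; exact: concave_slope.
  rewrite ler_pdivlMr ?subr_gt0//; lra.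
- have : (g x - g t) / (x - t) <= sup S.
    by apply: ub_le_sup; [exists ((g t - g 0) / (t - 0)) | exists x].
  rewrite ler_pdivrMr ?subr_gt0//; lra.
Qed.

End concave.

Section two_sided_bounds.
Context (R : realType) (s kappa : R).
Hypotheses (s0 : 0 < s) (k0 : 0 < kappa).

(** The deficit t - g(t) is of order t^(s+1) near 0 and of order 1, at least, away
    from 0; the truncated power covers both ranges. *)
Lemma conductance_upper (g : R -> R) : g 0 = 0 ->
  (forall x, 0 < x -> g x <= x / (1 + kappa * x `^ s) `^ s^-1) ->
  exists2 c, 0 < c & forall t, 0 <= t -> g t + c * Num.min t 1 `^ (s + 1) <= t.
Proof.
move=> g00 gub.
have [c0 c00 base] : exists2 c0, 0 < c0 &
    forall u, 0 <= u <= 1 -> 1 + c0 * u <= (1 + kappa * u) `^ s^-1.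
  have k1 : 0 < 1 + kappa by rewrite addr_gt0.
  exists (kappa / (s * (1 + kappa))); first by rewrite divr_gt0// mulr_gt0.
  move=> u /andP[u0 u1].
  have ku0 : 0 <= kappa * u by rewrite mulr_ge0// ltW.
  have si0 : 0 <= s^-1 by rewrite invr_ge0 ltW.
  apply: le_trans (powR_1D_ge ku0 si0); rewrite lerD2l.
  have -> : kappa / (s * (1 + kappa)) * u = s^-1 * (kappa * u / (1 + kappa)).
    by field; rewrite !gt_eqF.
  have w0 : 0 < 1 + kappa * u by rewrite ltr_wpDr.
  rewrite ler_wpM2l// ler_wpM2l// lef_pV2 ?posrE//.
  by rewrite lerD2l ler_piMr// ltW.
have c01 : 0 < 1 + c0 by rewrite addr_gt0.
exists (c0 / (1 + c0)); first by rewrite divr_gt0.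
move=> t; rewrite le_eqVlt => /predU1P[<-|t0].
  rewrite g00 add0r; have -> : Num.min 0 1 = 0 :> R by rewrite min_l.
  by rewrite powR0 ?mulr0// gt_eqF// addr_gt0.
have [t1|t1] := leP t 1.
  have u01 : 0 <= t `^ s <= 1.
    by rewrite powR_ge0/= powR_le1 ?(ltW t0) ?(ltW s0).
  have h := base _ u01; have h1 := gub t t0.
  have d0 : 0 < 1 + c0 * t `^ s.
    by rewrite ltr_wpDr// mulr_ge0 ?powR_ge0 ?ltW.
  have h2 : g t <= t / (1 + c0 * t `^ s).
    apply: le_trans h1 _; rewrite ler_wpM2l ?(ltW t0)// lef_pV2 ?posrE//.
    exact: lt_le_trans h.
  rewrite [s + 1]addrC powR_D1 ?(ltW t0)//; set u := t `^ s in u01 d0 h2 *.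
  move/andP: u01 => [u0 u1].
  have h3 : t / (1 + c0 * u) <= t - c0 / (1 + c0) * (t * u).
    rewrite ler_pdivrMr//.
    have -> : (t - c0 / (1 + c0) * (t * u)) * (1 + c0 * u) =
       t + t * (c0 * c0 / (1 + c0) * (u * (1 - u))).
      by field; rewrite gt_eqF.
    have u1' : 0 <= 1 - u by rewrite subr_ge0.
    by rewrite lerDl !mulr_ge0 ?invr_ge0//; exact: ltW.
  lra.
have h1 := gub t t0.
rewrite powR1 mulr1.
have h2 : g t <= t / (1 + c0).
  have ts1 : 1 <= t `^ s by rewrite powR_ge1 ?ltW.
  have k1 : 0 <= 1 + kappa * 1 by rewrite addr_ge0 ?mulr_ge0// ltW.
  have kle : 1 + kappa * 1 <= 1 + kappa * t `^ s by rewrite lerD2l ler_wpM2l// ltW.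
  have si0 : 0 <= s^-1 by rewrite invr_ge0 ltW.
  have cle : 1 + c0 <= (1 + kappa * t `^ s) `^ s^-1.
    have := base 1; rewrite mulr1 ler01 lexx => /(_ isT) /le_trans; apply.
    by apply: ge0_ler_powR; rewrite ?nnegrE// (le_trans k1).
  apply: le_trans h1 _; rewrite ler_wpM2l ?(ltW t0)// lef_pV2 ?posrE//.
  exact: lt_le_trans cle.
have : t / (1 + c0) <= t - c0 / (1 + c0).
  rewrite ler_pdivrMr// mulrBl divfK ?gt_eqF//.
  have : c0 <= t * c0 by rewrite ler_peMl ?ltW.
  lra.
lra.
Qed.

(** Follows from (1 + u)^(1/s) <= exp(u/s) and exp(-v) >= 1 - v. *)
Lemma conductance_lower (g : R -> R) : g 0 = 0 ->
  (forall x, 0 < x -> x / (1 + kappa * x `^ s) `^ s^-1 <= g x) ->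
  forall t, 0 <= t -> t - kappa / s * t `^ (s + 1) <= g t.
Proof.
move=> g00 glb t; rewrite le_eqVlt => /predU1P[<-|t0].
  by rewrite g00 powR0 ?mulr0 ?subrr// gt_eqF// addr_gt0.
apply: le_trans (glb t t0).
have u0 := powR_ge0 t s.
have ku0 : 0 <= kappa * t `^ s by rewrite mulr_ge0// ltW.
have si0 : 0 <= s^-1 by rewrite invr_ge0 ltW.
rewrite [s + 1]addrC powR_D1 ?(ltW t0)//.
have -> : t - kappa / s * (t * t `^ s) = t * (1 + - (s^-1 * (kappa * t `^ s))) by ring.
rewrite ler_wpM2l ?(ltW t0)//; apply: le_trans (expR_ge1Dx _) _.
have w0 : 0 < 1 + kappa * t `^ s by rewrite ltr_wpDr.
rewrite expRN lef_pV2 ?posrE ?expR_gt0 ?powR_gt0//.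
exact: powR_1D_le.
Qed.

End two_sided_bounds.

(** * Upper bound for the recursion of means *)

Section upper_recursion.
Context (R : realType) (Q : probability tree R) (mu : probability nat R).
Hypothesis QG : gw_tree Q mu.
Variables (g : R -> R) (gi : R).
Hypothesis Hg : conductance g gi.
Variables (X : nat) (r : R).
Hypothesis r0 : 0 < r.

Let N := noffspring X.
Local Notation gval := (gval g gi X r).
Local Notation bval := (bval g gi X r).
Local Notation meang := (meang Q g gi X r).

Lemma bounded_g_label (c : R) : 0 <= c ->
  exists M, forall j : nat, `|g (c * j%:R)| <= M.
Proof.
move=> c0; exists gi => j.
by rewrite ger0_norm ?(cond_le Hg)// (g_ge0 Hg)// mulr_ge0.
Qed.

(** Jensen's inequality given the number j of children: g is bounded above by its
    supporting line at r Y j, with Y the mean contribution of a child.  The slope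
    depends on j alone, so by Wald's identity the linear term has mean 0. *)
Lemma meang_jensen k : 0 < meang k ->
  meang k.+1 <= Ex Q (fun nu => g (r * meang k * (N nu)%:R)).
Proof.
move=> Y0; set Y := meang k in Y0 *.
have rY0 : 0 < r * Y by rewrite mulr_gt0.
(* the indicator removes j = 0, where there may be no supporting line; both sides
   of the lemma are then g 0 *)
have /choice[sigma Hs] : forall j : nat, exists sigma : R, forall x, 0 <= x ->
    g x * (j != 0%N)%:R <= (g (r * Y * j%:R) + sigma * (x - r * Y * j%:R)) * (j != 0%N)%:R.
  move=> [|j]; first by exists 0 => x _; rewrite !mulr0.
  have t0 : 0 < r * Y * j.+1%:R by rewrite mulr_gt0.
  have [sigma h] := concave_supporting_line (cond_concave Hg) t0.
  by exists sigma => x x0; rewrite !mulr1; exact: h.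
pose phi (j : nat) := sigma j * (j != 0%N)%:R.
have bphi := bounded_rv_offspring X (phi : nat -> R).
have bg : bounded_rv (fun nu => g (r * Y * (N nu)%:R)).
  exact: (bounded_rv_offspring X (fun j => g (r * Y * j%:R))).
have bS : bounded_rv (fun nu => \sum_(i < N nu) gval k (subtree i nu)).
  apply: (@bounded_rv_offspring_sum R X (fun i nu => gval k (subtree i nu))) => i.
  by apply: bounded_rv_subtree; exact: (bounded_gval Hg).
have b1 : bounded_rv (fun nu => r * (phi (N nu) * \sum_(i < N nu) gval k (subtree i nu))).
  by apply: bounded_rvZ; exact: bounded_rvM.
have b2 : bounded_rv (fun nu => r * Y * (phi (N nu) * (N nu)%:R)).
  apply: bounded_rvZ; apply: bounded_rvM => //.
  exact: (bounded_rv_offspring X (fun j => j%:R)).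
have -> : Ex Q (fun nu => g (r * Y * (N nu)%:R)) =
  Ex Q (fun nu => g (r * Y * (N nu)%:R) +
    (r * (phi (N nu) * \sum_(i < N nu) gval k (subtree i nu)) -
     r * Y * (phi (N nu) * (N nu)%:R))).
  rewrite ExD//; last exact: bounded_rvB.
  rewrite ExB// ExZ; last exact: bounded_rvM.
  rewrite [X in _ = _ + (r * X - _)](Ex_offspring_sum QG X phi (bounded_gval Hg X r0 k)).
  rewrite ExZ; last first.
    by apply: bounded_rvM => //; exact: (bounded_rv_offspring X (fun j => j%:R)).
  rewrite -/(meang k) -/Y; ring.
apply: Ex_le => [||nu].
- exact: (bounded_gval Hg X r0 k.+1).
- by apply: bounded_rvD => //; exact: bounded_rvB.
have b0 := bval_ge0 Hg X r0 k nu.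
have := Hs (N nu) _ b0; rewrite gvalS /phi.
case: (eqVneq (N nu) 0%N) => [N0|Nn0] /=; last first.
  rewrite !mulr1 => /le_trans; apply.
  by rewrite /bval -/N lerD2l le_eqVlt; apply/orP; left; apply/eqP; ring.
by move=> _; rewrite /bval -/N N0 big_ord0 !(mulr0, mul0r, subrr, addr0).
Qed.

Lemma meang_le_label k : 0 < meang k ->
  meang k.+1 <= Ex mu (fun j => g (r * meang k * j%:R)).
Proof.
move=> Y0; have rY0 : 0 < r * meang k by rewrite mulr_gt0.
apply: (le_trans (meang_jensen Y0)).
have bM := bounded_g_label (ltW rY0).
rewrite -(Ex_label QG bM); apply: Ex_le => [||nu].
- exact: (bounded_rv_offspring X (fun j => g (r * meang k * j%:R))).
- exact: (bounded_rv_label bM).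
apply: (cond_nd Hg); rewrite ler_pM2l// ler_nat; exact: geq_minl.
Qed.

End upper_recursion.

Section offspring_law.
Context (R : realType) (mu : probability nat R) (m : R).
Hypothesis hm : ('E_mu[fun k : nat => k%:R : R] = m%:E)%E.

Lemma Ex_linear_minorant (f1 f2 : nat -> R) y :
  0 <= y -> (forall j, 0 <= f1 j) -> (forall j, 0 <= f2 j) ->
  (exists M, forall j, `|f1 j| <= M) -> (exists M, forall j, `|f2 j| <= M) ->
  (forall j, f1 j + f2 j <= y * j%:R) -> Ex mu f1 + Ex mu f2 <= y * m.
Proof.
move=> y0 f10 f20 bf1 bf2 h.
have B1 : bounded_rv f1 by split.
have B2 : bounded_rv f2 by split.
have <- : Ex mu (fun j => f1 j + f2 j) = Ex mu f1 + Ex mu f2 by exact: ExD.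
rewrite -lee_fin -Ex_EFin; last exact: bounded_rvD.
rewrite EFinM -hm unlock -ge0_integralZl//.
apply: ge0_le_integral => //.
- by move=> j _; rewrite lee_fin addr_ge0.
- by move=> j _; rewrite -EFinM lee_fin h.
Qed.

(** The deficit min(y j, 1)^q is y^q times a power of j truncated at 1/y, so the
    loss per generation is a truncated moment of the offspring law. *)
Lemma Ex_conductance_le (g : R -> R) (c q y : R) :
  0 < y -> 0 <= c -> 0 < q -> (forall t, 0 <= t -> 0 <= g t) ->
  (exists M, forall t, 0 <= t -> g t <= M) ->
  (forall t, 0 <= t -> g t + c * Num.min t 1 `^ q <= t) ->
  Ex mu (fun j => g (y * j%:R)) +
    c * y `^ q * Ex mu (fun j => Num.min j%:R y^-1 `^ q) <= y * m.
Proof.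
move=> y0 c0 q0 g0 [M gM] gc.
have yi0 : 0 < y^-1 by rewrite invr_gt0.
have mb (j : nat) : 0 <= Num.min (j%:R : R) y^-1 <= y^-1.
  by rewrite le_min ler0n (ltW yi0)/= ge_min lexx orbT.
have bq : exists M', forall j : nat, `|Num.min (j%:R : R) y^-1 `^ q| <= M'.
  exists (y^-1 `^ q) => j; have /andP[a b] := mb j.
  rewrite ger0_norm ?powR_ge0//; apply: ge0_ler_powR; rewrite ?nnegrE ?(ltW q0)//.
  exact: ltW.
rewrite -ExZ; last by split.
apply: Ex_linear_minorant.
- exact: ltW.
- by move=> j; apply: g0; rewrite mulr_ge0// ltW.
- by move=> j; rewrite !mulr_ge0 ?powR_ge0.
- exists M => j; have h : 0 <= y * j%:R by rewrite mulr_ge0// ltW.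
  by rewrite ger0_norm ?g0// gM.
- have [M' hM'] := bq; exists (`|c * y `^ q| * M') => j.
  by rewrite normrM ler_wpM2l.
move=> j; have h : 0 <= y * j%:R by rewrite mulr_ge0// ltW.
apply: le_trans (gc _ h); rewrite lerD2l -mulrA ler_wpM2l//.
have /andP[a b] := mb j.
rewrite -powRM// ?(ltW y0)// minr_pMr ?(ltW y0)// divff ?gt_eqF//.
Qed.

End offspring_law.

(** * Regularly varying scale functions *)

(** What the recursions use of the regular variation of [h] with positive index: a
    Potter bound, which makes [h] grow at least like the power [beta], and a
    doubling bound, both uniform on bounded sets. *)
Record scale_function (R : realType) (h hi : R -> R) (beta : R) : Prop := Scale {
  scale_gt0 : forall x, 0 < x -> 0 < h x;
  scale_lt : forall x y, 0 < x -> x < y -> h x < h y;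
  scale_inv_gt0 : forall t, 0 < t -> 0 < hi t;
  scale_invK : forall t, 0 < t -> h (hi t) = t;
  scale_beta : 0 < beta;
  scale_potter : forall M, 0 < M -> exists2 C, 0 < C & forall x y,
    0 < x -> x <= y -> y <= M -> h x <= C * (x / y) `^ beta * h y;
  scale_doubling : forall M, 0 < M -> exists2 C, 0 < C & forall x,
    0 < x -> x <= M -> h (2 * x) <= C * h x }.

Section scale_theory.
Context (R : realType) (h hi : R -> R) (beta : R).
Hypothesis S : scale_function h hi beta.

Lemma scale_le x y : 0 < x -> x <= y -> h x <= h y.
Proof.
move=> x0; rewrite le_eqVlt => /predU1P[->//|xy].
by apply/ltW/(scale_lt S).
Qed.

Lemma scale_le_inv x t : 0 < x -> 0 < t -> (h x <= t) = (x <= hi t).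
Proof.
move=> x0 t0; have [xt|tx] := leP x (hi t).
  by rewrite -{1}(scale_invK S t0) scale_le.
by apply/negbTE; rewrite -ltNge -{1}(scale_invK S t0) (scale_lt S)// (scale_inv_gt0 S).
Qed.

Lemma scale_hK x : 0 < x -> hi (h x) = x.
Proof.
move=> x0; have hx := scale_gt0 S x0; have i0 := scale_inv_gt0 S hx.
have e := scale_invK S hx.
have [l|l|//] := ltgtP (hi (h x)) x.
  by have := scale_lt S i0 l; rewrite e ltxx.
by have := scale_lt S x0 l; rewrite e ltxx.
Qed.

Lemma scale_inv_le t u : 0 < t -> t <= u -> hi t <= hi u.
Proof.
move=> t0 tu; rewrite -scale_le_inv ?(scale_inv_gt0 S)//.
  by rewrite (scale_invK S).
exact: lt_le_trans tu.
Qed.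

Lemma scale_mul M lam : 0 < M -> 0 < lam -> exists2 C, 0 < C &
  forall x, 0 < x -> x <= M -> h (lam * x) <= C * h x.
Proof.
move=> M0 lam0; pose n := Num.bound lam.
have ln : lam <= 2 ^+ n by apply/ltW; exact: upper_nthrootP.
have [C C0 hC] : exists2 C, 0 < C &
    forall x, 0 < x -> x <= M -> h (2 ^+ n * x) <= C * h x.
  elim: n {ln} => [|n [C C0 ih]].
    by exists 1 => // x x0 _; rewrite expr0 !mul1r.
  have [D D0 hD] := scale_doubling S (mulr_gt0 (exprn_gt0 n (@ltr0n R 2)) M0).
  exists (D * C); first exact: mulr_gt0.
  move=> x x0 xM; rewrite exprS -mulrA; apply: (le_trans (hD _ _ _)).
  - by rewrite mulr_gt0// exprn_gt0.
  - by rewrite ler_pM2l// exprn_gt0.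
  - by rewrite -mulrA ler_pM2l//; exact: ih.
exists C => // x x0 xM; apply: le_trans (hC x x0 xM).
by apply: scale_le; [exact: mulr_gt0 | rewrite ler_pM2r].
Qed.

(** The Potter bound makes [h] grow at least like the power beta; inverted, it says
    that [hi] grows at most like the power 1/beta. *)
Lemma scale_inv_mul D lam : 0 < D -> 0 < lam -> exists2 C, 0 < C &
  forall t, 0 < t -> t <= D -> hi (lam * t) <= C * hi t.
Proof.
move=> D0 lam0.
have lD : 0 < lam * D by exact: mulr_gt0.
have [C C0 hC] := scale_potter S (scale_inv_gt0 S lD).
have b0 := scale_beta S.
pose K := Num.max 1 ((C * lam) `^ beta^-1).
have K0 : 0 < K by rewrite lt_max ltr01.
have K1 : 1 <= K by rewrite le_max lexx.
have CK : C * lam <= K `^ beta.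
  have Cl0 : 0 <= C * lam by rewrite mulr_ge0// ltW.
  rewrite -[leLHS](powRr1 Cl0) -(mulVf (lt0r_neq0 b0)) powRrM.
  apply: ge0_ler_powR; rewrite ?nnegrE ?powR_ge0 ?(ltW b0) ?(ltW K0)//.
  by rewrite le_max lexx orbT.
exists K => // t t0 tD.
have lt0 : 0 < lam * t by exact: mulr_gt0.
have x0 := scale_inv_gt0 S t0.
have Kx0 : 0 < K * hi t by exact: mulr_gt0.
have [Kx|Kx] := leP (K * hi t) (hi (lam * D)); last first.
  by apply/ltW/(le_lt_trans _ Kx)/scale_inv_le => //; rewrite ler_pM2l.
have := hC _ _ x0 _ Kx; rewrite ler_peMl ?(ltW x0)// => /(_ isT).
have -> : hi t / (K * hi t) = K^-1 by field; rewrite !gt_eqF.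
rewrite (scale_invK S)// => h1.
have h2 : lam * t <= h (K * hi t).
  rewrite -(ler_pM2l C0); apply: le_trans (_ : K `^ beta * t <= _).
    by rewrite mulrA ler_pM2r.
  have Kb : 0 < K `^ beta by rewrite powR_gt0.
  move: h1; rewrite -powR_inv1 ?(ltW K0)// -powRrM mulN1r powRN.
  rewrite -(ler_pM2l Kb) => /le_trans; apply.
  by rewrite le_eqVlt; apply/orP; left; apply/eqP; field; rewrite gt_eqF.
apply: le_trans (scale_inv_le lt0 h2) _.
by rewrite scale_hK.
Qed.

End scale_theory.

Section scale_of_equivalent.
Context (R : realType) (alpha : R) (L h : R -> R).
Hypothesis alpha1 : 1 < alpha.
Hypothesis hL : slowly_varying L.
Hypothesis hh : increasing_bijection_pos h.
Hypothesis hhL : h ~_(0^'+) (fun x : R => (L x^-1 * x `^ (alpha - 1))%R).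

Let f (x : R) := L x^-1 * x `^ (alpha - 1).

Lemma regular_gt0 x : 0 < x -> x <= 1 -> 0 < f x.
Proof.
have [_ L0 _] := hL; move=> x0 x1; rewrite mulr_gt0 ?powR_gt0// L0//.
by rewrite -invr1 lef_pV2 ?posrE.
Qed.

Lemma scale_equivalent eps : 0 < eps -> exists2 x0 : R, 0 < x0 <= 1 & forall x,
  0 < x -> x <= x0 -> (1 - eps) * f x <= h x <= (1 + eps) * f x.
Proof.
move=> e0; have /eqaddoP /(_ _ e0) := hhL.
move=> [d /= d0 Hd].
exists (Num.min 1 (d / 2)).
  by rewrite lt_min ltr01 divr_gt0//= ge_min lexx.
move=> x x0; rewrite le_min => /andP[x1 xd].
have := Hd x; rewrite /ball /= sub0r normrN gtr0_norm//.
have xd' : x < d by apply: le_lt_trans xd _; rewrite ltr_pdivrMr// ltr_pMr// ltr1n.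
move=> /(_ xd' x0); rewrite -[(h - _) x]/(h x - f x) -/(f x).
rewrite (gtr0_norm (regular_gt0 x0 x1)) ler_norml => /andP[a b].
apply/andP; split; lra.
Qed.

Lemma slowly_varying_half eps : 0 < eps -> exists2 x0 : R, 0 < x0 <= 1 & forall x,
  0 < x -> x <= x0 -> (1 - eps) * L x^-1 <= L (2 * x)^-1 <= (1 + eps) * L x^-1.
Proof.
move=> e0; have [_ L0 Ll] := hL.
have h2 : 0 < 2^-1 :> R by rewrite invr_gt0.
have /cvgrPdist_le /(_ _ e0) [M [_ HM]] := Ll _ h2.
pose M' := Num.max 1 (M + 1).
have M'0 : 0 < M' by rewrite lt_max ltr01.
exists (M'^-1); first by rewrite invr_gt0 M'0 invf_le1// le_max lexx.
move=> x x0 xM.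
have Mx : M' <= x^-1 by rewrite -(invrK M') lef_pV2 ?posrE ?invr_gt0.
have M1 : M < x^-1.
  by apply: lt_le_trans Mx; rewrite lt_max ltrDl ltr01 orbT.
have x1 : 1 <= x^-1 by apply: le_trans Mx; rewrite le_max lexx.
have Lx := L0 _ x1.
have := HM _ M1; rewrite invfM distrC ler_norml => /andP[a b].
apply/andP; split.
  by rewrite -ler_pdivlMr//; lra.
by rewrite -ler_pdivrMr//; lra.
Qed.

Let beta := (alpha - 1) / 2.

(** The ratio h(2x)/h(x) tends to 2^(alpha-1) = 2^(2 beta); giving up half of the
    exponent absorbs the slowly varying factor near 0.  The precision e is such
    that (1 - 3 e) 2^beta = 1. *)
Lemma scale_ratio : exists x0 C : R, [/\ 0 < x0, 0 < C & forall x,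
  0 < x -> x <= x0 -> 2 `^ beta * h x <= h (2 * x) <= C * h x].
Proof.
have b0 : 0 < beta by rewrite divr_gt0// subr_gt0.
pose e : R := (1 - 2 `^ (- beta)) / 3.
have t1 : 2 `^ (- beta) < 1.
  by rewrite powRN invf_lt1 ?powR_gt0// -[ltLHS](powRr0 2) /powR gt_eqF// ltr_expR
     ltr_pM2r// ln_gt0// ltr1n.
have t0 : 0 < 2 `^ (- beta) by rewrite powR_gt0.
have e0 : 0 < e by rewrite divr_gt0// subr_gt0.
have e1 : e < 1 by rewrite ltr_pdivrMr//; lra.
have [x1 /andP[x10 x11] H1] := scale_equivalent e0.
have [x2 /andP[x20 x21] H2] := slowly_varying_half e0.
exists (Num.min (x1 / 2) x2), ((1 + e) * (1 + e) / (1 - e) * 2 `^ (alpha - 1)); split.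
- by rewrite lt_min x20 divr_gt0.
- by rewrite mulr_gt0 ?powR_gt0// divr_gt0 ?subr_gt0// mulr_gt0// addr_gt0.
move=> x x0; rewrite le_min ler_pdivlMr// => /andP[xx1 xx2].
have xx1' : x <= x1 by apply: le_trans xx1; rewrite ler_pMr// ler1n.
have /andP[a1 a2] := H1 _ x0 xx1'.
have xx0 : 0 < 2 * x by rewrite mulr_gt0.
have /andP[b1 b2] : (1 - e) * f (2 * x) <= h (2 * x) <= (1 + e) * f (2 * x).
  by apply: H1 => //; rewrite mulrC.
have /andP[c1 c2] := H2 _ x0 xx2.
have fE : f (2 * x) = 2 `^ (alpha - 1) * (L (2 * x)^-1 * x `^ (alpha - 1)).
  by rewrite /f powRM ?(ltW x0)//; ring.
have f0 : 0 < f x by apply: regular_gt0 => //; exact: le_trans xx1' _.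
have p0 : 0 <= x `^ (alpha - 1) by exact: powR_ge0.
have w0 : 0 < 2 `^ (alpha - 1) :> R by rewrite powR_gt0.
have w2 : 2 `^ (alpha - 1) = 2 `^ beta * 2 `^ beta :> R.
  rewrite -powRD; last by rewrite pnatr_eq0 implybT.
  by congr (_ `^ _); rewrite /beta; field.
have f1 : 2 `^ (alpha - 1) * ((1 - e) * f x) <= f (2 * x).
  by rewrite fE ler_pM2l// /f mulrA ler_wpM2r.
have f2 : f (2 * x) <= 2 `^ (alpha - 1) * ((1 + e) * f x).
  by rewrite fE ler_pM2l// /f mulrA ler_wpM2r.
have e1' : 0 < 1 - e by rewrite subr_gt0.
have e2' : 0 < 1 + e by rewrite addr_gt0.
apply/andP; split.
  apply: le_trans b1; apply: (@le_trans _ _ ((1 - e) * (2 `^ (alpha - 1) * ((1 - e) * f x)))); last by rewrite ler_pM2l.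
  apply: (@le_trans _ _ (2 `^ beta * ((1 + e) * f x))); first by rewrite ler_pM2l// powR_gt0.
  rewrite w2 -subr_ge0.
  have -> : (1 - e) * (2 `^ beta * 2 `^ beta * ((1 - e) * f x)) -
     2 `^ beta * ((1 + e) * f x) = 2 `^ beta * f x * ((1 - e) * (1 - e) * 2 `^ beta - (1 + e)).
    by ring.
  apply: mulr_ge0; first by apply: mulr_ge0; [exact: powR_ge0 | exact: ltW].
  rewrite subr_ge0.
  have : (1 - 3 * e) * (1 + e) * 2 `^ beta <= (1 - e) * (1 - e) * 2 `^ beta.
    rewrite ler_wpM2r ?powR_ge0//; have := sqr_ge0 e; rewrite expr2; lra.
  apply: le_trans; rewrite /e.
  have -> : 1 - 3 * ((1 - 2 `^ (- beta)) / 3) = 2 `^ (- beta) :> R by field.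
  by rewrite powRN mulrAC mulVf ?mul1r// gt_eqF// powR_gt0.
apply: (le_trans b2).
apply: (@le_trans _ _ ((1 + e) * (2 `^ (alpha - 1) * ((1 + e) * f x)))); first by rewrite ler_pM2l.
have -> : (1 + e) * (2 `^ (alpha - 1) * ((1 + e) * f x)) =
  (1 + e) * (1 + e) / (1 - e) * 2 `^ (alpha - 1) * ((1 - e) * f x).
  by field; rewrite gt_eqF.
rewrite ler_pM2l// !mulr_gt0 ?invr_gt0//.
Qed.

(** Iterating the doubling ratio gives the Potter bound along dyadic multiples;
    monotonicity of [h] fills the gaps between them, and provides bounds above and
    below away from 0. *)
Lemma bijection_scale : scale_function h (inv_pos h) beta.
Proof.
have [[hfun hinj hsurj] hmono] := hh.
have pos x : 0 < x -> (`]0, +oo[%classic : set R) x by move=> x0 /=; rewrite in_itv/= x0.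
have posE x : (`]0, +oo[%classic : set R) x -> 0 < x by rewrite /= in_itv/= andbT.
have h0 x : 0 < x -> 0 < h x by move=> x0; apply: posE; apply: hfun; exact: pos.
have hlt x y : 0 < x -> x < y -> h x < h y.
  move=> x0 xy; apply: hmono => //; rewrite inE; apply: pos => //.
  exact: lt_trans xy.
have hle x y : 0 < x -> x <= y -> h x <= h y.
  by move=> x0; rewrite le_eqVlt => /predU1P[->//|xy]; apply/ltW/hlt.
have b0 : 0 < beta by rewrite divr_gt0// subr_gt0.
have [x0 [C [x00 C0 HC]]] := scale_ratio.
have th0 : 0 < 2 `^ beta :> R by rewrite powR_gt0.
have potter n x y : 0 < x -> x <= y -> y <= x0 -> y < 2 ^+ n * x ->
    h x <= 2 `^ beta * (x / y) `^ beta * h y.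
  elim: n x => [|n ih] x xp xy yx0; first by rewrite expr0 mul1r ltNge xy.
  move=> yn; have yp : 0 < y by exact: lt_le_trans xy.
  have [y2|y2] := ltP y (2 * x).
    apply: (le_trans (hle _ _ xp xy)); rewrite ler_peMl ?(ltW (h0 _ yp))//.
    rewrite -powRM ?divr_ge0 ?(ltW xp) ?(ltW yp)// powR_ge1 ?(ltW b0)//.
    by rewrite mulrA ler_pdivlMr// mul1r ltW.
  have xx0 : 0 < 2 * x by rewrite mulr_gt0.
  have h1 : h (2 * x) <= 2 `^ beta * (2 * x / y) `^ beta * h y.
    by apply: ih => //; rewrite mulrA -exprSr.
  have /andP[h2 _] := HC _ xp (le_trans xy yx0).
  rewrite -(ler_pM2l th0); apply: (le_trans h2); apply: (le_trans h1).
  rewrite -[2 * x / y]mulrA powRM ?divr_ge0 ?(ltW xp) ?(ltW yp)//.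
  by rewrite le_eqVlt; apply/orP; left; apply/eqP; ring.
have potter' x y : 0 < x -> x <= y -> y <= x0 ->
    h x <= 2 `^ beta * (x / y) `^ beta * h y.
  move=> xp xy yx0; apply: (potter (Num.bound (y / x))) => //.
  by rewrite -ltr_pdivrMr// upper_nthrootP.
split => //.
- move=> t t0; apply: posE.
  have [/= f1 _ _] := bijpinv_bij (fun=> 0 : R) (And3 hfun hinj hsurj).
  by apply: f1; exact: pos.
- move=> t t0; apply: (surjpK (fun=> 0 : R) hsurj).
  by rewrite inE; exact: pos.
- move=> M M0; pose M' := Num.max M x0.
  have M'0 : 0 < M' by rewrite lt_max M0.
  have Mx0 : 1 <= M' / x0 by rewrite ler_pdivlMr// mul1r le_max lexx orbT.
  exists (2 `^ beta * (M' / x0) `^ beta).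
    by rewrite mulr_gt0// powR_gt0// divr_gt0.
  move=> x y xp xy yM; have yp : 0 < y by exact: lt_le_trans xy.
  have two1 : 1 <= 2 `^ beta :> R by rewrite powR_ge1 ?ler1n ?ltW.
  have [yx0|yx0] := leP y x0.
    apply: (le_trans (potter' _ _ xp xy yx0)).
    rewrite ler_pM2r ?h0// ler_pM2r ?powR_gt0 ?divr_gt0//.
    by rewrite ler_peMr ?(ltW th0)// powR_ge1// ltW.
  have yM' : y <= M' by rewrite le_max yM.
  have Mp : 0 <= M' / x0 by rewrite divr_ge0 ?ltW.
  have xyp : 0 <= x / y by rewrite divr_ge0 ?ltW.
  have eM : (M' / x0) `^ beta * (x / y) `^ beta = (x / x0 * (M' / y)) `^ beta.
    by rewrite -powRM//; congr (_ `^ _); field; rewrite !gt_eqF.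
  rewrite -[2 `^ beta * _ * _]mulrA eM.
  have M'y : 1 <= M' / y by rewrite ler_pdivlMr// mul1r.
  have [xx0|xx0] := leP x x0.
    apply: (le_trans (potter' _ _ xp xx0 (lexx _))).
    apply: (@le_trans _ _ (2 `^ beta * (x / x0) `^ beta * h y)).
      rewrite ler_pM2l ?mulr_gt0 ?powR_gt0 ?divr_gt0//.
      by apply: hle => //; exact: ltW.
    have xx00 : 0 <= x / x0 by rewrite divr_ge0 ?ltW.
    rewrite ler_pM2r ?h0// ler_pM2l//; apply: ge0_ler_powR; rewrite ?nnegrE ?(ltW b0)//.
      by rewrite mulr_ge0// (le_trans _ M'y).
    by rewrite ler_peMr.
  apply: (le_trans (hle _ _ xp xy)); rewrite ler_peMl ?(ltW (h0 _ yp))//.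
  apply: mulr_ege1 => //; apply: powR_ge1; last exact: ltW.
  by apply: mulr_ege1 => //; rewrite ler_pdivlMr// mul1r ltW.
- move=> M M0.
  exists (Num.max C (h (2 * M) / h x0)); first by rewrite lt_max C0.
  move=> x xp xM; have [xx0|xx0] := leP x x0.
    have /andP[_ h2] := HC _ xp xx0; apply: (le_trans h2).
    by rewrite ler_pM2r ?h0// le_max lexx.
  apply: (@le_trans _ _ (h (2 * M) / h x0 * h x)); last first.
    by rewrite ler_pM2r ?h0// le_max lexx orbT.
  apply: (@le_trans _ _ (h (2 * M))).
    by apply: hle; rewrite ?mulr_gt0// ler_pM2l.
  rewrite -mulrAC ler_pdivlMr ?h0// ler_pM2l ?h0 ?mulr_gt0//.
  by apply: hle => //; exact: ltW.
Qed.

End scale_of_equivalent.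

(** * Deterministic recursions *)

Section upper_sequences.
Context (R : realType) (h hi : R -> R) (beta : R).
Hypothesis S : scale_function h hi beta.

(** The model is u' = - c u h(u) with h a power of exponent beta, for which
    u^(-beta) grows linearly.  The Potter bound compares each h(u_k) with h(u_n),
    so that the same computation, with time n as reference, bounds n h(u_n). *)
Lemma decay_rate c M : 0 < c -> 0 < M -> exists2 C, 0 < C &
  forall (u : nat -> R) n, (forall k, 0 < u k) -> u 0%N <= M ->
  (forall k, (k < n)%N -> u k.+1 <= u k * (1 - c * h (u k))) ->
  h (u n) <= C / n.+1%:R.
Proof.
move=> c0 M0; have [C4 C40 H4] := scale_potter S M0; have b0 := scale_beta S.
have hM0 := scale_gt0 S M0.
exists (C4 / (beta * c) + h M); first by rewrite addr_gt0// divr_gt0// mulr_gt0.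
move=> u n u0 uM hu.
have h0 k := scale_gt0 S (u0 k).
have dec k : (k < n)%N -> u k.+1 <= u k.
  move=> kn; apply: (le_trans (hu k kn)).
  by rewrite ler_piMr ?(ltW (u0 k))// gerBl mulr_ge0 ?ltW.
have uleM k : (k <= n)%N -> u k <= M.
  by elim: k => // k ih kn; apply: (le_trans (dec k kn)); apply: ih; exact: ltnW.
have unle k : (k <= n)%N -> u n <= u k.
  move=> kn; have : forall j, (k + j <= n)%N -> u (k + j)%N <= u k.
    elim=> [|j ih] jn; first by rewrite addn0.
    rewrite addnS in jn *; apply: (le_trans (dec _ jn)); apply: ih; exact: ltnW.
  by move=> /(_ (n - k)%N); rewrite subnKC//; apply.
(* w is the power u^(-beta), normalised to be 1 at time n: each step increases
   it by at least dl, so n * dl <= 1 *)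
pose w k := (u n / u k) `^ beta.
pose dl := beta * c * h (u n) / C4.
have wstep k : (k < n)%N -> w k + dl <= w k.+1.
  move=> kn; have uk := u0 k; have uk1 := u0 k.+1; have un := u0 n.
  have z0 : 0 < c * h (u k) by rewrite mulr_gt0.
  have z1 : 0 < 1 - c * h (u k).
    by rewrite -(pmulr_rgt0 _ uk); apply: lt_le_trans (hu k kn).
  have w0 : 0 <= w k by exact: powR_ge0.
  have step : w k * (1 + beta * (c * h (u k))) <= w k.+1.
    apply: (@le_trans _ _ (w k * (1 - c * h (u k)) `^ (- beta))).
      rewrite ler_wpM2l// /powR gt_eqF//; apply: le_trans (expR_ge1Dx _).
      rewrite lerD2l mulNr -mulrN ler_pM2l// lerNr.
      by rewrite le_ln1Dx// ltrN2 -subr_gt0.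
    rewrite powRN ler_pdivrMr ?powR_gt0// -powRM; last 2 first.
    - by rewrite divr_ge0 ?ltW.
    - exact: ltW.
    have q0 : 0 <= u n / u k by rewrite divr_ge0 ?ltW.
    have q1 : 0 <= u n / u k.+1 * (1 - c * h (u k)).
      by rewrite mulr_ge0 ?divr_ge0 ?ltW.
    apply: ge0_ler_powR; rewrite ?nnegrE ?(ltW b0)//.
    rewrite -mulrA ler_pM2l// mulrC ler_pdivlMr// mulrC ler_pdivrMr//.
    by rewrite mulrC hu.
  apply: le_trans step; rewrite mulrDr mulr1 lerD2l.
  have := H4 _ _ un (unle _ (ltnW kn)) (uleM _ (ltnW kn)); rewrite -/(w k) => h4.
  rewrite /dl ler_pdivrMr//.
  have -> : w k * (beta * (c * h (u k))) * C4 = beta * c * (C4 * w k * h (u k)) by ring.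
  by rewrite ler_pM2l// mulr_gt0.
have wn : forall k, (k <= n)%N -> k%:R * dl <= w k.
  elim=> [|k ih] kn; first by rewrite mul0r powR_ge0.
  apply: le_trans (wstep k kn); rewrite -natr1 mulrDl mul1r lerD2r; apply: ih.
  exact: ltnW.
have := wn n (leqnn n); rewrite /w divff ?gt_eqF// powR1 /dl => hn.
have hb : n%:R * h (u n) <= C4 / (beta * c).
  have bc : 0 < beta * c by rewrite mulr_gt0.
  rewrite ler_pdivlMr//.
  have -> : n%:R * h (u n) * (beta * c) = n%:R * (beta * c * h (u n) / C4) * C4.
    by field; rewrite gt_eqF.
  by rewrite ger_pMl.
rewrite ler_pdivlMr// mulrC -natr1 mulrDl mul1r lerD//.
by apply: scale_le S _ _ (u0 n) _; exact: uleM.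
Qed.

Section upper_regimes.
Variables (c M K a0 : R).
Hypotheses (c0 : 0 < c) (M0 : 0 < M) (K0 : 0 < K) (a00 : 0 < a0).

Definition upper_sequence (a : R) (x : nat -> R) :=
  [/\ forall k, 0 < x k, forall k, x k <= M &
      forall k, x k.+1 <= a * x k * (1 - c * h (x k))].

Lemma upper_sequence_lt1 a x k : 0 < a -> upper_sequence a x ->
  0 < 1 - c * h (x k).
Proof.
move=> a_gt0 [x0 _ hx]; have := lt_le_trans (x0 k.+1) (hx k).
by rewrite pmulr_rgt0// mulr_gt0.
Qed.

(** While the drift c h(x) exceeds twice the growth dl, half of it remains and
    [decay_rate] applies; since 1/n <= dl, either this lasts up to time n, or the
    sequence has met the level where the two balance, and can then overshoot it by
    at most one factor 1 + K. *)
Lemma upper_supercritical : exists2 C, 0 < C & forall a dl x n, 0 < a -> 0 < dl ->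
  dl <= K -> (n.+1%:R)^-1 <= dl -> a <= 1 + dl -> upper_sequence a x ->
  x n <= C * hi dl.
Proof.
have [C1 C10 H1] := decay_rate (divr_gt0 c0 (@ltr0n R 2)) M0.
have [C2 C20 H2] := scale_inv_mul S K0 C10.
have [C3 C30 H3] := scale_inv_mul S K0 (divr_gt0 (@ltr0n R 2) c0).
exists (C2 + (1 + K) * C3).
  by rewrite addr_gt0// mulr_gt0// addr_gt0.
move=> a dl x n a_gt0 dl0 dlK ndl adl xa.
have [xp xM hx] := xa.
have hp k := scale_gt0 S (xp k).
have hidl := scale_inv_gt0 S dl0.
have big k : 2 * dl <= c * h (x k) -> x k.+1 <= x k * (1 - c / 2 * h (x k)).
  move=> hk; apply: (le_trans (hx k)).
  have -> : a * x k * (1 - c * h (x k)) = x k * (a * (1 - c * h (x k))) by ring.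
  rewrite ler_pM2l//.
  have l1 := upper_sequence_lt1 k a_gt0 xa.
  apply: (@le_trans _ _ ((1 + dl) * (1 - c * h (x k)))).
    by rewrite ler_pM2r.
  have := mulr_gt0 dl0 (mulr_gt0 c0 (hp k)); lra.
have [hall|] := pselect (forall k, (k < n)%N -> 2 * dl <= c * h (x k)).
  have := H1 x n xp (xM 0%N) (fun k kn => big k (hall k kn)).
  move=> hxn; apply: (@le_trans _ _ (C2 * hi dl)); last first.
    by rewrite ler_wpM2r ?(ltW hidl)// lerDl mulr_ge0 ?addr_ge0 ?ltW.
  apply: le_trans (H2 dl dl0 dlK).
  rewrite -(scale_le_inv S) ?mulr_gt0//; apply: (le_trans hxn).
  by rewrite ler_pM2l.
move=> /existsNP[k /not_implyP[kn /negP]]; rewrite -ltNge => hk.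
pose B := (1 + K) * hi (2 / c * dl).
have dc0 : 0 < 2 / c * dl by rewrite mulr_gt0// divr_gt0.
have small j : c * h (x j) < 2 * dl -> x j <= hi (2 / c * dl).
  move=> hj; rewrite -(scale_le_inv S)// mulrAC ler_pdivlMr// mulrC; exact: ltW.
have hd0 := scale_inv_gt0 S dc0.
have hB : hi (2 / c * dl) <= B by rewrite /B ler_peMl ?(ltW hd0)// lerDl ltW.
have all j : x (k + j)%N <= B.
  elim: j => [|j ih]; first by rewrite addn0 (le_trans (small _ hk)).
  rewrite addnS; have [hj|hj] := leP (2 * dl) (c * h (x (k + j)%N)).
    apply: le_trans ih; apply: (le_trans (big _ hj)).
    rewrite ler_piMr ?(ltW (xp _))// gerBl mulr_ge0 ?(ltW (hp _))//.
    by rewrite divr_ge0 ?ltW.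
  apply: (le_trans (hx _)).
  have l1 := upper_sequence_lt1 (k + j) a_gt0 xa.
  apply: (@le_trans _ _ (a * x (k + j)%N)).
    rewrite ler_piMr ?mulr_ge0 ?(ltW a_gt0) ?(ltW (xp _))// gerBl mulr_ge0 ?(ltW (hp _))//.
    exact: ltW.
  apply: ler_pM; rewrite ?(ltW a_gt0) ?(ltW (xp _)) ?small//.
  by apply: (le_trans adl); rewrite lerD2l.
apply: (@le_trans _ _ ((1 + K) * C3 * hi dl)); last first.
  by rewrite ler_wpM2r ?(ltW hidl)// lerDr ltW.
have := all (n - k)%N; rewrite subnKC ?(ltnW kn)// => /le_trans; apply.
by rewrite /B -[leRHS]mulrA ler_pM2l ?H3// addr_gt0.
Qed.

(** Below criticality the drift is felt for about J = 1/(1-a) steps, which bring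
    the sequence down to hi(1-a); afterwards the decay is geometric, and the J
    powers of a lost at the beginning cost a constant factor since a^J is bounded
    below. *)
Lemma upper_subcritical : exists2 C, 0 < C & forall a x n, a0 <= a ->
  a <= 1 - (n.+1%:R)^-1 -> upper_sequence a x ->
  x n <= C * (hi (1 - a) * a ^+ n.+1).
Proof.
have [C1 C10 H1] := decay_rate c0 M0.
have [C2 C20 H2] := scale_inv_mul S (@ltr01 R) (mulr_gt0 (@ltr0n R 2) C10).
exists (C2 * expR (a0^-1)); first by rewrite mulr_gt0 ?expR_gt0.
move=> a x n a0a an xa; have [xp xM hx] := xa.
have a_gt0 : 0 < a by exact: lt_le_trans a0a.
have d0 : 0 < 1 - a.
  by rewrite subr_gt0 (le_lt_trans an)// gtrBl invr_gt0.
have d1 : 1 - a <= 1 by rewrite gerBl ltW.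
have hp k := scale_gt0 S (xp k).
have i1 : 1 <= (1 - a)^-1 by rewrite -[leLHS]invr1 lef_pV2 ?posrE ?ltr01.
have [J J1 J2] : exists2 J : nat, J%:R <= (1 - a)^-1 & (1 - a)^-1 < J.+1%:R.
  have /andP[] := truncn_itv (ltW (lt_le_trans ltr01 i1)).
  by exists (Num.truncn (1 - a)^-1).
have J0 : (0 < J)%N.
  by rewrite lt0n; apply/eqP => J0; move: J2; rewrite J0 ltNge i1.
have Jn : (J <= n.+1)%N.
  rewrite -(ler_nat R); apply: (le_trans J1).
  rewrite -[leRHS]invrK lef_pV2 ?posrE ?invr_gt0//.
  by rewrite lerBrDl -lerBrDr.
have Jp : 0 < J%:R :> R by rewrite ltr0n.
have step k : x k.+1 <= x k * (1 - c * h (x k)).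
  apply: (le_trans (hx k)); rewrite ler_pM2r ?(upper_sequence_lt1 _ a_gt0 xa)//.
  by rewrite ler_piMl ?(ltW (xp k))// -subr_ge0 ltW.
have geo j k : x (k + j)%N <= a ^+ j * x k.
  elim: j => [|j ih]; first by rewrite addn0 expr0 mul1r.
  rewrite addnS exprS; apply: (le_trans (hx _)).
  apply: (@le_trans _ _ (a * x (k + j)%N)).
    rewrite ler_piMr ?mulr_ge0 ?(ltW a_gt0) ?(ltW (xp _))// gerBl mulr_ge0 ?(ltW (hp _))//.
    exact: ltW.
  by rewrite -mulrA ler_pM2l.
have hJ : x J.-1 <= C2 * hi (1 - a).
  apply: le_trans (H2 _ d0 d1).
  rewrite -(scale_le_inv S) ?mulr_gt0//; apply: (le_trans (H1 x J.-1 xp (xM _) (fun k _ => step k))).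
  rewrite prednK// ler_pdivrMr//.
  have : (1 - a)^-1 * (1 - a) <= 2 * J%:R * (1 - a).
    rewrite ler_pM2r//; apply: (le_trans (ltW J2)).
    by rewrite -natr1 mulr_natl mulr2n lerD2l ler1n.
  rewrite mulVf ?gt_eqF// => hj.
  have -> : 2 * C1 * (1 - a) * J%:R = C1 * (2 * J%:R * (1 - a)) by ring.
  by rewrite ler_peMr ?(ltW C10).
have aJ : 1 <= expR (a0^-1) * a ^+ J.
  have ea : a^-1 <= expR ((1 - a) / a).
    by apply: le_trans (expR_ge1Dx _); rewrite mulrBl mul1r divff ?gt_eqF// addrC subrK.
  have : (a^-1) ^+ J <= expR ((1 - a) / a) ^+ J.
    by apply: lerXn2r; rewrite ?nnegrE ?expR_ge0// invr_ge0 ltW.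
  rewrite exprVn -expRM_natl => h1.
  rewrite -ler_pdivrMr ?exprn_gt0// mul1r; apply: (le_trans h1).
  rewrite ler_expR mulrA; apply: (@le_trans _ _ (1 / a)).
    rewrite ler_pM2r ?invr_gt0//.
    by rewrite -ler_pdivlMr// mul1r.
  by rewrite mul1r lef_pV2 ?posrE.
have nE : n = (J.-1 + (n.+1 - J))%N.
  by apply/eqP; rewrite -eqSS -addSn prednK// subnKC.
have -> : x n = x (J.-1 + (n.+1 - J))%N by rewrite -nE.
apply: (le_trans (geo _ _)).
have -> : a ^+ n.+1 = a ^+ ((n.+1 - J) + J) by rewrite subnK.
rewrite exprD; set A := a ^+ (n.+1 - J).
have A0 : 0 < A by rewrite exprn_gt0.
have -> : C2 * expR a0^-1 * (hi (1 - a) * (A * a ^+ J)) =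
  A * (C2 * hi (1 - a) * (expR a0^-1 * a ^+ J)) by ring.
rewrite ler_pM2l//; apply: (le_trans hJ).
by rewrite ler_peMr// mulr_ge0 ?(ltW C20)// ltW// (scale_inv_gt0 S).
Qed.

End upper_regimes.

End upper_sequences.

Section lower_sequences.
Context (R : realType) (s D B xmin : R).
Hypotheses (s0 : 0 < s) (D0 : 0 < D) (B0 : 0 < B) (xmin0 : 0 < xmin).

(** The inequality is required for every [y] below [x k]: this makes it monotone,
    so that any sequence solving the recursion bounds [x] from below. *)
Definition lower_sequence (a dl y0 : R) (x : nat -> R) :=
  xmin <= x 0%N /\ forall k y, 0 <= y -> y <= x k ->
    a * (1 - dl / 4) * (y * (1 - D * dl * (y / y0) `^ s)) <= x k.+1.

Lemma small_power E : 0 < E -> exists2 eta, 0 < eta & eta `^ s <= E.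
Proof.
move=> E0; exists (E `^ s^-1); first by rewrite powR_gt0.
by rewrite -powRrM mulVf ?gt_eqF// powRr1// ltW.
Qed.

Lemma le_powR_cancel x y : 0 <= x -> 0 <= y -> x `^ s <= y `^ s -> x <= y.
Proof.
move=> x0 y0; rewrite leNgt => /negP h; rewrite leNgt; apply/negP => yx.
by apply: h; apply: gt0_ltr_powR; rewrite ?nnegrE.
Qed.

(** A geometric series of ratio a^s is thus at most of order 1/(1-a). *)
Lemma one_sub_powR a : 0 < a -> a <= 1 -> 1 - a <= Num.max 1 s^-1 * (1 - a `^ s).
Proof.
move=> a0 a1; have as1 : a `^ s <= 1 by rewrite powR_le1 ?(ltW a0) ?(ltW s0).
have q0 : 0 <= 1 - a `^ s by rewrite subr_ge0.
have [s1|s1] := leP s 1.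
  apply: (@le_trans _ _ (s^-1 * (1 - a `^ s))); last first.
    by rewrite ler_wpM2r// le_max lexx orbT.
  rewrite ler_pdivlMl//.
  have := @powR_concave_tangent R a s (ltW a0); rewrite s0 s1 => /(_ isT); lra.
apply: (@le_trans _ _ (1 * (1 - a `^ s))); last first.
  by rewrite ler_wpM2r// le_max lexx.
rewrite mul1r lerD2l lerN2 -[leRHS](powRr1 (ltW a0)).
by rewrite ger_powR ?a0//= ltW.
Qed.

Lemma pow_one_sub_inv n : expR (-1) <= (1 - (n.+1%:R)^-1) ^+ n :> R.
Proof.
case: n => [|n]; first by rewrite expr0 expR_le1 lerNl oppr0.
have n0 : 0 < n.+1%:R :> R by rewrite ltr0n.
have -> : 1 - (n.+2%:R)^-1 = (1 + (n.+1%:R)^-1)^-1 :> R.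
  have e : n.+2%:R = n.+1%:R + 1 :> R by rewrite -natr1.
  by rewrite e; field; rewrite !gt_eqF// addr_gt0.
rewrite exprVn expRN lef_pV2 ?posrE ?expR_gt0 ?exprn_gt0 ?addr_gt0 ?invr_gt0//.
apply: (@le_trans _ _ (expR (n.+1%:R^-1) ^+ n.+1)).
  by apply: lerXn2r; rewrite ?nnegrE ?expR_ge0 ?expR_ge1Dx// addr_ge0// invr_ge0 ltW.
by rewrite -expRM_natl divff ?gt_eqF.
Qed.

(** Starting from a small multiple eta of the balance level y0, the nonlinear loss
    is dominated by what the linear factor can afford.  Above criticality,
    (1 + dl)(1 - dl/4)^2 >= 1 keeps the level eta y0 invariant.  In the critical
    window each step costs a factor (1 - 1/n)^3 at worst, which stays bounded below
    over n steps.  Below criticality, y decreases like a^k, so the relative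
    losses decrease like a^(s k); their sum remains at most 1/2 even when the
    starting level is raised by the factor (n (1 - a))^(1/s). *)
Lemma lower_sequence_bounds : exists2 eta, 0 < eta &
  forall a dl y0 x n, 0 < a -> 0 < dl -> dl <= 1 -> 0 < y0 -> y0 `^ s <= B * dl ->
  lower_sequence a dl y0 x ->
  [/\ 1 + dl <= a -> eta * y0 <= x n,
      dl <= (n.+1%:R)^-1 -> 1 - (n.+1%:R)^-1 <= a -> eta * y0 <= x n &
      dl <= (n.+1%:R)^-1 -> a <= 1 - (n.+1%:R)^-1 ->
        eta * (y0 * (n.+1%:R * (1 - a)) `^ s^-1 * a ^+ n.+1) <= x n].
Proof.
pose Cs := Num.max 1 s^-1.
have Cs0 : 0 < Cs by rewrite lt_max ltr01.
(* the three bounds on eta^s serve, in turn, the loss in one step, the total loss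
   below criticality, and the comparison of the starting level with xmin *)
pose E := Num.min (4^-1 / D) (Num.min (2^-1 / (D * Cs)) (xmin `^ s / B)).
have E0 : 0 < E.
  by rewrite !lt_min !divr_gt0 ?powR_gt0 ?invr_gt0 ?mulr_gt0.
have [eta eta0 etaE] := small_power E0.
have /and3P[e1 e2 e3] : [&& D * eta `^ s <= 4^-1, D * Cs * eta `^ s <= 2^-1 &
    B * eta `^ s <= xmin `^ s].
  move: etaE; rewrite !le_min !ler_pdivlMr ?mulr_gt0// => /and3P[h1 h2 h3].
  by apply/and3P; split; rewrite mulrC.
have es0 : 0 < eta `^ s by rewrite powR_gt0.
exists (expR (- 3) / 2 * eta); first by rewrite !mulr_gt0 ?expR_gt0.
move=> a dl y0 x n a0 dl0 dl1 y00 y0B [x0 hx].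
have e31 : expR (-3) / 2 <= 1 :> R.
  rewrite ler_pdivrMr// mul1r; apply: (@le_trans _ _ 1); last by rewrite ler1n.
  by rewrite expR_le1; lra.
have ey0 : 0 < eta * y0 by rewrite mulr_gt0.
have eyle : expR (-3) / 2 * eta * y0 <= eta * y0.
  by rewrite -[leLHS]mulrA ler_piMl// ltW.
have start : eta * y0 <= xmin.
  apply: le_powR_cancel; rewrite ?(ltW ey0) ?(ltW xmin0)//.
  rewrite powRM ?(ltW eta0) ?(ltW y00)//; apply: le_trans e3.
  rewrite mulrC ler_pM2r//; apply: (le_trans y0B).
  by rewrite ler_piMr// ltW.
have d4 : 0 <= 1 - dl / 4 by lra.
(* below eta * y0 the nonlinear loss is at most dl / 4 *)
have loss y : 0 <= y -> y <= eta * y0 -> 1 - dl / 4 <= 1 - D * dl * (y / y0) `^ s.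
  move=> yp yle; rewrite lerD2l lerN2.
  have : (y / y0) `^ s <= eta `^ s.
    apply: ge0_ler_powR; rewrite ?nnegrE ?divr_ge0 ?(ltW s0) ?(ltW eta0) ?(ltW y00)//.
    by rewrite ler_pdivrMr.
  move=> h; apply: (@le_trans _ _ (D * dl * eta `^ s)).
    by rewrite ler_pM2l// mulr_gt0.
  by rewrite mulrAC mulrC ler_pM2l.
split.
- move=> adl; apply: (le_trans eyle).
  elim: n => [|k ih]; first exact: le_trans x0.
  apply: le_trans (hx k _ (ltW ey0) ih).
  have h := loss _ (ltW ey0) (lexx _).
  set Z := 1 - D * dl * _ in h *.
  have -> : a * (1 - dl / 4) * (eta * y0 * Z) = eta * y0 * (a * ((1 - dl / 4) * Z)) by ring.
  rewrite -[leLHS]mulr1 ler_pM2l//.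
  apply: (@le_trans _ _ ((1 + dl) * ((1 - dl / 4) * (1 - dl / 4)))).
    have h1 : 0 <= dl * (1 - dl) by rewrite mulr_ge0 ?(ltW dl0)// subr_ge0.
    have h2 : 0 <= dl * dl * dl by rewrite !mulr_ge0 ?ltW.
    have h3 : 0 <= dl * dl by rewrite !mulr_ge0 ?ltW.
    lra.
  by apply: ler_pM; [lra | rewrite mulr_ge0 | | rewrite ler_wpM2l].
- move=> dln an.
  pose q : R := 1 - (n.+1%:R)^-1.
  have q0 : 0 <= q by rewrite subr_ge0 invf_le1// ler1n.
  have q1 : q <= 1 by rewrite gerBl.
  have dq : q <= 1 - dl / 4 by rewrite lerD2l lerN2 (le_trans _ dln)//; lra.
  have claim k : eta * y0 * (q ^+ 3) ^+ k <= x k.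
    elim: k => [|k ih]; first by rewrite expr0 mulr1 (le_trans start).
    set y := eta * y0 * (q ^+ 3) ^+ k in ih.
    have yp : 0 <= y by rewrite mulr_ge0 ?(ltW ey0)// !exprn_ge0.
    have yle : y <= eta * y0 by rewrite ler_piMr ?(ltW ey0)// !exprn_ile1 ?exprn_ge0.
    apply: le_trans (hx k _ yp ih).
    rewrite exprS mulrCA -/y.
    have -> : a * (1 - dl / 4) * (y * (1 - D * dl * (y / y0) `^ s)) =
       (a * ((1 - dl / 4) * (1 - D * dl * (y / y0) `^ s))) * y by ring.
    rewrite ler_wpM2r// exprS expr2; apply: ler_pM => //; first exact: mulr_ge0.
    by apply: ler_pM => //; exact: (le_trans dq (loss _ yp yle)).
  apply: le_trans (claim n).
  rewrite [leLHS]mulrAC -[leLHS]mulrA mulrC [y0 * eta]mulrC ler_pM2l//.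
  apply: (@le_trans _ _ (expR (-3))).
    by rewrite ler_pdivrMr// ler_peMr ?expR_ge0// ler1n.
  rewrite -exprM mulnC exprM.
  have -> : expR (-3) = expR (-1) ^+ 3 :> R.
    by rewrite -expRM_natl; congr expR; rewrite mulrN1.
  by apply: lerXn2r; rewrite ?nnegrE ?expR_ge0 ?exprn_ge0// pow_one_sub_inv.
- move=> dln an.
  have n0 : 0 < n.+1%:R :> R by rewrite ltr0n.
  have ni0 : 0 < n.+1%:R^-1 :> R by rewrite invr_gt0.
  have a1 : a < 1 by apply: (le_lt_trans an); rewrite gtrBl.
  have d0 : 0 < 1 - a by rewrite subr_gt0.
  pose rho := a `^ s.
  have rho0 : 0 < rho by rewrite powR_gt0.
  have rho1 : rho < 1.
    by have := @gt0_ltr_powR R s s0 a 1; rewrite powR1; apply; rewrite ?nnegrE ?ler01 ?ltW.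
  pose y1 := eta * y0 * (n.+1%:R * (1 - a)) `^ s^-1.
  have nd0 : 0 < n.+1%:R * (1 - a) by rewrite mulr_gt0.
  have y10 : 0 < y1 by rewrite mulr_gt0 ?powR_gt0.
  have dln1 : dl * n.+1%:R <= 1 by rewrite -ler_pdivlMr// mul1r.
  have y1s : y1 `^ s = eta `^ s * y0 `^ s * (n.+1%:R * (1 - a)).
    rewrite /y1 powRM ?(ltW ey0) ?powR_ge0// powRM ?(ltW eta0) ?(ltW y00)//.
    by rewrite -powRrM mulVf ?gt_eqF// powRr1// ltW.
  have start1 : y1 <= xmin.
    apply: le_powR_cancel; rewrite ?(ltW y10) ?(ltW xmin0)//.
    rewrite y1s; apply: le_trans e3.
    have h1 : y0 `^ s * (n.+1%:R * (1 - a)) <= B.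
      apply: (@le_trans _ _ (B * dl * (n.+1%:R * (1 - a)))); first by rewrite ler_pM2r.
      have -> : B * dl * (n.+1%:R * (1 - a)) = B * (dl * n.+1%:R * (1 - a)) by ring.
      rewrite ler_piMr ?(ltW B0)// mulr_ile1 ?mulr_ge0 ?(ltW dl0) ?(ltW d0)//.
      by rewrite gerBl ltW.
    by rewrite -mulrA mulrC ler_pM2r.
  (* F (1 - rho^k) is the sum of the first k relative losses *)
  pose F := D * eta `^ s * (1 - a) / (1 - rho).
  have r1 : 0 < 1 - rho by rewrite subr_gt0.
  have F0 : 0 <= F by rewrite !mulr_ge0 ?invr_ge0 ?ltW.
  have F2 : F <= 2^-1.
    rewrite ler_pdivrMr//; apply: (@le_trans _ _ (D * Cs * eta `^ s * (1 - rho))).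
      have -> : D * Cs * eta `^ s * (1 - rho) = D * eta `^ s * (Cs * (1 - rho)) by ring.
      by rewrite ler_pM2l ?mulr_gt0// one_sub_powR// ltW.
    by rewrite ler_pM2r.
  have rk k : 0 <= 1 - rho ^+ k by rewrite subr_ge0 exprn_ile1 ?ltW.
  pose q := a * (1 - dl / 4).
  have q0 : 0 <= q by rewrite mulr_ge0 ?(ltW a0).
  have qa : q <= a by rewrite ler_piMr ?(ltW a0)// gerBl divr_ge0 ?ltW.
  have sg k : 0 <= 1 - F * (1 - rho ^+ k).
    rewrite subr_ge0; apply: mulr_ile1 => //; first by lra.
    by rewrite gerBl exprn_ge0// ltW.
  have claim k : y1 * q ^+ k * (1 - F * (1 - rho ^+ k)) <= x k.
    elim: k => [|k ih]; first by rewrite !expr0 subrr mulr0 subr0 !mulr1 (le_trans start1).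
    set y := y1 * q ^+ k * _ in ih.
    have yp0 : 0 <= y1 * q ^+ k.
      by apply: mulr_ge0; [exact: ltW | exact: exprn_ge0].
    have yp : 0 <= y by apply: mulr_ge0; [exact: yp0 | exact: sg].
    have yle : y <= y1 * a ^+ k.
      apply: (@le_trans _ _ (y1 * q ^+ k)).
        rewrite ler_piMr// gerBl.
        by apply: mulr_ge0; [exact: F0 | exact: rk].
      by rewrite ler_pM2l//; apply: lerXn2r; rewrite ?nnegrE// ltW.
    apply: le_trans (hx k _ yp ih).
    have tk : D * dl * (y / y0) `^ s <= D * eta `^ s * (1 - a) * rho ^+ k.
      have : (y / y0) `^ s <= eta `^ s * (n.+1%:R * (1 - a)) * rho ^+ k.
        apply: (@le_trans _ _ ((y1 * a ^+ k / y0) `^ s)).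
          have b1 : 0 <= y / y0 by apply: divr_ge0; [exact: yp | exact: ltW].
          have b2 : y / y0 <= y1 * a ^+ k / y0 by rewrite ler_pM2r// invr_gt0.
          by apply: ge0_ler_powR => //; [exact: ltW | rewrite nnegrE (le_trans b1)].
        have -> : y1 * a ^+ k / y0 = eta * (n.+1%:R * (1 - a)) `^ s^-1 * a ^+ k.
          by rewrite /y1; field; rewrite gt_eqF.
        rewrite powRM ?mulr_ge0 ?powR_ge0 ?exprn_ge0 ?(ltW eta0) ?(ltW a0)//.
        rewrite powRM ?powR_ge0 ?(ltW eta0)// -powRrM mulVf ?gt_eqF// powRr1 ?(ltW nd0)//.
        rewrite -[a ^+ k]powR_mulrn ?(ltW a0)// -powRrM [k%:R * s]mulrC powRrM -/rho.
        by rewrite powR_mulrn ?(ltW rho0).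
      move=> h; apply: (@le_trans _ _ (D * dl * (eta `^ s * (n.+1%:R * (1 - a)) * rho ^+ k))).
        by rewrite ler_pM2l// mulr_gt0.
      have -> : D * dl * (eta `^ s * (n.+1%:R * (1 - a)) * rho ^+ k) =
        dl * n.+1%:R * (D * eta `^ s * (1 - a) * rho ^+ k) by ring.
      rewrite ler_piMl//; apply: mulr_ge0; last by rewrite exprn_ge0// ltW.
      by rewrite !mulr_ge0// ltW.
    rewrite -/q exprS.
    have -> : y1 * (q * q ^+ k) * (1 - F * (1 - rho ^+ k.+1)) =
       q * (y1 * q ^+ k * (1 - F * (1 - rho ^+ k.+1))) by ring.
    rewrite ler_wpM2l// /y -[leRHS]mulrA ler_wpM2l//.
    set t := D * dl * _ in tk *.
    have tF : F * (1 - rho ^+ k.+1) = F * (1 - rho ^+ k) + D * eta `^ s * (1 - a) * rho ^+ k.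
      by rewrite /F exprS; field; rewrite gt_eqF.
    have t0 : 0 <= t.
      by apply: mulr_ge0; [rewrite mulr_ge0// ltW | exact: powR_ge0].
    have : 0 <= F * (1 - rho ^+ k) * t.
      by apply: mulr_ge0 => //; apply: mulr_ge0; [exact: F0 | exact: rk].
    rewrite tF; lra.
  apply: le_trans (claim n).
  rewrite -/y1.
  have h1 : 2^-1 <= 1 - F * (1 - rho ^+ n).
    have : F * (1 - rho ^+ n) <= F by rewrite ler_piMr// gerBl exprn_ge0// ltW.
    lra.
  have h2 : expR (-3) * a ^+ n.+1 <= q ^+ n.
    rewrite /q exprMn mulrC; apply: ler_pM; rewrite ?exprn_ge0 ?expR_ge0 ?(ltW a0)//.
      by rewrite exprS ler_piMl ?exprn_ge0 ?ltW.
    apply: (@le_trans _ _ (expR (-1))); first by rewrite ler_expR; lra.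
    apply: (le_trans (pow_one_sub_inv n)); apply: lerXn2r; rewrite ?nnegrE//.
      by rewrite subr_ge0 invf_le1// ler1n.
    by rewrite lerD2l lerN2 (le_trans _ dln)//; lra.
  have -> : expR (-3) / 2 * eta * (y0 * (n.+1%:R * (1 - a)) `^ s^-1 * a ^+ n.+1) =
    y1 * (expR (-3) * a ^+ n.+1) * 2^-1 by rewrite /y1; ring.
  have y1a : 0 <= y1 * (expR (-3) * a ^+ n.+1).
    apply: mulr_ge0; first exact: ltW.
    by apply: mulr_ge0; [exact: expR_ge0 | rewrite exprn_ge0// ltW].
  by apply: ler_pM => //; rewrite ?invr_ge0// ler_pM2l.
Qed.

End lower_sequences.

(** * Moments of the normalised value *)

Lemma powR_convex_tangent (R : realType) (p a c : R) : 0 < p -> 0 <= a -> 0 <= c ->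
  c `^ (1 + p) + (1 + p) * c `^ p * (a - c) <= a `^ (1 + p).
Proof.
move=> p0 a0; rewrite le_eqVlt => /predU1P[<-|c0].
  have p1 : 0 < 1 + p by rewrite addr_gt0.
  rewrite !powR0 ?gt_eqF//.
  by rewrite mulr0 mul0r addr0 powR_ge0.
have ac : 0 <= a / c by rewrite divr_ge0// ltW.
have := @powR_bernoulli R (a / c) (1 + p) ac; rewrite lerDl ltW// => /(_ isT) h.
have cp0 : 0 < c `^ (1 + p) by rewrite powR_gt0.
have := ler_wpM2r (ltW cp0) h; rewrite -powRM ?(ltW c0)// divfK ?gt_eqF//.
apply: le_trans; rewrite !powR_D1 ?(ltW c0)//.
rewrite le_eqVlt; apply/orP; left; apply/eqP; field; by rewrite gt_eqF.
Qed.

(** If [f2] exceeds [f1] only where [f2] is small, then [f2] is less dispersed than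
    [f1].  With t the crossing level, convexity at f2 gives a linear term whose
    slope can be replaced by the slope at t on both sides of the crossing, and
    this term has mean 0. *)
Lemma Ex_powR_single_crossing d (T : measurableType d) (R : realType)
    (P : probability T R) (f1 f2 : T -> R) (p : R) : 0 < p ->
  bounded_rv f1 -> bounded_rv f2 -> (forall w, 0 <= f1 w) -> (forall w, 0 <= f2 w) ->
  Ex P f1 = Ex P f2 ->
  (forall w w', f1 w < f2 w -> f2 w' < f1 w' -> f2 w <= f2 w') ->
  Ex P (fun w => f2 w `^ (1 + p)) <= Ex P (fun w => f1 w `^ (1 + p)).
Proof.
move=> p0 b1 b2 f10 f20 E12 cross.
have q0 : 0 <= 1 + p by rewrite addr_ge0// ltW.
have [_ [M hM]] := b2.
pose S := [set f2 w | w in [set w | f1 w < f2 w]] `|` [set 0].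
have S0 : S !=set0 by exists 0; right.
have SM : ubound S `|M|.
  move=> _ [[w _ <-]|->//]; apply: le_trans (ler_norm M).
  by apply: le_trans (hM w); exact: ler_norm.
pose t := sup S.
have t0 : 0 <= t by apply: ub_le_sup; [exists `|M| | right].
have key w : f2 w `^ (1 + p) + (1 + p) * t `^ p * (f1 w - f2 w) <= f1 w `^ (1 + p).
  apply: le_trans (powR_convex_tangent p0 (f10 w) (f20 w)).
  rewrite lerD2l -!mulrA ler_pM2l ?addr_gt0//.
  have [l|l|->] := ltgtP (f1 w) (f2 w); last by rewrite subrr !mulr0.
  - rewrite -subr_ge0 -mulrBl -mulrNN mulr_ge0// oppr_ge0.
      rewrite subr_le0; apply: ge0_ler_powR; rewrite ?nnegrE ?(ltW p0)//.
      by apply: ub_le_sup; [exists `|M| | left; exists w].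
    by rewrite subr_le0 ltW.
  - rewrite ler_pM2r ?subr_gt0//.
    apply: ge0_ler_powR; rewrite ?nnegrE ?(ltW p0)//.
    by apply: ge_sup => // _ [[w' h <-]|->]; [exact: cross l | exact: f20].
have bp1 := bounded_rv_powR f10 q0 b1; have bp2 := bounded_rv_powR f20 q0 b2.
have -> : Ex P (fun w => f2 w `^ (1 + p)) =
  Ex P (fun w => f2 w `^ (1 + p) + (1 + p) * t `^ p * (f1 w - f2 w)).
  rewrite ExD//; last by apply: bounded_rvZ; exact: bounded_rvB.
  by rewrite ExZ ?ExB ?E12 ?subrr ?mulr0 ?addr0//; exact: bounded_rvB.
apply: Ex_le => //; apply: bounded_rvD => //; apply: bounded_rvZ.
exact: bounded_rvB.
Qed.

Section offspring_moments.
Context (R : realType) (Q : probability tree R) (mu : probability nat R).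
Hypothesis QG : gw_tree Q mu.
Variable X : nat.

Let N := noffspring X.

(** Up to the factor E[N], the moment of order [a] of the size-biased offspring
    number; [a = 0] gives E[N]. *)
Definition nmoment (a : R) : R := Ex Q (fun nu => (N nu)%:R * (N nu)%:R `^ a).

Lemma nmoment_mean a : 0 <= a -> meanN Q X <= nmoment a.
Proof.
move=> a0; apply: Ex_le => [||nu].
- exact: (bounded_rv_offspring X (fun j => j%:R)).
- exact: (bounded_rv_offspring X (fun j => j%:R * j%:R `^ a)).
rewrite -/N; case: (N nu) => [|j]; first by rewrite mul0r.
by rewrite ler_peMr// powR_ge1// ler1n.
Qed.

(** Chebyshev's association inequality for two increasing functions of the
    size-biased offspring number, integrated over two independent copies. *)
Lemma nmoment_assoc a c : 0 <= a -> 0 <= c ->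
  nmoment a * nmoment c <= meanN Q X * nmoment (a + c).
Proof.
move=> a0 c0.
pose n (nu : tree) : R := (N nu)%:R.
have bn (phi : nat -> R) := bounded_rv_offspring X phi.
have b0 := bn (fun j => j%:R); have ba := bn (fun j => j%:R * j%:R `^ a).
have bc := bn (fun j => j%:R * j%:R `^ c).
have bac := bn (fun j => j%:R * j%:R `^ (a + c)).
have pD (j : nat) : (j%:R : R) * j%:R `^ (a + c) = j%:R * j%:R `^ a * j%:R `^ c.
  case: j => [|j]; first by rewrite !mul0r.
  by rewrite powRD ?mulrA// pnatr_eq0 implybT.
have sgn (i j : nat) : 0 <= ((i%:R : R) `^ a - j%:R `^ a) * (i%:R `^ c - j%:R `^ c).
  have mono b : 0 <= b -> forall i j : nat, (i <= j)%N -> (i%:R : R) `^ b <= j%:R `^ b.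
    by move=> hb i' j' ij; apply: ge0_ler_powR; rewrite ?nnegrE// ler_nat.
  have [ij|/ltnW ij] := leqP i j.
    by rewrite -mulrNN mulr_ge0// opprB subr_ge0 mono.
  by rewrite mulr_ge0// subr_ge0 mono.
have step (j : nat) : 0 <= j%:R * nmoment (a + c) - j%:R * j%:R `^ a * nmoment c
    - j%:R * j%:R `^ c * nmoment a + j%:R * j%:R `^ (a + c) * meanN Q X.
  have := @Ex_ge0 _ _ R Q (fun nu => j%:R * n nu *
    ((n nu `^ a - j%:R `^ a) * (n nu `^ c - j%:R `^ c))) _.
  have -> : (fun nu => j%:R * n nu * ((n nu `^ a - j%:R `^ a) * (n nu `^ c - j%:R `^ c))) =
    (fun nu => (j%:R * (n nu * n nu `^ (a + c)) - j%:R * j%:R `^ a * (n nu * n nu `^ c))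
       - j%:R * j%:R `^ c * (n nu * n nu `^ a) + j%:R * j%:R `^ (a + c) * n nu).
    by apply/funext => nu; rewrite /n !pD; ring.
  rewrite ExD; [|by do !apply: bounded_rvB; exact: bounded_rvZ|exact: bounded_rvZ].
  rewrite ExB; [|by apply: bounded_rvB; exact: bounded_rvZ|exact: bounded_rvZ].
  rewrite ExB; [|exact: bounded_rvZ|exact: bounded_rvZ].
  rewrite !ExZ//; apply => nu.
  by apply: mulr_ge0; [rewrite mulr_ge0 | exact: sgn].
have := @Ex_ge0 _ _ R Q (fun nu => n nu * nmoment (a + c) - n nu * n nu `^ a * nmoment c
    - n nu * n nu `^ c * nmoment a + n nu * n nu `^ (a + c) * meanN Q X)
    (fun nu => step (N nu)).
have -> : (fun nu => n nu * nmoment (a + c) - n nu * n nu `^ a * nmoment c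
    - n nu * n nu `^ c * nmoment a + n nu * n nu `^ (a + c) * meanN Q X) =
  (fun nu => (nmoment (a + c) * n nu - nmoment c * (n nu * n nu `^ a))
    - nmoment a * (n nu * n nu `^ c) + meanN Q X * (n nu * n nu `^ (a + c))).
  by apply/funext => nu; ring.
rewrite ExD; [|by do !apply: bounded_rvB; exact: bounded_rvZ|exact: bounded_rvZ].
rewrite ExB; [|by apply: bounded_rvB; exact: bounded_rvZ|exact: bounded_rvZ].
rewrite ExB; [|exact: bounded_rvZ|exact: bounded_rvZ].
rewrite !ExZ// -/(nmoment _) -/(nmoment c) -/(nmoment (a + c)) -/(meanN Q X).
lra.
Qed.

(** One factor of T^(1+p) is expanded as a sum over the children; in the term of
    child i, the remaining T^p is split into the summand of i and the rest, which
    is independent of the subtree of i and again at most T. *)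
Lemma Ex_sum_powR (xi : tree -> R) (p A C : R) (phi : nat -> R) :
  bounded_rv xi -> (forall nu, 0 <= xi nu) -> Ex Q xi = 1 -> 0 < p -> 0 <= C ->
  (forall x y, 0 <= x -> 0 <= y -> (x + y) `^ p <= A * x `^ p + C * y `^ p) ->
  (forall j, 0 <= phi j) ->
  forall T : tree -> R, (forall nu, T nu = \sum_(i < N nu) xi (subtree i nu)) ->
  Ex Q (fun nu => phi (N nu) * T nu `^ (1 + p)) <=
  A * (Ex Q (fun nu => phi (N nu) * (N nu)%:R) * Ex Q (fun nu => xi nu `^ (1 + p))) +
  C * Ex Q (fun nu => phi (N nu) * (N nu)%:R * T nu `^ p).
Proof.
move=> bxi xi0 Exi p0 C0 hAC phi0 T hT.
have p1 : 0 <= 1 + p by rewrite addr_ge0// ltW.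
pose Tx (i : nat) (nu : tree) := \sum_(j < X | (j != i :> nat)) ((j < N nu)%N%:R * xi (subtree j nu)).
have TE nu : T nu = \sum_(j < X) (j < N nu)%:R * xi (subtree j nu).
  by rewrite hT (sum_ord_le (fun i => xi (subtree i nu)) (noffspring_le X nu)).
have T0 nu : 0 <= T nu by rewrite hT; apply: sumr_ge0.
have Tx0 i nu : 0 <= Tx i nu by apply: sumr_ge0 => j _; rewrite mulr_ge0.
have Tsplit (i : 'I_X) nu : T nu = (i < N nu)%:R * xi (subtree i nu) + Tx i nu.
  by rewrite TE (bigD1 i).
have Nsum nu : \sum_(i < X) (i < N nu)%:R = (N nu)%:R :> R.
  have := @sum_ord_le R (N nu) X (fun=> 1) (noffspring_le X nu).
  rewrite sumr_const card_ord => ->.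
  by apply: eq_bigr => i _; rewrite mulr1.
pose ph (i : nat) nu : R := phi (N nu) * (i < N nu)%:R.
have ph0 i nu : 0 <= ph i nu by rewrite mulr_ge0.
have bph i : bounded_rv (ph i).
  exact: (bounded_rv_offspring X (fun n => phi n * (i < n)%:R)).
have bT : bounded_rv T.
  rewrite (funext hT).
  apply: (@bounded_rv_offspring_sum R X (fun i nu => xi (subtree i nu))) => i.
  exact: bounded_rv_subtree.
have bTp : bounded_rv (fun nu => T nu `^ p) by apply: bounded_rv_powR => //; exact: ltW.
have bTx i : bounded_rv (Tx i).
  apply: bounded_rv_sum => j; apply: bounded_rvM; last exact: bounded_rv_subtree.
  exact: (bounded_rv_offspring X (fun n => (j < n)%:R)).
have bTxp i : bounded_rv (fun nu => Tx i nu `^ p).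
  by apply: bounded_rv_powR => //; exact: ltW.
have bxp : bounded_rv (fun nu => xi nu `^ (1 + p)) by exact: bounded_rv_powR.
pose F1 (i : nat) nu := A * (xi (subtree i nu) `^ (1 + p) * ph i nu).
pose F2 (i : nat) nu := C * (xi (subtree i nu) * (ph i nu * Tx i nu `^ p)).
have bF1 i : bounded_rv (F1 i).
  apply: bounded_rvZ; apply: bounded_rvM => //.
  exact: (@bounded_rv_subtree R i (fun nu => xi nu `^ (1 + p))).
have bF2 i : bounded_rv (F2 i).
  apply: bounded_rvZ; apply: bounded_rvM; first exact: bounded_rv_subtree.
  exact: bounded_rvM.
have EF1 i : Ex Q (F1 i) = A * (Ex Q (ph i) * Ex Q (fun nu => xi nu `^ (1 + p))).
  rewrite /F1 ExZ; last first.
    apply: bounded_rvM => //.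
    exact: (@bounded_rv_subtree R i (fun nu => xi nu `^ (1 + p))).
  congr (_ * _).
  by rewrite (@Ex_branching R Q mu QG i (fun nu => xi nu `^ (1 + p)) (ph i))// mulrC.
have EF2 (i : 'I_X) : Ex Q (F2 i) <= C * Ex Q (fun nu => ph i nu * T nu `^ p).
  rewrite /F2 ExZ; last first.
    by apply: bounded_rvM; [exact: bounded_rv_subtree | exact: bounded_rvM].
  rewrite ler_wpM2l//.
  rewrite (@Ex_branching R Q mu QG i xi (fun nu => ph i nu * Tx i nu `^ p))//; last 2 first.
  - exact: bounded_rvM.
  - move=> P; rewrite /ph /Tx; congr (_ * _ `^ _); apply: eq_bigr => j ji.
    by rewrite subtree_graft_neq.
  rewrite Exi mul1r; apply: Ex_le => [||nu]; [exact: bounded_rvM..|].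
  rewrite ler_wpM2l//; apply: ge0_ler_powR; rewrite ?nnegrE ?(ltW p0)//.
  by rewrite (Tsplit i) lerDr mulr_ge0.
apply: (@le_trans _ _ (Ex Q (fun nu => \sum_(i < X) F1 i nu + \sum_(i < X) F2 i nu))).
  apply: Ex_le => [||nu].
  - apply: bounded_rvM; first exact: (bounded_rv_offspring X phi).
    exact: bounded_rv_powR.
  - by apply: bounded_rvD; apply: bounded_rv_sum => i.
  rewrite powR_D1// {1}TE mulr_suml mulr_sumr -big_split /=.
  apply: ler_sum => i _; rewrite /F1 /F2 /ph.
  have [iN|iN] := boolP (i < N nu)%N; last by rewrite !(mulr0, mul0r, addr0).
  rewrite !mulr1 mul1r powR_D1//.
  have := hAC _ _ (xi0 (subtree i nu)) (Tx0 i nu).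
  have := Tsplit i nu; rewrite iN mul1r => <- h.
  have x0 := xi0 (subtree i nu).
  have := ler_wpM2l (phi0 (N nu)) (ler_wpM2l x0 h); lra.
rewrite ExD; [|exact: bounded_rv_sum..].
apply: lerD.
  rewrite Ex_sum//; under eq_bigr do rewrite EF1.
  rewrite -mulr_sumr -mulr_suml -Ex_sum//.
  rewrite (_ : (fun nu => \sum_(i < X) ph i nu) =
    (fun nu => phi (N nu) * (N nu)%:R))//.
  by apply/funext => nu; rewrite -mulr_sumr Nsum.
rewrite Ex_sum//; apply: (@le_trans _ _ (\sum_(i < X) C * Ex Q (fun nu => ph i nu * T nu `^ p))).
  by apply: ler_sum => i _; exact: EF2.
rewrite -mulr_sumr ler_wpM2l// -Ex_sum; last by move=> i; exact: bounded_rvM.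
rewrite (_ : (fun nu => \sum_(i < X) ph i nu * T nu `^ p) =
  (fun nu => phi (N nu) * (N nu)%:R * T nu `^ p))//.
by apply/funext => nu; rewrite -mulr_suml -mulr_sumr Nsum.
Qed.

(** Conditionally on the number of summands, concave powers are handled by
    Jensen's inequality. *)
Lemma Ex_sum_powR_le1 (xi : tree -> R) (p b : R) :
  bounded_rv xi -> (forall nu, 0 <= xi nu) -> Ex Q xi = 1 -> 0 < p <= 1 -> 0 <= b ->
  Ex Q (fun nu => (N nu)%:R * (N nu)%:R `^ b *
    (\sum_(i < N nu) xi (subtree i nu)) `^ p) <= nmoment (b + p).
Proof.
move=> bxi xi0 Exi /andP[p0 p1] b0.
pose T nu := \sum_(i < N nu) xi (subtree i nu).
have bT : bounded_rv T.
  apply: (@bounded_rv_offspring_sum R X (fun i nu => xi (subtree i nu))) => i.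
  exact: bounded_rv_subtree.
have T0 nu : 0 <= T nu by apply: sumr_ge0.
pose phi (j : nat) : R := j%:R `^ b * j%:R `^ p.
have bphi := bounded_rv_offspring X phi.
have bN := bounded_rv_offspring X (fun j => j%:R : R).
have bac := bounded_rv_offspring X (fun j => (j%:R : R) * j%:R `^ (b + p)).
have -> : nmoment (b + p) = Ex Q (fun nu => (N nu)%:R * (N nu)%:R `^ (b + p) +
    p * (phi (N nu) * T nu - phi (N nu) * (N nu)%:R)).
  have bM1 : bounded_rv (fun nu => phi (N nu) * T nu) by exact: bounded_rvM.
  have bM2 : bounded_rv (fun nu => phi (N nu) * (N nu)%:R) by exact: bounded_rvM.
  rewrite ExD//; last by apply: bounded_rvZ; exact: bounded_rvB.
  rewrite ExZ; last exact: bounded_rvB.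
  rewrite ExB// (Ex_offspring_sum QG X phi bxi) Exi mulr1 subrr mulr0 addr0.
  by [].
apply: Ex_le => [||nu].
- apply: bounded_rvM.
    exact: (bounded_rv_offspring X (fun j => (j%:R : R) * j%:R `^ b)).
  by apply: bounded_rv_powR => //; exact: ltW.
- apply: bounded_rvD => //; apply: bounded_rvZ.
  by apply: bounded_rvB; exact: bounded_rvM.
rewrite -/(T nu) /phi; have := T0 nu.
case: (N nu) => [|j] => t0.
  have p00 : 0 `^ p = 0 :> R by rewrite powR0// gt_eqF.
  by rewrite mulr0n p00 !(mulr0, mul0r, subrr, addr0).
have j0 : 0 < j.+1%:R :> R by rewrite ltr0n.
have tj : 0 <= T nu / j.+1%:R by rewrite divr_ge0.
have := @powR_concave_tangent R (T nu / j.+1%:R) p tj; rewrite p0 p1 => /(_ isT) h.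
have jp : 0 <= j.+1%:R * j.+1%:R `^ b * j.+1%:R `^ p :> R.
  by rewrite !mulr_ge0 ?powR_ge0.
have := ler_wpM2l jp h.
have -> : j.+1%:R * j.+1%:R `^ b * j.+1%:R `^ p * (T nu / j.+1%:R) `^ p =
  j.+1%:R * j.+1%:R `^ b * T nu `^ p.
  rewrite -mulrA -powRM ?(ltW j0)//; congr (_ * _ `^ _).
  by field; rewrite gt_eqF.
move=> /le_trans; apply; rewrite powRD; last by rewrite pnatr_eq0 implybT.
by rewrite le_eqVlt; apply/orP; left; apply/eqP; field; rewrite gt_eqF.
Qed.

End offspring_moments.

Section normalized_moments.
Context (R : realType) (Q : probability tree R) (mu : probability nat R).
Hypothesis QG : gw_tree Q mu.
Variables (g : R -> R) (gi : R).
Hypothesis Hg : conductance g gi.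

Definition normalized_bval X r k nu : R :=
  bval g gi X r k nu / Ex Q (bval g gi X r k).

Section fixed_parameters.
Variables (X : nat) (r : R).
Hypotheses (r0 : 0 < r) (m0 : 0 < meanN Q X).

Let xi k nu := gval g gi X r k nu / meang Q g gi X r k.
Let T k nu := \sum_(i < noffspring X nu) xi k (subtree i nu).

Let Y0 k : 0 < meang Q g gi X r k.
Proof. exact: (meang_gt0 QG Hg). Qed.

Lemma Ex_bval_gt0 k : 0 < Ex Q (bval g gi X r k).
Proof. by rewrite (Ex_bval QG Hg)// !mulr_gt0. Qed.

Lemma normalized_bvalE k nu : normalized_bval X r k nu = T k nu / meanN Q X.
Proof.
rewrite /normalized_bval (Ex_bval QG Hg)// /bval /T /xi -mulr_suml.
by field; rewrite !gt_eqF.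
Qed.

Lemma normalized_bval_ge0 k nu : 0 <= normalized_bval X r k nu.
Proof. by rewrite divr_ge0 ?(bval_ge0 Hg)// ltW// Ex_bval_gt0. Qed.

Lemma bounded_normalized_bval k : bounded_rv (normalized_bval X r k).
Proof.
apply: bounded_rvM; first exact: (bounded_bval Hg X r0).
exact: bounded_rv_cst.
Qed.

Lemma Ex_normalized_bval k : Ex Q (normalized_bval X r k) = 1.
Proof.
rewrite /normalized_bval; under [X in Ex Q X]eq_fun do rewrite mulrC.
rewrite ExZ; last exact: (bounded_bval Hg X r0).
by rewrite mulVf// gt_eqF// Ex_bval_gt0.
Qed.

Let bxi k : bounded_rv (xi k).
Proof.
apply: bounded_rvM; first exact: (bounded_gval Hg X r0).
exact: bounded_rv_cst.
Qed.

Let xi0 k nu : 0 <= xi k nu.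
Proof. by rewrite divr_ge0 ?(gval_ge0 Hg X r0)// ltW. Qed.

Let Exi k : Ex Q (xi k) = 1.
Proof.
rewrite /xi; under [X in Ex Q X]eq_fun do rewrite mulrC.
rewrite ExZ; last exact: (bounded_gval Hg X r0).
by rewrite mulVf// gt_eqF.
Qed.

(** Since g(x)/x decreases, g(B)/E[g(B)] exceeds B/E[B] only for small B, and so is
    less dispersed. *)
Lemma xi_dispersion k p : 0 < p ->
  Ex Q (fun nu => xi k.+1 nu `^ (1 + p)) <=
  Ex Q (fun nu => normalized_bval X r k nu `^ (1 + p)).
Proof.
move=> p0.
apply: (@Ex_powR_single_crossing _ _ R Q (normalized_bval X r k) (xi k.+1)) => //.
- exact: bounded_normalized_bval.
- exact: normalized_bval_ge0.
- by rewrite Exi Ex_normalized_bval.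
move=> w w'; rewrite /normalized_bval /xi !gvalS.
set x := Ex Q _; have x0 : 0 < x by exact: Ex_bval_gt0.
set b := bval g gi X r k w; set b' := bval g gi X r k w'.
have b0 : 0 <= b by exact: (bval_ge0 Hg X r0).
have b'0 : 0 <= b' by exact: (bval_ge0 Hg X r0).
move=> h1 h2; rewrite ler_pM2r ?invr_gt0//.
apply: (cond_nd Hg); rewrite leNgt; apply/negP => lb.
have bp : 0 < b by exact: le_lt_trans lb.
have t01 : 0 <= b' / b <= 1 by rewrite divr_ge0//= ler_pdivrMr// mul1r ltW.
have := g_star Hg t01 b0; rewrite divfK ?gt_eqF// => hs.
move: h2; rewrite ltNge => /negP; apply.
apply: (@le_trans _ _ (b' / b * g b / meang Q g gi X r k.+1)).
  have -> : b' / x = b' / b * (b / x) by field; rewrite !gt_eqF.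
  by rewrite -[leRHS]mulrA ler_wpM2l ?(ltW h1)// divr_ge0.
by rewrite ler_pM2r ?invr_gt0.
Qed.

Let T0 k nu : 0 <= T k nu.
Proof. by apply: sumr_ge0. Qed.

Lemma normalized_moment_step k p A C (b : R) : 0 < p -> 0 <= C -> 0 <= b ->
  (forall x y, 0 <= x -> 0 <= y -> (x + y) `^ p <= A * x `^ p + C * y `^ p) ->
  Ex Q (fun nu => (noffspring X nu)%:R * (noffspring X nu)%:R `^ b * T k nu `^ (1 + p)) <=
  A * (nmoment Q X (b + 1) * Ex Q (fun nu => xi k nu `^ (1 + p))) +
  C * Ex Q (fun nu => (noffspring X nu)%:R * (noffspring X nu)%:R `^ (b + 1) * T k nu `^ p).
Proof.
move=> p0 C0 b0 hAC.
have e (j : nat) : j%:R * j%:R `^ b * j%:R = j%:R * j%:R `^ (b + 1) :> R.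
  case: j => [|j]; first by rewrite !mul0r.
  by rewrite powRD ?pnatr_eq0 ?implybT// powRr1// mulrA.
have := @Ex_sum_powR R Q mu QG X (xi k) p A C (fun j => j%:R * j%:R `^ b)
  (bxi k) (xi0 k) (Exi k) p0 C0 hAC _ (T k) (fun=> erefl).
have -> : Ex Q (fun nu => (noffspring X nu)%:R * (noffspring X nu)%:R `^ b * (noffspring X nu)%:R) = nmoment Q X (b + 1).
  by congr Ex; apply/funext => nu; rewrite e.
have -> : (fun nu => (noffspring X nu)%:R * (noffspring X nu)%:R `^ b *
    (noffspring X nu)%:R * T k nu `^ p) =
  (fun nu => (noffspring X nu)%:R * (noffspring X nu)%:R `^ (b + 1) * T k nu `^ p).
  by apply/funext => nu; rewrite e.
by apply => j; rewrite mulr_ge0// powR_ge0.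
Qed.

Lemma normalized_moment_step0 k p A C : 0 < p -> 0 <= C ->
  (forall x y, 0 <= x -> 0 <= y -> (x + y) `^ p <= A * x `^ p + C * y `^ p) ->
  Ex Q (fun nu => T k nu `^ (1 + p)) <=
  A * (meanN Q X * Ex Q (fun nu => xi k nu `^ (1 + p))) +
  C * Ex Q (fun nu => (noffspring X nu)%:R * (noffspring X nu)%:R `^ 0 * T k nu `^ p).
Proof.
move=> p0 C0 hAC.
have := @Ex_sum_powR R Q mu QG X (xi k) p A C (fun=> 1)
  (bxi k) (xi0 k) (Exi k) p0 C0 hAC (fun=> ler01) (T k) (fun=> erefl).
rewrite (_ : (fun nu => 1 * T k nu `^ (1 + p)) = (fun nu => T k nu `^ (1 + p))).
  rewrite (_ : (fun nu => 1 * (noffspring X nu)%:R * T k nu `^ p) =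
    (fun nu => (noffspring X nu)%:R * (noffspring X nu)%:R `^ 0 * T k nu `^ p)).
    rewrite (_ : Ex Q (fun nu => 1 * (noffspring X nu)%:R) = meanN Q X)//.
    by congr Ex; apply/funext => nu; rewrite mul1r.
  by apply/funext => nu; rewrite powRr0 mulr1 mul1r.
by apply/funext => nu; rewrite mul1r.
Qed.

Lemma bounded_sum_xi_powR k p : 0 <= p -> bounded_rv (fun nu => T k nu `^ p).
Proof.
move=> p0; apply: bounded_rv_powR => //.
apply: (@bounded_rv_offspring_sum R X (fun i nu => xi k (subtree i nu))) => i.
exact: bounded_rv_subtree.
Qed.

Lemma sum_xi_moment_le1 k p b : 0 < p <= 1 -> 0 <= b ->
  Ex Q (fun nu => (noffspring X nu)%:R * (noffspring X nu)%:R `^ b * T k nu `^ p) <=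
  nmoment Q X (b + p).
Proof. by move=> p01 b0; apply: (Ex_sum_powR_le1 QG). Qed.

Lemma xi0_moment p : Ex Q (fun nu => xi 0 nu `^ (1 + p)) = 1.
Proof.
rewrite -[RHS](Ex_cst Q); congr Ex; apply/funext => nu.
rewrite /xi /= /meang Ex_cst divff; first by rewrite powR1.
by rewrite gt_eqF// (gi_gt0 Hg).
Qed.

Lemma normalized_powR k p : 0 < p ->
  Ex Q (fun nu => normalized_bval X r k nu `^ (1 + p)) =
  Ex Q (fun nu => T k nu `^ (1 + p)) / (meanN Q X) `^ (1 + p).
Proof.
move=> p0; rewrite mulrC -ExZ; last by apply: bounded_sum_xi_powR; rewrite addr_ge0// ltW.
congr Ex; apply/funext => nu; rewrite normalized_bvalE.
rewrite powRM ?invr_ge0 ?(ltW m0)// mulrC; congr (_ * _).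
by rewrite -powR_inv1 ?(ltW m0)// -powRrM mulN1r powRN.
Qed.

End fixed_parameters.

Variables mlo mhi : R.
Hypothesis mlo1 : 1 < mlo.

(** Only bounds on the mean offspring number are fixed: the constants below must
    be uniform in [X], [r] and the height. *)
Let good X (r : R) := 0 < r /\ mlo <= meanN Q X <= mhi.

Let xi X r k nu := gval g gi X r k nu / meang Q g gi X r k.
Let T X r k nu := \sum_(i < noffspring X nu) xi X r k (subtree i nu).

Let moment_V p := exists2 C, 0 < C & forall X r k, good X r ->
  Ex Q (fun nu => xi X r k nu `^ (1 + p)) <= C * nmoment Q X p /\
  Ex Q (fun nu => normalized_bval X r k nu `^ (1 + p)) <= C * nmoment Q X p.

Let moment_T p := forall b, 0 <= b -> exists2 C, 0 < C & forall X r k, good X r ->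
  Ex Q (fun nu => (noffspring X nu)%:R * (noffspring X nu)%:R `^ b * T X r k nu `^ p)
  <= C * nmoment Q X (b + p).

Let good_pos X r : good X r -> 0 < r /\ 0 < meanN Q X.
Proof. by move=> [r0 /andP[h _]]; split => //; apply: lt_le_trans h; apply: lt_trans mlo1. Qed.

(** For T the sum of the normalised contributions of the children, B/E[B] is
    T/E[N].  In E[T^(1+p)] the leading term is A E[N] times the moment of one child,
    and dividing by E[N]^(1+p) leaves a factor A E[N]^(-p); with A = mlo^(p/2) it is
    below 1, so that the moments stay bounded along the heights. *)
Let moment_V_of_T p : 0 < p -> moment_T p -> moment_V p.
Proof.
move=> p0 HT.
have [C0 C00 H0] := HT 0 (lexx 0).
have mlo0 : 0 < mlo by exact: lt_trans mlo1.
pose A := mlo `^ (p / 2).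
have p20 : 0 < p / 2 by rewrite divr_gt0.
have A1 : 1 < A.
  by have := @gt0_ltr_powR R (p / 2) p20 1 mlo; rewrite powR1 !nnegrE ler01 (ltW mlo0); apply.
have [C1 C10 H1] := powR_add_le p0 A1.
pose rho := A^-1.
have A0 : 0 < A by exact: lt_trans A1.
have rho1 : rho < 1 by rewrite invf_lt1.
have r1 : 0 < 1 - rho by rewrite subr_gt0.
have rho0 : 0 <= rho by rewrite invr_ge0 ltW.
pose K := Num.max 1 (C1 * C0 / (1 - rho)).
have K1 : 1 <= K by rewrite le_max lexx.
have K0 : 0 < K by exact: lt_le_trans K1.
have KC : C1 * C0 <= (1 - rho) * K.
  by rewrite [leRHS]mulrC -ler_pdivrMr// /K le_max lexx orbT.
exists K => // X r k hg; have [r0 m0] := good_pos hg.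
have [_ /andP[mlo_le _]] := hg.
have m1 : 1 <= meanN Q X by apply: le_trans mlo_le; exact: ltW.
pose z := nmoment Q X p.
have z1 : 1 <= z by apply: le_trans m1 _; apply: nmoment_mean; exact: ltW.
have z0 : 0 <= z by exact: le_trans z1.
have stepV j : Ex Q (fun nu => xi X r j nu `^ (1 + p)) <= K * z ->
    Ex Q (fun nu => normalized_bval X r j nu `^ (1 + p)) <= K * z.
  move=> hw; rewrite normalized_powR// ler_pdivrMr ?powR_gt0//.
  apply: (le_trans (normalized_moment_step0 r0 m0 j p0 (ltW C10) H1)).
  have := H0 X r j hg; rewrite add0r -/z => h0.
  have M1 : meanN Q X <= rho * meanN Q X `^ (1 + p) / A.
    rewrite powR_D1 ?(ltW m0)//.
    have -> : rho * (meanN Q X * meanN Q X `^ p) / A =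
      meanN Q X * (meanN Q X `^ p * (rho / A)) by ring.
    rewrite ler_peMr ?(ltW m0)//.
    have -> : rho / A = (mlo `^ p)^-1.
      rewrite /rho -invfM /A -powRD; last by rewrite gt_eqF ?implybT// addr_gt0.
      by congr ((_ `^ _)^-1); field.
    rewrite ler_pdivlMr ?powR_gt0// mul1r.
    by apply: ge0_ler_powR; rewrite ?nnegrE ?(ltW p0) ?(ltW mlo0) ?(ltW m0).
  have P1 : 1 <= meanN Q X `^ (1 + p) by rewrite powR_ge1// addr_ge0// ltW.
  apply: (@le_trans _ _ (A * (rho * meanN Q X `^ (1 + p) / A * (K * z)) + C1 * (C0 * z))).
    apply: lerD; last by rewrite ler_pM2l.
    rewrite ler_pM2l//; apply: ler_pM => //; first exact: ltW.
    by apply: Ex_ge0 => nu; exact: powR_ge0.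
  have -> : A * (rho * meanN Q X `^ (1 + p) / A * (K * z)) =
     rho * K * z * meanN Q X `^ (1 + p) by field; rewrite gt_eqF.
  apply: (@le_trans _ _ (rho * K * z * meanN Q X `^ (1 + p) + (1 - rho) * K * z * meanN Q X `^ (1 + p))).
    rewrite lerD2l mulrA; apply: (@le_trans _ _ ((1 - rho) * K * z)).
      by rewrite ler_wpM2r.
    by rewrite ler_peMr// !mulr_ge0// ltW.
  by rewrite -mulrDl -!mulrA -mulrDl addrC subrK mul1r mulrA.
have hw j : Ex Q (fun nu => xi X r j nu `^ (1 + p)) <= K * z.
  elim: j => [|j ih].
    rewrite [leLHS](xi0_moment X r p); exact: mulr_ege1 K1 z1.
  exact: le_trans (xi_dispersion r0 m0 j p0) (stepV j ih).
split; [exact: (hw k) | exact: (stepV k (hw k))].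
Qed.

(** Induction on an integer bound for the order.  For p <= 1 the moments of T follow
    from Jensen's inequality.  Otherwise, expanding one factor of T^p produces the
    order p - 1, and the product of moments of N that appears is recombined by
    [nmoment_assoc]. *)
Let moment_induction n : forall p, 0 < p -> p <= n%:R -> moment_V p /\ moment_T p.
Proof.
elim: n => [|n ih] p p0 pn; first by have := lt_le_trans p0 pn; rewrite ltxx.
suff HT : moment_T p by split => //; exact: moment_V_of_T.
have [p1|p1] := leP p 1.
  move=> b b0; exists 1 => // X r k hg; have [r0 m0] := good_pos hg.
  by rewrite mul1r; apply: sum_xi_moment_le1 => //; rewrite p0.
have q0 : 0 < p - 1 by rewrite subr_gt0.
have qn : p - 1 <= n%:R by rewrite lerBlDr natr1.
have [[C1 C10 H1] HT'] := ih _ q0 qn.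
move=> b b0.
have b1 : 0 <= b + 1 by rewrite addr_ge0.
have [C2 C20 H2] := HT' (b + 1) b1.
have [C C0 HC] := powR_add_le q0 (ltr1n R 2 : 1 < 2).
pose mh := Num.max 1 mhi.
have mh0 : 0 < mh by rewrite lt_max ltr01.
exists (2 * (mh * C1) + C * C2).
  by rewrite addr_gt0 ?mulr_gt0.
move=> X r k hg; have [r0 m0] := good_pos hg.
have [_ /andP[_ mhi_le]] := hg.
have pE : p = 1 + (p - 1) by rewrite addrC subrK.
have z0 a : 0 <= nmoment Q X a.
  by apply: Ex_ge0 => nu; rewrite mulr_ge0// powR_ge0.
rewrite {1}pE; apply: (le_trans (normalized_moment_step r0 m0 k q0 (ltW C0) b0 HC)).
rewrite [leRHS]mulrDl; apply: lerD; last first.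
  rewrite -mulrA ler_pM2l//; apply: (le_trans (H2 X r k hg)).
  by rewrite -addrA subrKC.
rewrite -mulrA ler_pM2l//.
apply: (@le_trans _ _ (nmoment Q X (b + 1) * (C1 * nmoment Q X (p - 1)))).
  by apply: ler_wpM2l; [exact: z0 | exact: (proj1 (H1 X r k hg))].
rewrite mulrCA [mh * C1]mulrC -mulrA ler_pM2l//.
have := @nmoment_assoc R Q X _ _ b1 (ltW q0); rewrite -addrA subrKC => /le_trans; apply.
by rewrite ler_wpM2r// le_max mhi_le orbT.
Qed.

(** The constant depends on neither the height nor the truncation level, so the
    latter may be adapted to the drift. *)
Theorem normalized_bval_moment p : 0 < p -> exists2 C, 0 < C & forall X r k,
  0 < r -> mlo <= meanN Q X <= mhi ->
  Ex Q (fun nu => normalized_bval X r k nu `^ (1 + p)) <= C * nmoment Q X p.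
Proof.
move=> p0; have pn : p <= (Num.bound p)%:R.
  exact/ltW/archi_boundP/ltW.
have [[C C0 H] _] := moment_induction p0 pn.
by exists C => // X r k r0 hm; have [] := H X r k (conj r0 hm).
Qed.

End normalized_moments.

(** * Lower recursion and concentration *)

Section lower_tail_event.
Context d (T : measurableType d) (R : realType) (P : probability T R).

Lemma lt_indicE (f : T -> R) (t : R) :
  (fun w => (f w < t)%R%:R) = \1_[set w | f w < t] :> (T -> R).
Proof.
apply/funext => w; rewrite indicE; congr (_ %:R)%R.
by case: (boolP (f w < t)) => h; [rewrite mem_set | rewrite memNset//; exact/negP].
Qed.

Lemma measurable_lt_event (f : T -> R) (t : R) : bounded_rv f ->
  measurable [set w | f w < t].
Proof.
move=> [mf _]; rewrite (_ : [set w | f w < t] = f @^-1` `]-oo, t[%classic).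
  by rewrite -[X in measurable X]setTI; exact: mf.
by apply/seteqP; split => w /=; rewrite in_itv.
Qed.

Lemma bounded_rv_lt (f : T -> R) (t : R) : bounded_rv f ->
  bounded_rv (fun w => (f w < t)%R%:R : R).
Proof.
by move=> bf; rewrite lt_indicE; apply: bounded_rv_indic; exact: measurable_lt_event.
Qed.

Lemma Ex_lt (f : T -> R) (t : R) : bounded_rv f ->
  ((Ex P (fun w => (f w < t)%R%:R))%:E = P [set w | (f w < t)%R])%E.
Proof.
by move=> bf; rewrite lt_indicE Ex_indic//; exact: measurable_lt_event.
Qed.

End lower_tail_event.

(** A Paley-Zygmund bound: a uniform moment of order larger than one prevents the
    mass from concentrating below half the mean. *)
Lemma paley_zygmund (R : realType) (p C : R) : 0 < p -> 0 < C ->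
  exists2 dl : R, 0 < dl <= 1 & forall d (T : measurableType d) (P : probability T R)
    (f : T -> R), bounded_rv f -> (forall w, 0 <= f w) -> Ex P f = 1 ->
    Ex P (fun w => f w `^ (1 + p)) <= C ->
    Ex P (fun w => (f w < 2^-1)%R%:R) <= 1 - dl.
Proof.
move=> p0 C0.
pose A := Num.max 1 ((4 * C) `^ p^-1).
have A1 : 1 <= A by rewrite le_max lexx.
have A0 : 0 < A by exact: lt_le_trans A1.
have Ap0 : 0 < A `^ p by rewrite powR_gt0.
have AC : 4 * C <= A `^ p.
  have C4 : 0 <= 4 * C by rewrite mulr_ge0// ltW.
  rewrite (_ : 4 * C = ((4 * C) `^ p^-1) `^ p); last first.
    by rewrite -powRrM mulVf ?gt_eqF// powRr1.
  apply: ge0_ler_powR; rewrite ?nnegrE ?powR_ge0 ?(ltW p0) ?(ltW A0)//.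
 by rewrite /A le_max lexx orbT.
exists ((4 * A)^-1).
  rewrite invr_gt0 mulr_gt0//= invf_le1 ?mulr_gt0//; lra.
move=> d T P f bf f0 Ef Ep.
have p1 : 0 <= 1 + p by rewrite addr_ge0// ltW.
have bfp := bounded_rv_powR f0 p1 bf.
have blt := bounded_rv_lt 2^-1 bf.
have bA : bounded_rv (fun w => A * (1 - (f w < 2^-1)%R%:R)).
  by apply: bounded_rvZ; apply: bounded_rvB => //; exact: bounded_rv_cst.
have bB : bounded_rv (fun w => 2^-1 + A * (1 - (f w < 2^-1)%R%:R)).
  by apply: bounded_rvD => //; exact: bounded_rv_cst.
have bC : bounded_rv (fun w => (A `^ p)^-1 * f w `^ (1 + p)) by exact: bounded_rvZ.
have : Ex P f <= Ex P (fun w => 2^-1 + A * (1 - (f w < 2^-1)%R%:R) + (A `^ p)^-1 * f w `^ (1 + p)).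
  apply: Ex_le => //; first exact: bounded_rvD.
  move=> w; have w0 := f0 w; have fp0 := powR_ge0 (f w) (1 + p).
  have q0 : 0 <= (A `^ p)^-1 * f w `^ (1 + p) by rewrite mulr_ge0// invr_ge0 ltW.
  have [h|h] := ltP (f w) 2^-1.
    by rewrite subrr mulr0 addr0; lra.
  rewrite subr0 mulr1; have [hA|hA] := leP (f w) A; first by lra.
  have : f w <= (A `^ p)^-1 * f w `^ (1 + p).
    rewrite powR_D1// mulrCA ler_peMr// mulrC ler_pdivlMr// mul1r.
    by apply: ge0_ler_powR; rewrite ?nnegrE ?(ltW p0) ?(ltW A0)// ltW.
  lra.
rewrite Ef ExD// ExD//; last exact: bounded_rv_cst.
rewrite ExZ; last by apply: bounded_rvB => //; exact: bounded_rv_cst.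
rewrite ExB//; last exact: bounded_rv_cst.
rewrite !Ex_cst ExZ//.
have hC : (A `^ p)^-1 * Ex P (fun w => f w `^ (1 + p)) <= 4^-1.
  rewrite mulrC ler_pdivrMr//; apply: (le_trans Ep); lra.
set e := Ex P _ => h.
have h4 : 4^-1 <= A * (1 - e) by lra.
have : (4 * A)^-1 <= 1 - e by rewrite invfM ler_pdivrMr// mulrC.
lra.
Qed.

Section lower_recursion.
Context (R : realType) (Q : probability tree R) (mu : probability nat R).
Hypothesis QG : gw_tree Q mu.
Variables (g : R -> R) (gi : R).
Hypothesis Hg : conductance g gi.

Lemma Ex_bvalS X r k : 0 < r ->
  Ex Q (bval g gi X r k.+1) = r * meanN Q X * Ex Q (fun nu => g (bval g gi X r k nu)).
Proof. by move=> r0; rewrite (Ex_bval QG Hg)// mulrA. Qed.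

(** Monotonicity of [g] allows the normalised value to be multiplied by any level y
    below the mean, so that the bound is stated for all such y. *)
Lemma Ex_bval_recursion_ge X r k (s kappa C y : R) : 0 < r -> 0 < meanN Q X ->
  0 < s -> 0 <= kappa -> (forall t, 0 <= t -> t - kappa * t `^ (s + 1) <= g t) ->
  Ex Q (fun nu => normalized_bval Q g gi X r k nu `^ (1 + s)) <= C ->
  0 <= y -> y <= Ex Q (bval g gi X r k) ->
  r * meanN Q X * (y * (1 - kappa * C * y `^ s)) <= Ex Q (bval g gi X r k.+1).
Proof.
move=> r0 m0 s0 kappa0 hlow hC y0 yx.
rewrite Ex_bvalS// ler_pM2l ?mulr_gt0//.
set x := Ex Q (bval g gi X r k) in yx *.
have x0 : 0 < x by exact: (Ex_bval_gt0 QG Hg).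
pose V := normalized_bval Q g gi X r k.
have bV : bounded_rv V by exact: (bounded_normalized_bval Q Hg X r0 k).
have V0 nu : 0 <= V nu by exact: (normalized_bval_ge0 QG Hg).
have s1 : 0 <= 1 + s by rewrite addr_ge0// ltW.
have bVs := bounded_rv_powR V0 s1 bV.
apply: (@le_trans _ _ (Ex Q (fun nu => y * V nu - kappa * y `^ (1 + s) * V nu `^ (1 + s)))).
  rewrite ExB; [|exact: bounded_rvZ|exact: bounded_rvZ].
  rewrite !ExZ// (Ex_normalized_bval QG Hg)// mulr1 mulrBr mulr1 lerD2l lerN2.
  rewrite powR_D1//.
  have -> : y * (kappa * C * y `^ s) = kappa * (y * y `^ s) * C by ring.
  by rewrite ler_wpM2l// !mulr_ge0// powR_ge0.
apply: Ex_le => [||nu].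
- by apply: bounded_rvB; exact: bounded_rvZ.
- exact: (bounded_gval Hg X r0 k.+1).
have b0 := bval_ge0 Hg X r0 k nu.
have -> : kappa * y `^ (1 + s) * V nu `^ (1 + s) = kappa * (y * V nu) `^ (s + 1).
  by rewrite -mulrA powRM// [s + 1]addrC.
apply: (@le_trans _ _ (g (y * V nu))); first by apply: hlow; rewrite mulr_ge0.
apply: (cond_nd Hg); rewrite /V /normalized_bval -/x mulrCA.
by rewrite ler_piMr// ler_pdivrMr// mul1r.
Qed.

Lemma Ex_bval_le X r k : 0 < r -> 0 < meanN Q X -> (forall t, 0 <= t -> g t <= t) ->
  Ex Q (bval g gi X r k.+1) <= r * meanN Q X * Ex Q (bval g gi X r k).
Proof.
move=> r0 m0 gt; rewrite Ex_bvalS// ler_pM2l ?mulr_gt0//.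
apply: Ex_le => [||nu].
- exact: (bounded_gval Hg X r0 k.+1).
- exact: (bounded_bval Hg X r0 k).
- by apply: gt; exact: (bval_ge0 Hg X r0).
Qed.

Let pr X r k t : R := Ex Q (fun nu => (bval g gi X r k nu < t)%R%:R).

Hypothesis mu0 : mu [set 0%N] = 0%E.

Let mu1 : R := Ex mu (fun j => (j == 1%N)%:R).

Lemma offspring_zero X : (1 < X)%N -> Ex Q (fun nu => (noffspring X nu == 0%N)%:R) = 0.
Proof.
move=> X1; rewrite (_ : (fun nu => _) = (fun nu : tree => (nu [::] == 0%N)%:R)); last first.
  apply/funext => nu; rewrite /noffspring; congr (_ %:R)%R.
  by case: (nu [::]) => [|j]; rewrite ?min0n//; case: X X1 => // X _; rewrite minnSS.
rewrite (Ex_label QG (phi := fun j => (j == 0%N)%:R)); last first.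
  by exists 1 => j; case: (j == 0%N); rewrite ?normr1 ?normr0.
apply: EFin_inj; transitivity (mu [set 0%N]); last exact: mu0.
rewrite -Ex_indic//; congr ((Ex mu _)%:E).
apply/funext => j; rewrite indicE; congr (_ %:R)%R.
by case: eqP => [->|h]; [rewrite mem_set | rewrite memNset].
Qed.

Lemma offspring_one X : (1 < X)%N -> Ex Q (fun nu => (noffspring X nu == 1%N)%:R) = mu1.
Proof.
move=> X1; rewrite (_ : (fun nu => _) = (fun nu : tree => (nu [::] == 1%N)%:R)); last first.
  apply/funext => nu; rewrite /noffspring; congr (_ %:R)%R.
  case: X X1 => [//|[//|X]] _.
  by case: (nu [::]) => [|[|j]]; rewrite ?min0n// !minnSS ?min0n// minnS.
rewrite (Ex_label QG (phi := fun j => (j == 1%N)%:R))//.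
by exists 1 => j; case: (j == 1%N); rewrite ?normr1 ?normr0.
Qed.

(** If the value at height k+1 is small, then so is the value at each child; there
    are at least two of these with positive probability. *)
Lemma lower_tail_step X r k t : 0 < r -> (1 < X)%N ->
  pr X r k.+1 (r * g t) <= pr X r k t * (mu1 + (1 - mu1) * pr X r k t).
Proof.
move=> r0 X1.
pose J nu : R := (bval g gi X r k nu < t)%R%:R.
have bJ : bounded_rv J by apply: bounded_rv_lt; exact: (bounded_bval Hg X r0).
pose e0 nu : R := (noffspring X nu == 0%N)%:R.
pose e1 nu : R := (noffspring X nu == 1%N)%:R.
pose e2 nu : R := (1 < noffspring X nu)%N%:R.
have be0 : bounded_rv e0 by exact: (bounded_rv_offspring X (fun j => (j == 0%N)%:R)).
have be1 : bounded_rv e1 by exact: (bounded_rv_offspring X (fun j => (j == 1%N)%:R)).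
have be2 : bounded_rv e2 by exact: (bounded_rv_offspring X (fun j => (1 < j)%N%:R)).
have bJi i := bounded_rv_subtree i bJ.
have E2 : Ex Q e2 = 1 - mu1.
  have : Ex Q (fun nu => e0 nu + e1 nu + e2 nu) = 1.
    rewrite -[RHS](Ex_cst Q); congr Ex; apply/funext => nu.
    by rewrite /e0 /e1 /e2; case: (noffspring X nu) => [|[|j]] /=; rewrite ?addr0 ?add0r.
  rewrite ExD//; last exact: bounded_rvD.
  rewrite ExD// offspring_zero// offspring_one//; lra.
pose F nu := e0 nu + (J (subtree 0 nu) * e1 nu +
  J (subtree 0 nu) * (J (subtree 1 nu) * e2 nu)).
have EF : Ex Q F = pr X r k t * (mu1 + (1 - mu1) * pr X r k t).
  rewrite /F ExD//; last by apply: bounded_rvD; do ?apply: bounded_rvM.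
  rewrite ExD; [|exact: bounded_rvM|by do ?apply: bounded_rvM].
  rewrite offspring_zero// add0r.
  rewrite (@Ex_branching R Q mu QG 0 J e1)// offspring_one//.
  rewrite (@Ex_branching R Q mu QG 0 J (fun nu => J (subtree 1 nu) * e2 nu))//; last first.
    exact: bounded_rvM.
  by rewrite (@Ex_branching R Q mu QG 1 J e2)// E2 -/(pr X r k t); ring.
rewrite -EF; apply: Ex_le => [||nu].
- by apply: bounded_rv_lt; exact: (bounded_bval Hg X r0).
- by rewrite /F; do !(apply: bounded_rvD => //); do ?apply: bounded_rvM.
have J0 i : 0 <= J (subtree i nu) by rewrite ler0n.
have e00 : 0 <= e0 nu by rewrite ler0n.
have e10 : 0 <= e1 nu by rewrite ler0n.
have e20 : 0 <= e2 nu by rewrite ler0n.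
have F0 : 0 <= F nu by rewrite /F !addr_ge0// !mulr_ge0.
have [h|//] := boolP (bval g gi X r k.+1 nu < r * g t).
have child i : (i < noffspring X nu)%N -> J (subtree i nu) = 1.
  move=> iN; rewrite /J (_ : _ < t)// ltNge; apply/negP => ht.
  move: h; rewrite ltNge => /negP; apply; rewrite /bval ler_pM2l//.
  rewrite (bigD1 (Ordinal iN))//= ler_wpDr//.
    by apply: sumr_ge0 => j _; exact: (gval_ge0 Hg X r0 k.+1).
  exact: (cond_nd Hg).
rewrite /F /e0 /e1 /e2.
case NE : (noffspring X nu) => [|[|j]] /=.
- by rewrite lerDl addr_ge0// !mulr_ge0.
- by rewrite child ?NE// mulr1 add0r !mulr0 addr0.
- by rewrite !child ?NE// !mulr1 mulr0 !add0r.
Qed.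

Lemma lower_tail_mono X r k t u : 0 < r -> t <= u -> pr X r k t <= pr X r k u.
Proof.
move=> r0 tu; apply: Ex_le => [||nu].
- by apply: bounded_rv_lt; exact: (bounded_bval Hg X r0).
- by apply: bounded_rv_lt; exact: (bounded_bval Hg X r0).
by rewrite ler_nat; case: ltP => // h; rewrite (lt_le_trans h tu).
Qed.

(** As long as the tail probability is at most 1 - dl, one generation multiplies it
    by at most rho; the threshold shrinks by [c], since r g is bounded below by a
    linear function on bounded sets. *)
Lemma lower_tail_iter X r k t c dl rho i : 0 < r -> (1 < X)%N -> 0 <= c <= 1 ->
  0 <= t -> (forall u, 0 <= u -> u <= t -> c * u <= r * g u) ->
  0 <= dl -> mu1 <= 1 -> pr X r k t <= 1 - dl -> mu1 + (1 - mu1) * (1 - dl) <= rho ->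
  rho <= 1 -> pr X r (k + i) (c ^+ i * t) <= rho ^+ i * (1 - dl).
Proof.
move=> r0 X1 /andP[c0 c1] t0 hc dl0 m1 h0 hrho rho1.
have p0 j u : 0 <= pr X r j u by apply: Ex_ge0 => nu; rewrite ler0n.
have mu10 : 0 <= mu1 by apply: Ex_ge0 => j; rewrite ler0n.
have dl1 : 0 <= 1 - dl by exact: le_trans h0.
have rho0 : 0 <= rho by apply: le_trans hrho; rewrite addr_ge0// mulr_ge0// subr_ge0.
elim: i => [|i ih]; first by rewrite addn0 !expr0 !mul1r.
have ct0 : 0 <= c ^+ i * t by rewrite mulr_ge0// exprn_ge0.
have ctt : c ^+ i * t <= t by rewrite ler_piMl// exprn_ile1.
rewrite addnS exprS -mulrA.
apply: (le_trans (lower_tail_mono _ _ r0 (hc _ ct0 ctt))).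
apply: (le_trans (lower_tail_step _ _ r0 X1)).
have q : pr X r (k + i) (c ^+ i * t) <= 1 - dl.
  by apply: (le_trans ih); rewrite ler_piMl// exprn_ile1.
rewrite exprS -mulrA [leRHS]mulrC; apply: ler_pM => //.
  by rewrite addr_ge0// mulr_ge0// subr_ge0.
apply: le_trans hrho; rewrite lerD2l ler_wpM2l// subr_ge0//.
Qed.

End lower_recursion.

(** * Truncated moments of the offspring law *)

Section truncated_moments.
Context (R : realType) (mu : probability nat R).
Hypothesis mu0 : mu [set 0%N] = 0%E.
Variables (s q alpha : R).
Hypotheses (s0 : 0 < s) (hq : q = s + 1).

Let q0 : 0 < q. Proof. by rewrite hq addr_gt0. Qed.

Definition tmoment (x : R) : R := Ex mu (fun j : nat => Num.min j%:R x `^ q).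

Lemma min_nat_bound (j : nat) (x : R) : 0 <= x -> 0 <= Num.min (j%:R : R) x <= x.
Proof. by move=> x0; rewrite le_min ler0n x0/= ge_min lexx orbT. Qed.

Lemma bounded_tmoment (x : R) : 0 <= x ->
  bounded_rv (fun j : nat => Num.min (j%:R : R) x `^ q).
Proof.
move=> x0; split => //; exists (x `^ q) => j; have /andP[a b] := min_nat_bound j x0.
by rewrite ger0_norm ?powR_ge0//; apply: ge0_ler_powR; rewrite ?nnegrE ?(ltW q0).
Qed.

Lemma truncated_momentE (x : R) : 0 <= x -> truncated_moment mu q x = (tmoment x)%:E.
Proof.
move=> x0; rewrite /truncated_moment unlock.
exact: (Ex_EFin mu (bounded_tmoment x0)).
Qed.

Lemma tmoment_le (x y : R) : 0 <= x -> x <= y -> tmoment x <= tmoment y.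
Proof.
move=> x0 xy; have y0 : 0 <= y by exact: le_trans xy.
apply: Ex_le => [||j]; [exact: bounded_tmoment..|].
have /andP[a b] := min_nat_bound j x0.
apply: ge0_ler_powR; rewrite ?nnegrE ?(ltW q0)//.
  by have /andP[] := min_nat_bound j y0.
by rewrite le_min !ge_min lexx xy orbT.
Qed.

Lemma tmoment_ge_min (x : R) : 0 <= x -> Num.min 1 x `^ q <= tmoment x.
Proof.
move=> x0; rewrite -[leLHS](Ex_cst mu); apply: (Ex_le_ae (A := [set 0%N])) => //.
- exact: bounded_rv_cst.
- exact: bounded_tmoment.
move=> [|j] /=; first by case.
move=> _; have m1 : 0 <= Num.min 1 x by rewrite le_min ler01.
have /andP[a b] := min_nat_bound j.+1 x0.
apply: ge0_ler_powR; rewrite ?nnegrE ?(ltW q0)//.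
by rewrite le_min !ge_min lexx ler1n orbT.
Qed.

Variables (L h hi : R -> R) (beta : R).
Hypothesis S : scale_function h hi beta.

Let f (x : R) := L x^-1 * x `^ (alpha - 1).

Hypothesis hf : exists2 x0 : R, 0 < x0 <= 1 & forall x,
  0 < x -> x <= x0 -> (1 - 2^-1) * f x <= h x <= (1 + 2^-1) * f x.

Let fE y : 0 < y -> L y^-1 * y^-1 `^ (q - alpha) = y `^ (- s) * f y.
Proof.
move=> y0; rewrite /f mulrCA; congr (_ * _).
rewrite -powR_inv1 ?(ltW y0)// -powRrM -powRD; last by rewrite (gt_eqF y0) implybT.
by congr (_ `^ _); rewrite hq; ring.
Qed.

(** Near 0, [h] is comparable with y^s times the assumed bound at level 1/y; away
    from 0 both sides are bounded above and below. *)
Lemma tmoment_lower (c1 M : R) : 0 < c1 -> 0 < M ->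
  (forall x, 1 <= x -> c1 * L x * x `^ (q - alpha) <= tmoment x) ->
  exists2 c, 0 < c & forall y, 0 < y -> y <= M -> c * h y <= y `^ s * tmoment y^-1.
Proof.
move=> c10 M0 hl; have [x0 /andP[x00 x01] H] := hf.
have hM := scale_gt0 S M0.
pose w := Num.min (x0 `^ s) M^-1.
have w0 : 0 < w by rewrite lt_min powR_gt0//= invr_gt0.
exists (Num.min (c1 / 2) (w / h M)).
  by rewrite lt_min !divr_gt0.
move=> y y0 yM; have hy := scale_gt0 S y0; have ys : 0 < y `^ s by rewrite powR_gt0.
have yi0 : 0 <= y^-1 by rewrite invr_ge0 ltW.
have [yx|xy] := leP y x0.
  apply: (@le_trans _ _ (c1 / 2 * h y)).
    by rewrite ler_pM2r// ge_min lexx.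
  have /andP[_ h2] := H _ y0 yx.
  have y1 : 1 <= y^-1 by rewrite invf_ge1//; exact: le_trans x01.
  have := hl _ y1; rewrite -mulrA fE// => h1.
  apply: (@le_trans _ _ (y `^ s * (c1 * (y `^ (- s) * f y)))); last by rewrite ler_pM2l.
  have -> : y `^ s * (c1 * (y `^ (- s) * f y)) = c1 * f y.
    by rewrite powRN; field; rewrite gt_eqF.
  rewrite -mulrA ler_pM2l//; have := le_trans (ltW hy) h2.
  rewrite pmulr_rge0 ?addr_gt0 ?invr_gt0// => f0.
  lra.
apply: (@le_trans _ _ (w / h M * h y)).
  by rewrite ler_pM2r// ge_min lexx orbT.
apply: (@le_trans _ _ w).
  rewrite mulrAC ler_pdivrMr// ler_pM2l//; exact: (scale_le S).
apply: (@le_trans _ _ (y `^ s * Num.min 1 y^-1 `^ q)); last first.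
  by rewrite ler_pM2l// tmoment_ge_min.
have [y1|y1] := leP y 1.
  have -> : Num.min 1 y^-1 = 1 by rewrite min_l// invf_ge1.
  rewrite powR1 mulr1 ge_min; apply/orP; left.
  by apply: ge0_ler_powR; rewrite ?nnegrE ?(ltW s0) ?(ltW x00) ?(ltW y0) ?(ltW xy).
have -> : Num.min 1 y^-1 = y^-1 by rewrite min_r// invf_le1// ltW.
rewrite hq -powR_inv1 ?(ltW y0)// -powRrM -powRD; last by rewrite (gt_eqF y0) implybT.
have -> : s + -1 * (s + 1) = -1 by ring.
rewrite powR_inv1 ?(ltW y0)// ge_min; apply/orP; right.
by rewrite lef_pV2 ?posrE.
Qed.

Section upper_tail.
Variable c2 : R.
Hypothesis c20 : 0 < c2.
Hypothesis hu : forall x, 1 <= x -> tmoment x <= c2 * L x * x `^ (q - alpha).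

Lemma tmoment_upper : exists2 C, 0 < C & forall x, 1 <= x ->
  tmoment x <= C * (x `^ s * h x^-1).
Proof.
have [x0 /andP[x00 x01] H] := hf.
have h0 := scale_gt0 S x00.
exists (Num.max (2 * c2) (tmoment x0^-1 / h x0)).
  by rewrite lt_max mulr_gt0.
move=> x x1; have xp : 0 < x by exact: lt_le_trans x1.
have xi0 : 0 < x^-1 by rewrite invr_gt0.
have hx := scale_gt0 S xi0.
have xs : 1 <= x `^ s by rewrite powR_ge1// ltW.
have xs0 : 0 < x `^ s * h x^-1 by rewrite mulr_gt0 ?powR_gt0.
have [xx|xx] := leP x^-1 x0.
  apply: (@le_trans _ _ (2 * c2 * (x `^ s * h x^-1))); last first.
    by rewrite ler_pM2r// le_max lexx.
  have /andP[h1 _] := H _ xi0 xx.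
  apply: (le_trans (hu x1)).
  have := fE xi0; rewrite invrK => e.
  rewrite -[leLHS]mulrA e -powR_inv1 ?(ltW xp)// -powRrM.
  have -> : -1 * - s = s by ring.
  rewrite powR_inv1 ?(ltW xp)//.
  have -> : 2 * c2 * (x `^ s * h x^-1) = c2 * (x `^ s * (2 * h x^-1)) by ring.
  rewrite ler_pM2l// ler_pM2l ?powR_gt0//; lra.
apply: (@le_trans _ _ (tmoment x0^-1 / h x0 * (x `^ s * h x^-1))); last first.
  by rewrite ler_pM2r// le_max lexx orbT.
apply: (@le_trans _ _ (tmoment x0^-1)).
  apply: tmoment_le; first exact: ltW.
  by rewrite -[leLHS]invrK lef_pV2 ?posrE ?ltW.
have t0 : 0 <= tmoment x0^-1 by apply: Ex_ge0 => j; exact: powR_ge0.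
rewrite -mulrA ler_peMr// ler_pdivlMl// mulr1.
apply: (@le_trans _ _ (h x^-1)); first by apply: (scale_le S) => //; exact: ltW.
by rewrite ler_peMl// ltW.
Qed.

(** The integrand of [nmoment], as a function of the offspring number. *)
Definition tpow (X : nat) (p : R) (j : nat) : R :=
  (minn j X)%:R * (minn j X)%:R `^ p.

Lemma tpow_bounded X p : 0 <= p -> exists M, forall j, `|tpow X p j| <= M.
Proof.
move=> p0; exists (X%:R * X%:R `^ p) => j.
rewrite ger0_norm ?mulr_ge0 ?powR_ge0//; apply: ler_pM; rewrite ?powR_ge0//.
  by rewrite ler_nat geq_minr.
by apply: ge0_ler_powR; rewrite ?nnegrE// ler_nat geq_minr.
Qed.

Lemma bounded_tpow X p : 0 <= p -> bounded_rv (tpow X p).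
Proof. by move=> p0; split => //; exact: tpow_bounded. Qed.

(** The two truncations differ only where j > X, and there min(j, X) = X. *)
Lemma tpow_double X p j : (0 < X)%N -> 0 <= p ->
  tpow (2 * X) p j <= tpow X p j +
    2 `^ (1 + p) * X%:R `^ (p - s) * Num.min j%:R X%:R `^ q.
Proof.
move=> X0 p0; have Xp : 0 < X%:R :> R by rewrite ltr0n.
have c0 : 0 <= 2 `^ (1 + p) * X%:R `^ (p - s) * Num.min j%:R X%:R `^ q.
  by rewrite !mulr_ge0 ?powR_ge0.
have [jX|Xj] := leqP j X.
  rewrite /tpow (minn_idPl jX) (minn_idPl (leq_trans jX _)) ?lerDl//.
  by rewrite leq_pmull.
have mX : Num.min (j%:R : R) X%:R = X%:R by rewrite min_r// ler_nat ltnW.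
rewrite mX -mulrA -powRD; last by rewrite (gt_eqF Xp) implybT.
have -> : p - s + q = 1 + p by rewrite hq; ring.
apply: (@le_trans _ _ ((2 * X)%:R `^ (1 + p))); last first.
  rewrite natrM powRM ?(ltW Xp)// lerDr /tpow.
  by rewrite mulr_ge0 ?powR_ge0.
rewrite powRD ?powRr1//; last by rewrite gt_eqF// ltr_wpDr.
rewrite /tpow; apply: ler_pM; rewrite ?powR_ge0//.
  by rewrite ler_nat geq_minr.
by apply: ge0_ler_powR; rewrite ?nnegrE// ler_nat geq_minr.
Qed.

(** Doubling the level X costs a term of order X^p h(1/X); since p < beta, these
    costs decrease geometrically along the dyadic levels. *)
Lemma tpow_growth p : 0 <= p -> p < beta -> exists2 C, 0 < C & forall X i,
  (0 < X)%N -> Ex mu (tpow (2 ^ i * X) p) <=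
    Ex mu (tpow X p) + C * (X%:R `^ p * h X%:R^-1).
Proof.
move=> p0 pb.
have [C1 C10 H1] := tmoment_upper.
have [C4 C40 H4] := scale_potter S (@ltr01 R).
pose th : R := 2 `^ (p - beta).
have th0 : 0 < th by rewrite powR_gt0.
have th1 : th < 1.
  rewrite /th -[ltRHS](powRr0 2) /powR pnatr_eq0/= ltr_expR mul0r nmulr_rlt0 ?subr_lt0//.
  by rewrite ln_gt0// ltr1n.
have r1 : 0 < 1 - th by rewrite subr_gt0.
pose K := 2 `^ (1 + p) * C1 * C4.
have K0 : 0 < K by rewrite !mulr_gt0 ?powR_gt0.
exists (K / (1 - th)); first by rewrite divr_gt0.
move=> X i X0; have Xp : 0 < X%:R :> R by rewrite ltr0n.
have Xi0 : 0 < X%:R^-1 :> R by rewrite invr_gt0.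
pose W := X%:R `^ p * h X%:R^-1.
have W0 : 0 < W by rewrite mulr_gt0 ?powR_gt0 ?(scale_gt0 S).
suff claim : Ex mu (tpow (2 ^ i * X) p) <=
    Ex mu (tpow X p) + K * ((1 - th ^+ i) / (1 - th)) * W.
  apply: (le_trans claim); rewrite lerD2l ler_pM2r// ler_pM2l// ler_pdivrMr//.
  by rewrite mulVf ?gt_eqF// gerBl exprn_ge0// ltW.
elim: i => [|i ih].
  by rewrite expn0 mul1n expr0 subrr mul0r mulr0 mul0r addr0.
set Y := (2 ^ i * X)%N in ih.
have Y0 : (0 < Y)%N by rewrite muln_gt0 expn_gt0.
have Yp : 0 < Y%:R :> R by rewrite ltr0n.
have Y1 : 1 <= Y%:R :> R by rewrite ler1n.
have XY : X%:R <= Y%:R :> R by rewrite ler_nat leq_pmull// expn_gt0.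
have Yi0 : 0 < Y%:R^-1 :> R by rewrite invr_gt0.
rewrite expnS -mulnA -/Y.
have bt := bounded_tmoment (ltW Yp).
apply: (@le_trans _ _ (Ex mu (fun j => tpow Y p j +
    2 `^ (1 + p) * Y%:R `^ (p - s) * Num.min j%:R Y%:R `^ q))).
  apply: Ex_le => [||j]; [exact: bounded_tpow| |exact: tpow_double].
  by apply: bounded_rvD; [exact: bounded_tpow | exact: bounded_rvZ].
rewrite ExD; [|exact: bounded_tpow|exact: bounded_rvZ].
rewrite ExZ// -/(tmoment Y%:R).
apply: (le_trans (lerD ih (lexx _))).
rewrite -addrA lerD2l.
have -> : K * ((1 - th ^+ i.+1) / (1 - th)) * W =
  K * ((1 - th ^+ i) / (1 - th)) * W + K * th ^+ i * W.
  by rewrite exprS; field; rewrite gt_eqF.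
rewrite lerD2l.
apply: (@le_trans _ _ (2 `^ (1 + p) * Y%:R `^ (p - s) * (C1 * (Y%:R `^ s * h Y%:R^-1)))).
  by rewrite ler_wpM2l ?mulr_ge0 ?powR_ge0// H1.
have -> : 2 `^ (1 + p) * Y%:R `^ (p - s) * (C1 * (Y%:R `^ s * h Y%:R^-1)) =
  2 `^ (1 + p) * C1 * (Y%:R `^ p * h Y%:R^-1).
  have -> : Y%:R `^ p = Y%:R `^ (p - s) * Y%:R `^ s :> R.
    by rewrite -powRD ?subrK// (gt_eqF Yp) implybT.
  by ring.
rewrite /K -!mulrA ler_pM2l ?powR_gt0// ler_pM2l//.
have := H4 _ _ Yi0 _ (_ : X%:R^-1 <= 1); rewrite lef_pV2 ?posrE// XY => /(_ isT).
rewrite invf_le1// ler1n X0 => /(_ isT) h4.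
apply: (@le_trans _ _ (Y%:R `^ p * (C4 * (Y%:R^-1 / X%:R^-1) `^ beta * h X%:R^-1))).
  by rewrite ler_pM2l ?powR_gt0.
have -> : Y%:R^-1 / X%:R^-1 = (2 ^+ i)^-1 :> R.
  by rewrite /Y natrM natrX; field; rewrite !gt_eqF// exprn_gt0.
have -> : Y%:R `^ p = (2 ^+ i) `^ p * X%:R `^ p :> R.
  by rewrite /Y natrM natrX powRM ?exprn_ge0 ?(ltW Xp).
have t0 : 0 < 2 ^+ i :> R by rewrite exprn_gt0.
have -> : (2 ^+ i)^-1 `^ beta = (2 ^+ i) `^ (- beta) :> R.
  by rewrite -powR_inv1 ?(ltW t0)// -powRrM mulN1r.
have -> : th ^+ i = (2 ^+ i) `^ p * (2 ^+ i) `^ (- beta).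
  rewrite -powRD; last by rewrite (gt_eqF t0) implybT.
  by rewrite /th -!powR_mulrn ?powR_ge0// -!powRrM mulrC.
by rewrite /W le_eqVlt; apply/orP; left; apply/eqP; ring.
Qed.

Lemma tpow_le X Y p : 0 <= p -> (X <= Y)%N -> Ex mu (tpow X p) <= Ex mu (tpow Y p).
Proof.
move=> p0 XY; apply: Ex_le => [||j]; [exact: bounded_tpow..|].
have m : (minn j X <= minn j Y)%N by rewrite leq_min geq_minl geq_min XY orbT.
apply: ler_pM; rewrite ?powR_ge0//; first by rewrite ler_nat.
by apply: ge0_ler_powR; rewrite ?nnegrE// ler_nat.
Qed.

Lemma tpow_uniformly_bounded p : 0 <= p -> p < beta ->
  exists2 C, 0 < C & forall X, Ex mu (tpow X p) <= C.
Proof.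
move=> p0 pb; have [C C0 H] := tpow_growth p0 pb.
exists (1 + C * (1 `^ p * h 1^-1)).
  by rewrite addr_gt0// !mulr_gt0 ?powR_gt0// (scale_gt0 S) ?invr_gt0.
move=> X; apply: (@le_trans _ _ (Ex mu (tpow (2 ^ X * 1) p))).
  by apply: tpow_le => //; rewrite muln1 ltnW// ltn_expl.
apply: (le_trans (H 1%N X isT)); rewrite lerD2r -[leRHS](Ex_cst mu).
apply: Ex_le => [||j]; [exact: bounded_tpow|exact: bounded_rv_cst|].
have : (minn j 1 <= 1)%N by rewrite geq_minr.
rewrite /tpow; case: (minn j 1) => [|[|//]] _; first by rewrite mul0r.
by rewrite mul1r powR1.
Qed.

Variable m : R.
Hypothesis hm : ('E_mu[fun k : nat => k%:R : R] = m%:E)%E.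

Lemma tpow0E X j : tpow X 0 j = (minn j X)%:R.
Proof. by rewrite /tpow powRr0 mulr1. Qed.

Lemma tpow_mean_le X : Ex mu (tpow X 0) <= m.
Proof.
rewrite -lee_fin -Ex_EFin; last exact: bounded_tpow.
rewrite -hm unlock; apply: ge0_le_integral => //.
- by move=> j _; rewrite lee_fin tpow0E.
- by move=> j _; rewrite lee_fin tpow0E ler_nat geq_minl.
Qed.

(** The first moment beyond the level X is the limit of the dyadic growth at p = 0,
    as the truncated means increase to m. *)
Lemma mean_defect : exists2 C, 0 < C & forall X, (0 < X)%N ->
  m <= Ex mu (tpow X 0) + C * h X%:R^-1.
Proof.
have [C C0 H] := tpow_growth (lexx 0) (scale_beta S).
exists C => // X X0.
pose B := Ex mu (tpow X 0) + C * h X%:R^-1.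
pose F i (j : nat) : \bar R := (tpow (2 ^ i * X) 0 j)%:E.
have mono (j : nat) : {homo F^~ j : i i' / (i <= i')%N >-> (i <= i')%E}.
  move=> i i' ii'; rewrite lee_fin !tpow0E ler_nat leq_min geq_minl geq_min.
  by rewrite leq_mul2r leq_exp2l// ii' !orbT.
have Fj (j : nat) : limn (F ^~ j) = (j%:R)%:E.
  apply/cvg_lim => //; apply: cvg_near_cst; exists j => // i /= ji.
  rewrite /F tpow0E (minn_idPl _)//; apply: (leq_trans ji).
  by apply: (leq_trans (ltnW (ltn_expl i (leqnn 2)))); rewrite leq_pmulr.
rewrite -lee_fin -hm unlock.
have -> : (\int[mu]_x (x%:R)%:E = limn (fun i => \int[mu]_x F i x))%E.
  rewrite -monotone_convergence//.
  - by apply: eq_integral => j _; rewrite Fj.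
  - by move=> i j _; rewrite lee_fin tpow0E.
apply: lime_le.
  apply: ereal_nondecreasing_is_cvgn => i i' ii'.
  apply: ge0_le_integral => //.
  - by move=> j _; rewrite lee_fin tpow0E.
  - by move=> j _; exact: mono.
apply: nearW => i; rewrite Ex_EFin; last exact: bounded_tpow.
rewrite lee_fin; apply: (le_trans (H X i X0)).
by rewrite powRr0 mul1r.
Qed.

(** The truncation level is lam / hi dl.  It must be high enough for the loss of
    mean, of order h at the inverse level, to be at most dl / 4 (whence lam, from
    the Potter bound), and not higher, because the truncated moment grows with
    it. *)
Lemma choose_truncation : exists dl0 D : R, [/\ 0 < dl0 <= 1, 0 < D & forall dl,
  0 < dl -> dl <= dl0 -> exists X : nat, [/\ (1 < X)%N,
    m * (1 - dl / 4) <= Ex mu (tpow X 0),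
    tmoment X%:R <= D * dl * (hi dl) `^ (- s) & (hi dl) `^ s <= D * dl]].
Proof.
have [C C0 HC] := mean_defect.
have [C1 C10 H1] := tmoment_upper.
have [C4 C40 H4] := scale_potter S (@ltr01 R).
have b0 := scale_beta S.
have h1 := scale_gt0 S (@ltr01 R).
have tm1 x : 1 <= x -> 1 <= tmoment x.
  move=> x1; apply: le_trans (tmoment_ge_min (le_trans ler01 x1)).
  by rewrite min_l// powR1.
have m1 : 1 <= m.
  apply: le_trans (tpow_mean_le 1); apply: le_trans (tm1 1 (lexx 1)) _.
  apply: Ex_le => [||j]; [exact: bounded_tmoment|exact: bounded_tpow|].
  rewrite tpow0E; case: j => [|j].
    by rewrite min_l// powR0// gt_eqF.
  by rewrite min_r ?ler1n// powR1 (minn_idPr _).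
pose lam := Num.max 1 ((4 * (C * C4)) `^ beta^-1).
have lam1 : 1 <= lam by rewrite le_max lexx.
have lam0 : 0 < lam by exact: lt_le_trans lam1.
have CC0 : 0 < C * C4 by rewrite mulr_gt0.
have lamb : 4 * (C * C4) <= lam `^ beta.
  have c4 : 0 <= 4 * (C * C4) by rewrite mulr_ge0// ltW.
  rewrite (_ : 4 * (C * C4) = ((4 * (C * C4)) `^ beta^-1) `^ beta); last first.
    by rewrite -powRrM mulVf ?gt_eqF// powRr1.
  apply: ge0_ler_powR; rewrite ?nnegrE ?powR_ge0 ?(ltW b0) ?(ltW lam0)//.
  by rewrite /lam le_max lexx orbT.
exists (Num.min 1 (h 1)), (C1 * (2 * lam) `^ s); split.
- by rewrite lt_min ltr01 h1/= ge_min lexx.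
- by rewrite mulr_gt0 ?powR_gt0 ?mulr_gt0.
move=> dl dlp; rewrite le_min => /andP[dl1 dlh].
set y0 := hi dl; have y00 : 0 < y0 by exact: (scale_inv_gt0 S).
have y01 : y0 <= 1 by rewrite -(scale_hK S (@ltr01 R)) (scale_inv_le S).
have ly1 : 1 <= lam / y0 by rewrite ler_pdivlMr// mul1r (le_trans y01).
have [n n1 n2] : exists2 n : nat, n%:R <= lam / y0 & lam / y0 < n.+1%:R.
  have /andP[] := truncn_itv (le_trans ler01 ly1).
  by exists (Num.truncn (lam / y0)).
have n0 : (0 < n)%N.
  by rewrite lt0n; apply/eqP => e; move: n2; rewrite e ltNge ly1.
have X0 : 0 < n.+1%:R :> R by rewrite ltr0n.
have Xle : n.+1%:R <= 2 * lam / y0.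
  by rewrite -natr1 -mulrA mulr_natl mulr2n lerD.
have Xge : n.+1%:R^-1 <= y0 / lam.
  by rewrite -[leRHS]invrK invf_div lef_pV2 ?posrE ?divr_gt0// ltW.
have Xi0 : 0 < n.+1%:R^-1 :> R by rewrite invr_gt0.
have yl : y0 / lam <= y0 by rewrite ler_pdivrMr// ler_peMr// ltW.
have hX : h n.+1%:R^-1 <= dl.
  by rewrite -(scale_invK S dlp) (scale_le S)// (le_trans Xge).
have tmX : tmoment n.+1%:R <= C1 * (2 * lam) `^ s * dl * y0 `^ (- s).
  apply: (le_trans (H1 _ _)); first by rewrite ler1n.
  rewrite -!mulrA ler_pM2l//.
  apply: (@le_trans _ _ ((2 * lam / y0) `^ s * dl)).
    apply: ler_pM; rewrite ?powR_ge0 ?(ltW (scale_gt0 S _))//.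
    by apply: ge0_ler_powR; rewrite ?nnegrE ?(ltW s0)// (le_trans (ltW X0)).
  rewrite powRM ?mulr_ge0 ?invr_ge0 ?(ltW lam0) ?(ltW y00)//.
  rewrite -(powR_inv1 (ltW y00)) -powRrM mulN1r -!mulrA.
  by rewrite [dl * _]mulrC.
exists n.+1; split => //.
- have := HC n.+1 isT => h2.
  have : C * h n.+1%:R^-1 <= dl / 4.
    apply: (@le_trans _ _ (C * h (y0 / lam))).
      by rewrite ler_pM2l// (scale_le S).
    have := H4 (y0 / lam) y0 (divr_gt0 y00 lam0) yl y01.
    have -> : y0 / lam / y0 = lam^-1 by field; rewrite !gt_eqF.
    rewrite (scale_invK S)// => h3.
    apply: (@le_trans _ _ (C * (C4 * lam^-1 `^ beta * dl))); first by rewrite ler_pM2l.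
    rewrite -(powR_inv1 (ltW lam0)) -powRrM mulN1r powRN.
    have lb0 : 0 < lam `^ beta by rewrite powR_gt0.
    have -> : C * (C4 * (lam `^ beta)^-1 * dl) = C * C4 * dl / lam `^ beta by ring.
    rewrite ler_pdivrMr//.
    have := ler_wpM2l (ltW dlp) lamb; lra.
  have : dl * 1 <= dl * m by rewrite ler_pM2l.
  lra.
- have := tm1 n.+1%:R; rewrite ler1n => /(_ isT) t1.
  have := le_trans t1 tmX; rewrite powRN ler_pdivlMr ?powR_gt0// mul1r.
  by [].
Qed.

End upper_tail.
End truncated_moments.

(** * Both bounds for the truncated recursion *)

Section mean_bounds.
Context (R : realType) (mu : probability nat R).
Hypothesis mu0 : mu [set 0%N] = 0%E.
Variable m : R.
Hypothesis hm : ('E_mu[fun k : nat => k%:R : R] = m%:E)%E.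
Context (Q : probability tree R).
Hypothesis QG : gw_tree Q mu.
Variables (s q alpha : R).
Hypotheses (s0 : 0 < s) (hq : q = s + 1).
Variables (L h hi : R -> R) (beta : R).
Hypothesis S : scale_function h hi beta.
Hypothesis hf : exists2 x0 : R, 0 < x0 <= 1 & forall x, 0 < x -> x <= x0 ->
  (1 - 2^-1) * (L x^-1 * x `^ (alpha - 1)) <= h x <=
  (1 + 2^-1) * (L x^-1 * x `^ (alpha - 1)).
Variables (g : R -> R) (gi : R).
Hypothesis Hg : conductance g gi.
Variables (a0 K : R).
Hypotheses (a00 : 0 < a0).

Lemma meanN_tpow X : meanN Q X = Ex mu (tpow X 0).
Proof.
have M0 : exists M, forall j : nat, `|(minn j X)%:R : R| <= M.
  by exists X%:R => j; rewrite ger0_norm// ler_nat geq_minr.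
rewrite /meanN /noffspring (Ex_label QG M0); congr Ex; apply/funext => j.
by rewrite tpow0E.
Qed.

Lemma nmoment_tpow X p : 0 <= p -> nmoment Q X p = Ex mu (tpow X p).
Proof. by move=> p0; rewrite /nmoment /noffspring (Ex_label QG (tpow_bounded X p0)). Qed.

Let mu1 : R := Ex mu (fun j => (j == 1%N)%:R).

Lemma bounded_eq1 : bounded_rv (fun j : nat => (j == 1%N)%:R : R).
Proof.
by split => //; exists 1 => j; case: (j == 1%N); rewrite ?normr1 ?normr0.
Qed.

Lemma mean_trunc_ge X : (1 < X)%N -> 2 - mu1 <= Ex mu (tpow X 0).
Proof.
move=> X1; have -> : 2 - mu1 = Ex mu (fun j => 2 - (j == 1%N)%:R).
  by rewrite ExB ?Ex_cst//; [exact: bounded_rv_cst | exact: bounded_eq1].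
apply: (Ex_le_ae (A := [set 0%N])) => //.
- by apply: bounded_rvB; [exact: bounded_rv_cst | exact: bounded_eq1].
- exact: bounded_tpow.
move=> [|[|j]] h0; rewrite tpow0E.
- by exfalso; exact: h0.
- by rewrite (minn_idPl (ltnW X1))/=; lra.
- by rewrite /= subr0 (ler_nat _ 2) leq_min X1.
Qed.

Lemma mean_trunc_ge1 X : (0 < X)%N -> 1 <= Ex mu (tpow X 0).
Proof.
move=> X1; rewrite -[leLHS](Ex_cst mu); apply: (Ex_le_ae (A := [set 0%N])) => //.
- exact: bounded_rv_cst.
- exact: bounded_tpow.
move=> [|j] h0; rewrite tpow0E; first by exfalso; exact: h0.
by rewrite (ler_nat _ 1) leq_min X1.
Qed.

Lemma mean_ge1 : 1 <= m.
Proof. exact: le_trans (mean_trunc_ge1 (ltnSn 0)) (tpow_mean_le hm 1). Qed.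

Let m_gt0 : 0 < m. Proof. exact: lt_le_trans ltr01 mean_ge1. Qed.

Section upper.
Variables (c1 kappa : R).
Hypotheses (c10 : 0 < c1) (k0 : 0 < kappa) (K0 : 0 < K).
Hypothesis gub : forall x, 0 < x -> g x <= x / (1 + kappa * x `^ s) `^ s^-1.
Hypothesis hl : forall x, 1 <= x ->
  c1 * L x * x `^ (q - alpha) <= tmoment mu q x.

(** Recorded for a Y_k, with Y_k the mean contribution of a child: this majorises
    the mean of B whatever the truncation. *)
Lemma mean_upper_sequence : exists2 c, 0 < c & forall X r, (0 < X)%N -> 0 < r ->
  m * r <= K ->
  upper_sequence h c (K * gi) (m * r) (fun k => m * r * meang Q g gi X r k).
Proof.
have gi0 := gi_gt0 Hg.
have [c c0 Hc] := conductance_upper s0 k0 (cond0 Hg) gub.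
have KM : 0 < K * gi by rewrite mulr_gt0.
have [cl cl0 Hcl] := tmoment_lower mu0 s0 hq S hf c10 KM hl.
have [Cm Cm0 HCm] := scale_mul S KM m_gt0.
pose d := c * cl / m.
have d0 : 0 < d by rewrite divr_gt0// mulr_gt0.
exists (d / Cm); first by rewrite divr_gt0.
move=> X r X0 r0 aK.
have mr0 : 0 < m * r by rewrite mulr_gt0.
have mN : 0 < meanN Q X.
  by rewrite meanN_tpow (lt_le_trans ltr01)// mean_trunc_ge1.
have Y0 k : 0 < meang Q g gi X r k := meang_gt0 QG Hg r0 mN k.
have Yle k : meang Q g gi X r k <= gi := meang_le Q Hg X r0 k.
split.
- by move=> k; rewrite mulr_gt0.
- by move=> k; apply: ler_pM => //; exact: ltW.
move=> k; set Y := meang Q g gi X r k.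
have y0 : 0 < r * Y by apply: mulr_gt0; [exact: r0 | exact: Y0].
have yM : r * Y <= K * gi.
  apply: (@le_trans _ _ (m * r * Y)).
    by rewrite -mulrA ler_peMl ?mean_ge1// ltW.
  by apply: ler_pM; [exact: ltW | exact: ltW (Y0 k) | exact: aK | exact: Yle].
have h1 := meang_le_label QG Hg r0 (Y0 k).
have q0 : 0 < q by rewrite hq addr_gt0.
have gbd : exists M, forall t, 0 <= t -> g t <= M.
  by exists gi => t _; exact: (cond_le Hg).
have gc : forall t, 0 <= t -> g t + c * Num.min t 1 `^ q <= t by rewrite hq.
have h2 := Ex_conductance_le hm y0 (ltW c0) q0 (@g_ge0 _ _ _ Hg) gbd gc.
have h3 := Hcl _ y0 yM.
have h4 := HCm _ y0 yM.
rewrite -/(tmoment mu q (r * Y)^-1) in h2.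
have yq : (r * Y) `^ q = (r * Y) * (r * Y) `^ s.
  by rewrite hq addrC powR_D1// ltW.
rewrite yq in h2.
have h5 : meang Q g gi X r k.+1 <= r * Y * m - c * (r * Y) * (cl * h (r * Y)).
  apply: (le_trans h1).
  have : c * (r * Y) * (cl * h (r * Y)) <=
      c * (r * Y * (r * Y) `^ s) * tmoment mu q (r * Y)^-1.
    have -> : c * (r * Y * (r * Y) `^ s) * tmoment mu q (r * Y)^-1 =
      c * (r * Y) * ((r * Y) `^ s * tmoment mu q (r * Y)^-1) by ring.
    by rewrite ler_pM2l// mulr_gt0.
  rewrite -/Y; lra.
have -> : m * r * (m * r * Y) = m * r * (r * Y * m) by ring.
rewrite -[leRHS]mulrA ler_pM2l//; apply: (le_trans h5).
have -> : r * Y * m - c * (r * Y) * (cl * h (r * Y)) =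
  r * Y * m * (1 - d * h (r * Y)) by rewrite /d; field; rewrite gt_eqF.
have ym0 : 0 < r * Y * m by apply: mulr_gt0.
rewrite ler_pM2l// lerD2l lerN2 -[d / Cm * _]mulrA ler_pM2l//.
by rewrite ler_pdivrMl// -mulrA.
Qed.

Theorem mean_upper : exists2 C, 0 < C & forall X r n, (0 < X)%N -> 0 < r ->
  a0 <= m * r -> m * r <= K ->
  [/\ m * r <= 1 - (n.+1%:R)^-1 ->
        Ex Q (bval g gi X r n) <= C * (hi (1 - m * r) * (m * r) ^+ n.+1),
      m * r <= 1 + (n.+1%:R)^-1 ->
        Ex Q (bval g gi X r n) <= C * hi (n.+1%:R)^-1 &
      1 + (n.+1%:R)^-1 <= m * r ->
        Ex Q (bval g gi X r n) <= C * hi (m * r - 1)].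
Proof.
have [c c0 H] := mean_upper_sequence.
have KM : 0 < K * gi by rewrite mulr_gt0 ?(gi_gt0 Hg).
have K1 : 0 < K + 1 by rewrite addr_gt0.
have [C1 C10 H1] := upper_supercritical S c0 KM K1.
have [C2 C20 H2] := upper_subcritical S c0 KM a00.
have C12 : 0 < C1 + C2 by rewrite addr_gt0.
exists (C1 + C2) => // X r n X0 r0 ar rK.
have xa := H X r X0 r0 rK.
have mr0 : 0 < m * r by rewrite mulr_gt0.
have mN : 0 < meanN Q X.
  by rewrite meanN_tpow (lt_le_trans ltr01)// mean_trunc_ge1.
have n0 : 0 < n.+1%:R^-1 :> R by rewrite invr_gt0 ltr0n.
have n1 : n.+1%:R^-1 <= 1 :> R by rewrite invf_le1// ler1n.
have bx : Ex Q (bval g gi X r n) <= m * r * meang Q g gi X r n.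
  rewrite (Ex_bval QG Hg)// [m * r]mulrC -mulrA ler_pM2l//.
  rewrite ler_pM2r; last exact: (meang_gt0 QG Hg).
  by rewrite meanN_tpow; exact: (tpow_mean_le hm).
split => [ha|ha|ha]; apply: (le_trans bx).
- apply: (le_trans (H2 _ _ n ar ha xa)).
  rewrite ler_wpM2r ?lerDr ?(ltW C10)// mulr_ge0 ?exprn_ge0 ?(ltW mr0)//.
  rewrite ltW// (scale_inv_gt0 S) ?subr_gt0//.
  by apply: (le_lt_trans ha); rewrite gtrBl.
- apply: (le_trans (H1 _ _ _ n mr0 n0 _ (lexx _) ha xa)).
    by apply: (le_trans n1); rewrite lerDr ltW.
  by rewrite ler_wpM2r ?lerDl ?(ltW C20)// ltW// (scale_inv_gt0 S).
- have d0 : 0 < m * r - 1 by rewrite subr_gt0 (lt_le_trans _ ha)// ltrDl.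
  have dn : n.+1%:R^-1 <= m * r - 1 by rewrite lerBrDl.
  apply: (le_trans (H1 (m * r) _ _ n mr0 d0 _ dn _ xa)); last first.
  + by rewrite ler_wpM2r ?lerDl ?(ltW C20)// ltW// (scale_inv_gt0 S).
  + by rewrite addrC subrK.
  + lra.
Qed.

End upper.

End mean_bounds.

Section mean_lower_bounds.
Context (R : realType) (mu : probability nat R).
Hypothesis mu0 : mu [set 0%N] = 0%E.
Variable m : R.
Hypothesis hm : ('E_mu[fun k : nat => k%:R : R] = m%:E)%E.
Context (Q : probability tree R).
Hypothesis QG : gw_tree Q mu.
Variables (s q alpha : R).
Hypotheses (s0 : 0 < s) (hq : q = s + 1).
Variables (L h hi : R -> R) (beta : R).
Hypothesis S : scale_function h hi beta.
Hypothesis hf : exists2 x0 : R, 0 < x0 <= 1 & forall x, 0 < x -> x <= x0 ->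
  (1 - 2^-1) * (L x^-1 * x `^ (alpha - 1)) <= h x <=
  (1 + 2^-1) * (L x^-1 * x `^ (alpha - 1)).
Variables (g : R -> R) (gi : R).
Hypothesis Hg : conductance g gi.
Variables (a0 K : R).
Hypotheses (a00 : 0 < a0) (K0 : 0 < K).
Variables (c2 kappa : R).
Hypotheses (c20 : 0 < c2) (k0 : 0 < kappa).
Hypothesis glb : forall x, 0 < x -> x / (1 + kappa * x `^ s) `^ s^-1 <= g x.
Hypothesis gle : forall x, 0 <= x -> g x <= x.
Hypothesis hu : forall x, 1 <= x ->
  tmoment mu q x <= c2 * L x * x `^ (q - alpha).

Let mu1 : R := Ex mu (fun j => (j == 1%N)%:R).
Hypothesis mu1_lt1 : mu1 < 1.

Let m_ge1 : 1 <= m. Proof. exact: (mean_ge1 mu0 hm). Qed.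
Let m_gt0 : 0 < m. Proof. exact: lt_le_trans ltr01 m_ge1. Qed.
Let gi0 : 0 < gi. Proof. exact: (gi_gt0 Hg). Qed.

Let mlo : 1 < 2 - mu1.
Proof.
have hlt (x : R) : x < 1 -> 1 < 2 - x by lra.
exact: hlt.
Qed.

Let meanN_bounds X : (1 < X)%N -> 2 - mu1 <= meanN Q X <= m.
Proof.
by move=> X1; rewrite (meanN_tpow QG) (mean_trunc_ge mu0)//= (tpow_mean_le hm).
Qed.

Let meanN_gt0 X : (1 < X)%N -> 0 < meanN Q X.
Proof.
by move=> X1; have /andP[h1 _] := meanN_bounds X1; apply: lt_le_trans h1; exact: lt_trans mlo.
Qed.

Let nmoment_tmoment X : nmoment Q X s = tmoment mu q X%:R.
Proof.
rewrite (nmoment_tpow QG) ?(ltW s0)//; congr Ex; apply/funext => j.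
have -> : Num.min (j%:R : R) X%:R = (minn j X)%:R.
  have [jX|Xj] := leqP j X; first by rewrite min_l// ler_nat.
  by rewrite min_r// ler_nat ltnW.
by rewrite /tpow hq [s + 1]addrC powR_D1.
Qed.

(** The moment of order 1 + s of the normalised value is at most a constant times
    the truncated moment of order q of the offspring law, which the choice of the
    truncation bounds by a multiple of dl y0^(-s). *)
Lemma truncated_lower_sequence : exists D dl0 xmin : R, [/\ 0 < D, 0 < dl0 <= 1, 0 < xmin &
  forall dl, 0 < dl -> dl <= dl0 -> (hi dl) `^ s <= D * dl /\
  exists2 X : nat, (1 < X)%N & forall r, 0 < r -> a0 <= m * r ->
  lower_sequence s D xmin (m * r) dl (hi dl) (fun k => Ex Q (bval g gi X r k))].
Proof.
have [dl0 [D [dl01 D0 H]]] := choose_truncation mu0 s0 hq S hf c20 hu hm.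
have [C C0 HC] := normalized_bval_moment QG Hg m mlo s0.
have k1 : 0 < kappa / s by rewrite divr_gt0.
pose D' := Num.max D (kappa / s * C * D).
have D'0 : 0 < D' by rewrite lt_max D0.
exists D', dl0, (a0 / m * gi); split => //.
  by rewrite !mulr_gt0 ?invr_gt0.
move=> dl dlp dll; have [X [X1 hX1 hX2 hX3]] := H _ dlp dll.
have y00 : 0 < hi dl := scale_inv_gt0 S dlp.
have dl4 : 0 <= 1 - dl / 4 by move/andP: dl01 => [_ ?]; lra.
split; first by apply: (le_trans hX3); rewrite ler_pM2r// le_max lexx.
exists X => // r r0 ar; have mN := meanN_gt0 X1; have /andP[mN1 mN2] := meanN_bounds X1.
split.
  rewrite (Ex_bval QG Hg)// /meang [Ex Q (gval _ _ _ _ 0)]Ex_cst mulrA ler_pM2r//.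
  rewrite ler_pdivrMr// (le_trans ar)//.
  have -> : r * meanN Q X * m = m * r * meanN Q X by ring.
  by rewrite ler_peMr ?(le_trans (ltW a00))// (le_trans (ltW mlo)).
move=> k y yp yx.
have hV : Ex Q (fun nu => normalized_bval Q g gi X r k nu `^ (1 + s)) <= C * nmoment Q X s.
  exact: HC (meanN_bounds X1).
have low : forall t, 0 <= t -> t - kappa / s * t `^ (s + 1) <= g t.
  exact: (conductance_lower s0 k0 (cond0 Hg) glb).
have := Ex_bval_recursion_ge QG Hg r0 mN s0 (ltW k1) low hV yp yx.
rewrite nmoment_tmoment => hrec.
have x1 : 0 <= Ex Q (bval g gi X r k.+1) by apply/ltW/(Ex_bval_gt0 QG Hg).
set Z := 1 - D' * dl * _.
have [Z0|Z0] := leP Z 0.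
  apply: le_trans x1; rewrite mulr_ge0_le0 ?mulr_ge0_le0//.
  by rewrite mulr_ge0// (le_trans (ltW a00)).
apply: le_trans hrec.
have mr : m * r * (1 - dl / 4) <= r * meanN Q X.
  by rewrite [m * r]mulrC -mulrA ler_pM2l// (meanN_tpow QG).
have ZZ : Z <= 1 - kappa / s * (C * tmoment mu q X%:R) * y `^ s.
  rewrite lerD2l lerN2.
  apply: (@le_trans _ _ (kappa / s * (C * (D * dl * hi dl `^ (- s))) * y `^ s)).
    by rewrite ler_wpM2r ?powR_ge0// ler_pM2l// ler_pM2l.
  apply: (@le_trans _ _ (kappa / s * C * D * dl * (y / hi dl) `^ s)).
    rewrite powRM ?invr_ge0 ?(ltW y00)// -(powR_inv1 (ltW y00)) -powRrM mulN1r.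
    by rewrite le_eqVlt; apply/orP; left; apply/eqP; ring.
  by rewrite ler_wpM2r ?powR_ge0// ler_pM2r// le_max lexx orbT.
apply: ler_pM => //.
- by rewrite mulr_ge0// (le_trans (ltW a00)).
- by rewrite mulr_ge0// ltW.
- by rewrite ler_wpM2l.
Qed.

(** The moment of order 1 + beta/2 of the truncated offspring number is bounded in
    the truncation level, so that the probability of exceeding half the mean is
    bounded below at all heights.  Over i generations the mean grows at most by
    the factor max(1, K)^i, which enters [e i]. *)
Lemma lower_tail_bound : exists (e : nat -> R) (rho : R),
  [/\ forall i, 0 < e i, 0 <= rho < 1 & forall X r k i, (1 < X)%N -> 0 < r ->
    a0 <= m * r -> m * r <= K ->
    Ex Q (fun nu => (bval g gi X r (k + i) nu < e i * Ex Q (bval g gi X r (k + i)))%R%:R)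
    <= rho ^+ i].
Proof.
have b0 := scale_beta S.
have p0 : 0 < beta / 2 by rewrite divr_gt0.
have pb : beta / 2 < beta by rewrite ltr_pdivrMr// ltr_pMr// ltr1n.
have [Cu Cu0 HCu] := tpow_uniformly_bounded s0 hq S hf c20 hu (ltW p0) pb.
have [C C0 HC] := normalized_bval_moment QG Hg m mlo p0.
have [dl /andP[dlp dl1] HPZ] := paley_zygmund p0 (mulr_gt0 C0 Cu0).
have mu10 : 0 <= mu1 by apply: Ex_ge0 => j; rewrite ler0n.
pose rho := mu1 + (1 - mu1) * (1 - dl).
have rho0 : 0 <= rho by rewrite addr_ge0// mulr_ge0// subr_ge0// ltW.
have rho1 : rho < 1.
  have hh (u : R) : u < 1 -> u + (1 - u) * (1 - dl) < 1.
    move=> u1; have : 0 < (1 - u) * dl by rewrite mulr_gt0// subr_gt0.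
    lra.
  exact: hh.
pose T := K * gi.
have T0 : 0 < T by rewrite mulr_gt0.
have gT := cond_gt0 Hg T0.
pose c := Num.min 1 (a0 / m * (g T / T)).
have c0 : 0 < c by rewrite lt_min ltr01 !mulr_gt0 ?invr_gt0.
have c1 : c <= 1 by rewrite ge_min lexx.
pose Km := Num.max 1 K.
have Km0 : 0 < Km by rewrite lt_max ltr01.
exists (fun i => c ^+ i / 2 / Km ^+ i), rho; split.
- by move=> i; rewrite !divr_gt0 ?exprn_gt0.
- by rewrite rho0.
move=> X r k i X1 r0 ar rK.
have mN := meanN_gt0 X1; have /andP[mN1 mN2] := meanN_bounds X1.
pose x j := Ex Q (bval g gi X r j).
have x0 j : 0 < x j by exact: (Ex_bval_gt0 QG Hg).
have rmN : r * meanN Q X <= m * r by rewrite mulrC ler_pM2r.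
have xT : x k <= T.
  rewrite /x (Ex_bval QG Hg)// mulrA; apply: ler_pM.
  - by rewrite mulr_ge0// ltW.
  - exact/ltW/(meang_gt0 QG Hg).
  - exact: le_trans rK.
  - exact: (meang_le Q Hg X r0).
have xgrow : x (k + i)%N <= Km ^+ i * x k.
  elim: i => [|j ih]; first by rewrite addn0 expr0 mul1r.
  rewrite addnS exprS; apply: (le_trans (Ex_bval_le QG Hg (k + j) r0 mN gle)).
  rewrite -[leRHS]mulrA; apply: ler_pM => //; [by rewrite mulr_ge0// ltW | exact: ltW (x0 _)|].
  by apply: (le_trans rmN); apply: (le_trans rK); rewrite le_max lexx orbT.
have half : Ex Q (fun nu => (bval g gi X r k nu < x k / 2)%R%:R) <= 1 - dl.
  rewrite (_ : (fun nu => _) = (fun nu => (normalized_bval Q g gi X r k nu < 2^-1)%R%:R)).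
    apply: HPZ.
    - exact: (bounded_normalized_bval Q Hg X r0 k).
    - exact: (normalized_bval_ge0 QG Hg).
    - exact: (Ex_normalized_bval QG Hg).
    apply: (le_trans (HC X r k r0 (meanN_bounds X1))).
    by rewrite ler_pM2l// (nmoment_tpow QG) ?(ltW p0).
  apply/funext => nu; congr (_ %:R)%R.
  by rewrite /normalized_bval ltr_pdivrMr ?x0// mulrC.
have xk2 : 0 <= x k / 2 by rewrite divr_ge0 ?ltW.
have hc u : 0 <= u -> u <= x k / 2 -> c * u <= r * g u.
  move=> u0 ux; have uT : u <= T.
    apply: (le_trans ux); apply: le_trans xT.
    by rewrite ler_pdivrMr// ler_peMr ?(ltW (x0 k))// ler1n.
  have uT01 : 0 <= u / T <= 1 by rewrite divr_ge0 ?(ltW T0)//= ler_pdivrMr// mul1r.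
  have := g_star Hg uT01 (ltW T0); rewrite divfK ?gt_eqF// => hs.
  apply: (@le_trans _ _ (a0 / m * (g T / T) * u)).
    by rewrite ler_wpM2r// ge_min lexx orbT.
  have -> : a0 / m * (g T / T) * u = a0 / m * (u / T * g T) by ring.
  apply: ler_pM => //.
  - by rewrite divr_ge0 ?ltW.
  - by rewrite mulr_ge0 ?(ltW gT)//; case/andP: uT01.
  - by rewrite ler_pdivrMr// mulrC.
have c01 : 0 <= c <= 1 by rewrite (ltW c0).
have it := lower_tail_iter QG Hg mu0 (k := k) i r0 X1 c01 xk2 hc (ltW dlp) (ltW mu1_lt1) half (lexx _) (ltW rho1).
apply: (@le_trans _ _ (rho ^+ i * (1 - dl))); last first.
  by rewrite ler_piMr ?exprn_ge0// gerBl ltW.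
apply: le_trans it; apply: (lower_tail_mono Q Hg) => //.
have Kmi : 0 < Km ^+ i by rewrite exprn_gt0.
have ci : 0 <= c ^+ i by rewrite exprn_ge0// ltW.
rewrite mulrAC ler_pdivrMr// -[leRHS]mulrA -[leLHS]mulrA ler_wpM2l//.
rewrite [leLHS]mulrC mulrAC ler_pM2r// mulrC; exact: xgrow.
Qed.

(** The drift allowed for in the truncation is t = max(1/n, a - 1), cut at [dl0];
    the cut costs a constant, as t is bounded.  One truncation level serves both
    the mean and its lower tail. *)
Theorem mean_lower : exists (c : R) (e : nat -> R) (rho : R),
  [/\ 0 < c, forall i, 0 < e i, 0 <= rho < 1 & forall r n, 0 < r -> a0 <= m * r ->
    m * r <= K -> exists2 X : nat, (1 < X)%N &
    let E := Ex Q (bval g gi X r n) in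
    [/\ m * r <= 1 - (n.+1%:R)^-1 ->
          c * (hi (n.+1%:R)^-1 * (n.+1%:R * (1 - m * r)) `^ s^-1 * (m * r) ^+ n.+1) <= E,
        1 - (n.+1%:R)^-1 <= m * r -> m * r <= 1 + (n.+1%:R)^-1 ->
          c * hi (n.+1%:R)^-1 <= E,
        1 + (n.+1%:R)^-1 <= m * r -> c * hi (m * r - 1) <= E &
        forall i, (i <= n)%N ->
          Ex Q (fun nu => (bval g gi X r n nu < e i * E)%R%:R) <= rho ^+ i]].
Proof.
have [D [dl0 [xmin [D0 /andP[dl00 dl01] xmin0 H]]]] := truncated_lower_sequence.
have [eta eta0 Heta] := lower_sequence_bounds s0 D0 D0 xmin0.
have [e [rho [e0 rho01 Htail]]] := lower_tail_bound.
pose Km := Num.max 1 K.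
have Km1 : 1 <= Km by rewrite le_max lexx.
have Km0 : 0 < Km by exact: lt_le_trans Km1.
have [Cr Cr0 HCr] := scale_inv_mul S dl00 (divr_gt0 Km0 dl00).
exists (eta / Cr), e, rho; split => //; first by rewrite divr_gt0.
move=> r n r0 ar rK; set a := m * r in ar rK *.
have a_gt0 : 0 < a by exact: lt_le_trans ar.
have ni0 : 0 < n.+1%:R^-1 :> R by rewrite invr_gt0 ltr0n.
have ni1 : n.+1%:R^-1 <= 1 :> R by rewrite invf_le1// ler1n.
have aux t : 0 < t -> t <= Km ->
   eta / Cr * hi t <= eta * hi (Num.min t dl0).
  move=> t0 tK; pose dl := Num.min t dl0.
  have dlp : 0 < dl by rewrite lt_min t0.
  have dll : dl <= dl0 by rewrite ge_min lexx orbT.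
  rewrite -mulrA ler_pM2l// ler_pdivrMl//.
  apply: le_trans (HCr _ dlp dll); apply: (scale_inv_le S) => //.
  rewrite /dl; have [tl|lt] := leP t dl0.
    by rewrite ler_peMl ?(ltW t0)// ler_pdivlMr// mul1r (le_trans dl01).
  by rewrite divfK ?gt_eqF.
pose t := if a < 1 + n.+1%:R^-1 then n.+1%:R^-1 else a - 1.
have t0 : 0 < t.
  rewrite /t; case: (ltP a (1 + n.+1%:R^-1)) => // h1.
  by rewrite subr_gt0 (lt_le_trans _ h1)// ltrDl.
have tK : t <= Km.
  rewrite /t; case: (ltP a (1 + n.+1%:R^-1)) => _; first exact: le_trans Km1.
  by rewrite lerBlDr (le_trans rK)// (@le_trans _ _ Km)// ?lerDl// le_max lexx orbT.
pose dl := Num.min t dl0.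
have dlp : 0 < dl by rewrite lt_min t0.
have dll : dl <= dl0 by rewrite ge_min lexx orbT.
have dlt : dl <= t by rewrite ge_min lexx.
have [hy [X X1 hX]] := H dl dlp dll.
have y00 := scale_inv_gt0 S dlp.
have [B1 B2 B3] := Heta a dl (hi dl) _ n a_gt0 dlp (le_trans dll dl01) y00 hy (hX r r0 ar).
have hcr := aux t t0 tK; rewrite -/dl in hcr.
exists X => //; split.
- move=> h1.
  have tE : t = n.+1%:R^-1.
    rewrite /t ifT//; apply: (le_lt_trans h1); apply: (@lt_trans _ _ 1).
      by rewrite gtrBl.
    by rewrite ltrDl.
  apply: le_trans (B3 _ h1); last by rewrite -tE.
  rewrite -tE; set W := (_ `^ s^-1); set A := a ^+ n.+1.
  have -> : eta / Cr * (hi t * W * A) = eta / Cr * hi t * (W * A) by ring.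
  have -> : eta * (hi dl * W * A) = eta * hi dl * (W * A) by ring.
  by rewrite ler_wpM2r// mulr_ge0 ?powR_ge0 ?exprn_ge0// ltW.
- move=> h1 h2; have tE : t = n.+1%:R^-1.
    rewrite /t; case: (ltP a (1 + n.+1%:R^-1)) => // h3; apply/eqP; rewrite eq_le lerBlDl h2/=.
    by rewrite lerBrDl.
  by apply: le_trans (B2 _ h1); rewrite -?tE.
- move=> h1; have tE : t = a - 1 by rewrite /t ltNge h1.
  by rewrite -tE; apply: (le_trans hcr); apply: B1; rewrite -lerBrDl -tE.
- move=> i ilen.
  by have := Htail X r (n - i)%N i X1 r0 ar rK; rewrite subnK.
Qed.

End mean_lower_bounds.

(** * From the recursion on the tree to the truncated recursion *)

Section conductance_of_concave.
Context (R : realType) (g : R -> R).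
Hypothesis hg0 : forall x : R, 0 <= x -> 0 <= g x.
Hypothesis hgconc : concave_nneg g.
Hypothesis hgbd : exists M : R, forall x : R, 0 <= x -> g x <= M.
Hypothesis hgle : forall x, 0 < x -> g x <= x.
Hypothesis hgpos : forall x, 0 < x -> 0 < g x.

(** Extending by the value at 0 makes the function monotone, hence measurable, on
    the whole line. *)
Definition extend_nneg (x : R) : R := g (Num.max x 0).

Lemma extend_nnegE x : 0 <= x -> extend_nneg x = g x.
Proof. by move=> x0; rewrite /extend_nneg max_l. Qed.

(** By concavity a negative slope would persist and lead to negative values. *)
Lemma concave_nneg_nondecreasing x y : 0 <= x -> x <= y -> g x <= g y.
Proof.
move=> x0; rewrite le_eqVlt => /predU1P[->//|xy].
rewrite leNgt; apply/negP => gyx.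
pose sg := (g x - g y) / (y - x).
have sg0 : 0 < sg by rewrite divr_gt0 ?subr_gt0.
have y0 : 0 <= y by rewrite (le_trans x0)// ltW.
have d0 : 0 < (g y + 1) / sg by rewrite divr_gt0// ltr_wpDl// hg0.
pose z := y + (g y + 1) / sg.
have yz : y < z by rewrite ltrDl.
have := concave_slope hgconc x0 xy yz.
have -> : z - y = (g y + 1) / sg by rewrite /z addrC addKr.
rewrite ler_pdivrMr//.
have -> : (g y - g x) / (y - x) = - sg by rewrite /sg -mulNr opprB.
have -> : - sg * ((g y + 1) / sg) = - (g y + 1) by field; rewrite gt_eqF.
have := hg0 (le_trans y0 (ltW yz)); lra.
Qed.

(** By concavity g(t) >= (1 - t) g(0) for small t, against g(t) <= t. *)
Lemma concave_at0 : g 0 = 0.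
Proof.
apply/eqP; rewrite eq_le hg0// andbT leNgt; apply/negP => g00.
pose t := Num.min 2^-1 (g 0 / 4).
have t0 : 0 < t by rewrite lt_min invr_gt0 ltr0n/= divr_gt0.
have t1 : t <= 2^-1 by rewrite ge_min lexx.
have t2 : t <= g 0 / 4 by rewrite ge_min lexx orbT.
have t01 : 0 <= t <= 1 by rewrite (ltW t0)/= (le_trans t1)// invf_le1// ler1n.
have := hgconc (@ler01 R) (lexx 0) t01; rewrite mulr1 mulr0 addr0 => h1.
have h2 := hgle t0; have h3 := hg0 (@ler01 R).
have h4 : 0 <= t * g 1 by rewrite mulr_ge0// ltW.
have h5 : 2^-1 * g 0 <= (1 - t) * g 0 by rewrite ler_wpM2r ?hg0//; lra.
lra.
Qed.

Lemma extend_nneg_nondecreasing : {homo extend_nneg : x y / x <= y}.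
Proof.
move=> x y xy; apply: concave_nneg_nondecreasing; first by rewrite le_max lexx orbT.
by rewrite ge_max !le_max xy lexx orbT.
Qed.

Lemma conductance_extend : conductance extend_nneg (lim (g y @[y --> +oo])).
Proof.
have [M hM] := hgbd.
have ub : has_ubound (range extend_nneg).
  by exists M => _ [x _ <-]; apply: hM; rewrite le_max lexx orbT.
have cv := nondecreasing_cvgr extend_nneg_nondecreasing ub.
have limE : lim (g y @[y --> +oo]) = sup (range extend_nneg).
  apply/cvg_lim => //; apply: cvg_trans cv; apply: near_eq_cvg.
  near=> x; rewrite extend_nnegE//.
split.
- exact: extend_nneg_nondecreasing.
- by rewrite extend_nnegE// concave_at0.
- by move=> x; rewrite limE; apply: ub_le_sup => //; exists x.
- by move=> x x0; rewrite extend_nnegE ?(ltW x0)// hgpos.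
- move=> x y t x0 y0 t01; have /andP[a b] := t01.
  rewrite !extend_nnegE//; first exact: hgconc.
  by rewrite addr_ge0// mulr_ge0// subr_ge0.
Unshelve. all: by end_near. Qed.

Let G := extend_nneg.
Let gi := lim (g y @[y --> +oo]).
Let HG : conductance G gi := conductance_extend.

Definition shift (u : seq nat) (nu : seq nat -> nat) : tree := fun v => nu (u ++ v).

Lemma subtree_shift i u nu : subtree i (shift u nu) = shift (rcons u i) nu.
Proof. by apply/funext => v; rewrite /subtree /shift cat_rcons. Qed.

Lemma bval_mono X Y r k nu : 0 < r -> (X <= Y)%N ->
  bval G gi X r k nu <= bval G gi Y r k nu.
Proof.
move=> r0 XY.
have step j nu' : (forall nu, gval G gi X r j nu <= gval G gi Y r j nu) ->
    bval G gi X r j nu' <= bval G gi Y r j nu'.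
  move=> hj; rewrite /bval ler_pM2l//.
  have NN : (noffspring X nu' <= noffspring Y nu')%N.
    by rewrite leq_min geq_minl geq_min XY orbT.
  rewrite (sum_ord_le (fun i => gval G gi X r j (subtree i nu')) NN).
  apply: ler_sum => i _; case: (i < noffspring X nu')%N.
    by rewrite mul1r hj.
  by rewrite mul0r (gval_ge0 HG Y r0).
suff hg j : forall nu, gval G gi X r j nu <= gval G gi Y r j nu by exact: step.
by elim: j => // j ih nu'; rewrite !gvalS; apply: (cond_nd HG); exact: step.
Qed.

Lemma B_height_of_children r nu k (X0 : seq nat -> nat) u : 0 < r ->
  (forall v X, (X0 v <= X)%N ->
    ext_fun g (B_height g r nu k v) = (gval G gi X r k (shift v nu))%:E) ->
  exists Y, forall X, (Y <= X)%N ->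
    B_height g r nu k.+1 u = (bval G gi X r k (shift u nu))%:E.
Proof.
move=> r0 hX; exists (maxn (nu u) (\max_(i < nu u) X0 (rcons u i))) => X.
rewrite geq_max => /andP[nX mX] /=.
rewrite /children big_map (_ : iota 0 (nu u) = index_iota 0 (nu u)); last first.
  by rewrite /index_iota subn0.
rewrite big_mkord.
have NE : noffspring X (shift u nu) = nu u.
  by rewrite /noffspring /shift cats0 (minn_idPl nX).
rewrite /bval NE EFinM; congr (_ * _)%E.
rewrite -sumEFin; apply: eq_bigr => i _.
rewrite subtree_shift; apply: hX; apply: leq_trans mX.
exact: (leq_bigmax (F := fun i : 'I_(nu u) => X0 (rcons u i))).
Qed.

Lemma ext_fun_gval r nu k : 0 < r -> exists X0 : seq nat -> nat, forall v X,
  (X0 v <= X)%N ->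
  ext_fun g (B_height g r nu k v) = (gval G gi X r k (shift v nu))%:E.
Proof.
move=> r0; elim: k => [|k [X0 ih]]; first by exists (fun=> 0%N).
have /choice[Y hY] : forall u, exists Y, forall X, (Y <= X)%N ->
    B_height g r nu k.+1 u = (bval G gi X r k (shift u nu))%:E.
  by move=> u; exact: B_height_of_children ih.
exists Y => v X hX; rewrite (hY v X hX) gvalS /=.
by rewrite /G extend_nnegE// (bval_ge0 HG).
Qed.

(** Only finitely many offspring numbers enter the value, so that truncation at a
    sufficiently high level, depending on the tree, does not change it. *)
Lemma B_height_bval r nu k u : 0 < r -> exists Y, forall X, (Y <= X)%N ->
  B_height g r nu k.+1 u = (bval G gi X r k (shift u nu))%:E.
Proof.
move=> r0; have [X0 h] := ext_fun_gval nu k r0; exact: B_height_of_children h.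
Qed.

Lemma B_height_ge_bval r nu k u X : 0 < r ->
  ((bval G gi X r k (shift u nu))%:E <= B_height g r nu k.+1 u)%E.
Proof.
move=> r0; have [Y hY] := B_height_bval nu k u r0.
rewrite (hY (maxn X Y)) ?leq_maxr// lee_fin.
by apply: bval_mono => //; exact: leq_maxl.
Qed.

End conductance_of_concave.

Section limsup.
Context (R : realType).

Lemma limn_esup_le_near (u : nat -> \bar R) c n0 :
  (forall n, (n0 <= n)%N -> (u n <= c)%E) -> (limn_esup u <= c)%E.
Proof.
move=> h; rewrite limn_esup_lim; apply: lime_le; first exact: is_cvg_esups.
exists n0 => // n /= nn; apply: ge_ereal_sup => _ [k /= nk <-].
exact: h (leq_trans nn nk).
Qed.

Lemma limn_esup_ge0 (u : nat -> \bar R) :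
  (forall n, (0 <= u n)%E) -> (0 <= limn_esup u)%E.
Proof.
move=> h; rewrite limn_esup_lim; apply: lime_ge; first exact: is_cvg_esups.
apply: nearW => n; apply: (le_trans (h n)).
by apply: ereal_sup_ubound; exists n => /=.
Qed.

Lemma cvge0_squeeze (F : set_system R) (FF : ProperFilter F) (f : R -> \bar R) :
  (forall x, (0 <= f x)%E) ->
  (forall e : R, 0 < e -> \forall x \near F, (f x <= e%:E)%E) ->
  f x @[x --> F] --> 0%E.
Proof.
move=> f0 h; apply/fine_cvgP; split.
  have := h 1 ltr01; apply: filterS => x fx.
  by rewrite ge0_fin_numE// (le_lt_trans fx)// ltry.
apply/cvgrPdist_le => e e0; have := h e e0; apply: filterS => x fx.
have fin : f x \is a fin_num by rewrite ge0_fin_numE// (le_lt_trans fx)// ltry.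
by rewrite sub0r normrN ger0_norm ?fine_ge0// -lee_fin fineK.
Qed.

End limsup.

(** * Transfer to the probability space *)

Section law_of_tree.
Context d (Omega : measurableType d) (R : realType) (P : probability Omega R)
  (mu : probability nat R) (N : seq nat -> Omega -> nat).
Hypothesis hN : gw_offspring P mu N.

Definition labels (w : Omega) : tree := fun u => N u w.

Lemma measurable_labels : measurable_fun setT labels.
Proof. by have [mN _ _] := hN; apply: measurable_into_tree. Qed.

Lemma gw_offspring_tree : exists2 Q : probability tree R, gw_tree Q mu &
  forall A, Q A = P (labels @^-1` A).
Proof.
pose mixin := isMeasurableFun.Build _ _ _ _ _ measurable_labels.
pose mlab : {mfun Omega >-> tree} := HB.pack labels mixin.
exists (distribution P mlab) => // s A us.
have [_ law ind] := hN.
transitivity (\prod_(v <- s) P (N v @^-1` A v))%E; last first.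
  by apply: eq_bigr => v _; exact: law.
apply: (eq_trans _ (ind s A us)); congr (P _).
rewrite -bigcap_seq; apply/seteqP; split => w /= h v vs; exact: h.
Qed.

Lemma Ex_labels (Q : probability tree R) (f : tree -> R) :
  (forall A, Q A = P (labels @^-1` A)) -> bounded_rv f ->
  bounded_rv (fun w => f (labels w)) /\ Ex P (fun w => f (labels w)) = Ex Q f.
Proof.
move=> QE [mf [M fM]].
have bf : bounded_rv f by split => //; exists M.
have bfl : bounded_rv (fun w => f (labels w)).
  split; last by exists M.
  exact: (measurableT_comp mf measurable_labels).
split => //; apply: EFin_inj; rewrite -!Ex_EFin//.
pose Q1 : {measure set tree -> \bar R} := pushforward P labels.
pose Q2 := Q1 measurable_labels.
rewrite -[RHS](@eq_measure_integral _ _ _ setT Q Q2); last first.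
  by move=> A mA _; rewrite /Q2 /= /pushforward QE.
rewrite (integral_pushforward measurable_labels)//; last 1 first.
  by rewrite preimage_setT; exact: bounded_rv_integrable bfl.
exact/measurable_EFinP.
Qed.

Variables (g : R -> R).
Hypothesis hg0 : forall x : R, 0 <= x -> 0 <= g x.
Hypothesis hgconc : concave_nneg g.
Hypothesis hgbd : exists M : R, forall x : R, 0 <= x -> g x <= M.
Hypothesis hgle : forall x, 0 < x -> g x <= x.
Hypothesis hgpos : forall x, 0 < x -> 0 < g x.

Let G := extend_nneg g.
Let gi := lim (g y @[y --> +oo]).
Let HG : conductance G gi := conductance_extend hg0 hgconc hgbd hgle hgpos.

Variable (Rn : nat -> R).

Lemma B_rootS n w : B_root g Rn N n.+1 w =
  B_height g (Rn n.+1) (N ^~ w) n.+1 [::].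
Proof. by rewrite /B_root /B_tree subn0. Qed.

Section fixed_n.
Variable n : nat.
Hypothesis r0 : 0 < Rn n.+1.

Let b X w := bval G gi X (Rn n.+1) n (labels w).

Lemma bval_le_B_root X w : ((b X w)%:E <= B_root g Rn N n.+1 w)%E.
Proof.
rewrite B_rootS; exact: (B_height_ge_bval hg0 hgconc hgbd hgle hgpos (N ^~ w) n [::] X r0).
Qed.

Let bb X : bounded_rv (b X).
Proof.
have [mf [M fM]] := bounded_bval HG X r0 n.
split; last by exists M => w; exact: fM.
exact: (measurableT_comp mf measurable_labels).
Qed.

(** The sequence is eventually constant at each point of the sample space. *)
Lemma cvg_B_root w : (b X w)%:E @[X --> \oo] --> B_root g Rn N n.+1 w.
Proof.
rewrite B_rootS.
have [Y hY] := B_height_bval hg0 hgconc hgbd hgle hgpos (N ^~ w) n [::] r0.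
by apply: cvg_near_cst; exists Y => // X YX; exact: (esym (hY X YX)).
Qed.

Lemma measurable_B_root : measurable_fun setT (B_root g Rn N n.+1).
Proof.
apply: (emeasurable_fun_cvg (fun X w => (b X w)%:E)) => //.
  by move=> X; apply/measurable_EFinP; have [] := bb X.
by move=> w _; exact: cvg_B_root.
Qed.

Lemma B_root_ge0 w : (0 <= B_root g Rn N n.+1 w)%E.
Proof. by apply: le_trans (bval_le_B_root 0 w); rewrite lee_fin (bval_ge0 HG). Qed.

Lemma integral_B_root_le (Q : probability tree R) (B : R) :
  (forall A, Q A = P (labels @^-1` A)) ->
  (forall X, (0 < X)%N -> Ex Q (bval G gi X (Rn n.+1) n) <= B) ->
  (\int[P]_w B_root g Rn N n.+1 w <= B%:E)%E.
Proof.
move=> QE hB.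
have -> : (\int[P]_w B_root g Rn N n.+1 w = limn (fun X => \int[P]_w (b X.+1 w)%:E))%E.
  rewrite -monotone_convergence//.
  - apply: eq_integral => w _; apply/esym/cvg_lim => //.
    by have := @cvg_B_root w; rewrite -(cvg_shiftS (fun X => (b X w)%:E)).
  - by move=> X; apply/measurable_EFinP; have [] := bb X.+1.
  - by move=> X w _; rewrite lee_fin (bval_ge0 HG).
  - by move=> w _ X Y XY; rewrite lee_fin (bval_mono hg0 hgconc hgbd hgle hgpos).
apply: lime_le.
  apply: ereal_nondecreasing_is_cvgn => X Y XY; apply: ge0_le_integral => //.
  - by move=> w _; rewrite lee_fin (bval_ge0 HG).
  - by apply/measurable_EFinP; have [] := bb X.+1.
  - by apply/measurable_EFinP; have [] := bb Y.+1.
  - by move=> w _; rewrite lee_fin (bval_mono hg0 hgconc hgbd hgle hgpos).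
apply: nearW => X; rewrite Ex_EFin; last exact: bb.
have [_ ->] := Ex_labels QE (bounded_bval HG X.+1 r0 n).
by rewrite lee_fin hB.
Qed.

Lemma integral_B_root_ge (Q : probability tree R) X :
  (forall A, Q A = P (labels @^-1` A)) ->
  ((Ex Q (bval G gi X (Rn n.+1) n))%:E <= \int[P]_w B_root g Rn N n.+1 w)%E.
Proof.
move=> QE; have [_ <-] := Ex_labels QE (bounded_bval HG X r0 n).
rewrite -Ex_EFin; last exact: bb.
apply: ge0_le_integral => //.
- by move=> w _; rewrite lee_fin (bval_ge0 HG).
- by apply/measurable_EFinP; have [] := bb X.
- exact: measurable_B_root.
- by move=> w _; exact: bval_le_B_root.
Qed.

Lemma B_root_markov (t B : R) : 0 < t ->
  (\int[P]_w B_root g Rn N n.+1 w <= B%:E)%E ->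
  (P [set w | (t%:E <= B_root g Rn N n.+1 w)%E] <= (B / t)%:E)%E.
Proof.
move=> t0 hB; set A := [set w | _].
have mA : measurable A.
  rewrite -[A]setTI.
  exact: (emeasurable_fun_c_infty measurableT measurable_B_root t%:E).
rewrite EFinM lee_pdivlMr// muleC.
have mi : measurable_fun setT (fun w => (\1_A w : R)%:E).
  by apply/measurable_EFinP; exact: measurable_indic.
have t0' : (0 <= t%:E)%E by rewrite lee_fin ltW.
apply: le_trans hB; rewrite -(setIT A) -integral_indic// -ge0_integralZl//.
apply: ge0_le_integral => //.
- by move=> w _; rewrite mule_ge0// lee_fin.
- exact: measurable_funeM.
- exact: measurable_B_root.
move=> w _; rewrite indicE; case: (boolP (w \in A)) => [|_].
  by rewrite inE mule1.
by rewrite mule0 B_root_ge0.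
Qed.

Lemma B_root_lower_tail (Q : probability tree R) X (t u : R) :
  (forall A, Q A = P (labels @^-1` A)) -> t < u ->
  (P [set w | (B_root g Rn N n.+1 w <= t%:E)%E] <=
   (Ex Q (fun nu => (bval G gi X (Rn n.+1) n nu < u)%R%:R))%:E)%E.
Proof.
move=> QE tu; rewrite Ex_lt; last exact: (bounded_bval HG).
rewrite QE; apply: le_measure.
- rewrite inE -[X in measurable X]setTI.
  exact: (emeasurable_fun_infty_c measurableT measurable_B_root t%:E).
- rewrite inE; exact: (measurable_lt_event u (bb X)).
move=> w /= hw; rewrite -lte_fin; apply: le_lt_trans (bval_le_B_root X w) _.
by apply: (le_lt_trans hw); rewrite lte_fin.
Qed.

End fixed_n.

End law_of_tree.

Section final_parameters.
Context (R : realType).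

Lemma ereal_inf_sup_bounds (u : nat -> R) (K : R) :
  (0 < ereal_inf [set (u n)%:E | n in [set n | (0 < n)%N]])%E ->
  (ereal_sup [set (u n)%:E | n in [set n | (0 < n)%N]] <= K%:E)%E ->
  exists2 a0 : R, 0 < a0 & forall n, (0 < n)%N -> a0 <= u n <= K.
Proof.
set S := [set _ | _ in _] => i0 sK.
have S1 : S (u 1%N)%:E by exists 1%N.
have il : (ereal_inf S <= (u 1%N)%:E)%E by exact: ereal_inf_lbound.
have ifin : ereal_inf S \is a fin_num.
  by rewrite ge0_fin_numE ?(ltW i0)// (le_lt_trans il)// ltry.
exists (fine (ereal_inf S)); first by rewrite -lte_fin fineK.
move=> n n0; have Sn : S (u n)%:E by exists n.
apply/andP; split; rewrite -lee_fin ?fineK//; first exact: ereal_inf_lbound.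
by apply: le_trans sK; exact: ereal_sup_ubound.
Qed.

Section two_sided.
Variables (s kappa1 kappa2 : R) (g : R -> R).
Hypotheses (s0 : 0 < s) (k10 : 0 < kappa1) (k20 : 0 < kappa2).
Hypothesis hg : forall x : R, 0 < x ->
    x / (1 + kappa1 * x `^ s) `^ s^-1 <= g x <=
    x / (1 + kappa2 * x `^ s) `^ s^-1.

Lemma two_sided_le x : 0 < x -> g x <= x.
Proof.
move=> x0; have /andP[_] := hg x0; move=> /le_trans; apply.
have d1 : 1 <= (1 + kappa2 * x `^ s) `^ s^-1.
  by rewrite powR_ge1 ?invr_ge0 ?(ltW s0)// lerDl mulr_ge0 ?powR_ge0 ?ltW.
by rewrite ler_pdivrMr ?(lt_le_trans ltr01)// ler_peMr// ltW.
Qed.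

Lemma two_sided_gt0 x : 0 < x -> 0 < g x.
Proof.
move=> x0; have /andP[h _] := hg x0; apply: lt_le_trans h.
by rewrite divr_gt0// powR_gt0// ltr_wpDr// mulr_ge0 ?powR_ge0// ltW.
Qed.

End two_sided.

Lemma expr_small (rho e : R) : 0 <= rho < 1 -> 0 < e -> exists i, rho ^+ i <= e.
Proof.
move=> /andP[r0 r1] e0.
have r1' : `|rho| < 1 by rewrite ger0_norm.
have /cvgrPdist_le /(_ e e0) [i _ hi] := cvg_expr r1'.
exists i; have := hi i (leqnn i); rewrite sub0r normrN ger0_norm// exprn_ge0//.
Qed.

(** Adjacent regimes share their endpoints, where either value is allowed; the
    estimates are therefore required on closed ranges. *)
Lemma is_gamma_le (h : R -> R) (m : R) (Rn : nat -> R) n (y E C : R) :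
  is_gamma h m Rn n y ->
  (m * Rn n <= 1 - n%:R^-1 -> E <= C * (inv_pos h (1 - m * Rn n) * (m * Rn n) ^+ n)) ->
  (m * Rn n <= 1 + n%:R^-1 -> E <= C * inv_pos h n%:R^-1) ->
  (1 + n%:R^-1 <= m * Rn n -> E <= C * inv_pos h (m * Rn n - 1)) ->
  E <= C * y.
Proof.
move=> hy h1 h2 h3; move: hy; rewrite /is_gamma /=.
case=> [[/andP[_ a1] ->]|[/andP[_ a1] ->]|[a1 ->]]; [exact: h1|exact: h2|exact: h3].
Qed.

Lemma is_gamma_gt0 (h : R -> R) beta (m : R) (Rn : nat -> R) n (y : R) :
  scale_function h (inv_pos h) beta -> (0 < n)%N -> 0 < m * Rn n ->
  is_gamma h m Rn n y -> 0 < y.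
Proof.
move=> S n0 a0; have ni : 0 < n%:R^-1 :> R by rewrite invr_gt0 ltr0n.
rewrite /is_gamma /=.
case=> [[/andP[_ a1] ->]|[/andP[_ a1] ->]|[a1 ->]].
- rewrite mulr_gt0 ?exprn_gt0// (scale_inv_gt0 S)// subr_gt0.
  by apply: (le_lt_trans a1); rewrite gtrBl.
- exact: (scale_inv_gt0 S).
- by rewrite (scale_inv_gt0 S)// subr_gt0 (lt_le_trans _ a1)// ltrDl.
Qed.

Lemma gamma_tilde_ge (h : R -> R) (s m : R) (Rn gamma : nat -> R) n (E C : R) :
  is_gamma h m Rn n (gamma n) ->
  (m * Rn n <= 1 - n%:R^-1 ->
    C * (inv_pos h n%:R^-1 * (n%:R * (1 - m * Rn n)) `^ s^-1 * (m * Rn n) ^+ n) <= E) ->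
  (1 - n%:R^-1 <= m * Rn n -> m * Rn n <= 1 + n%:R^-1 -> C * inv_pos h n%:R^-1 <= E) ->
  (1 + n%:R^-1 <= m * Rn n -> C * inv_pos h (m * Rn n - 1) <= E) ->
  C * gamma_tilde s h m Rn gamma n <= E.
Proof.
move=> hy h1 h2 h3; rewrite /gamma_tilde /=; case: ifPn => [a1|]; first exact: h1.
rewrite -ltNge => a1; move: hy; rewrite /is_gamma /=.
case=> [[/andP[_ a2] ->]|[/andP[a2 a3] ->]|[a2 ->]]; [|exact: h2|exact: h3].
by move: a1; rewrite ltNge a2.
Qed.

Lemma gamma_tilde_gt0 (h : R -> R) beta (s m : R) (Rn gamma : nat -> R) n :
  scale_function h (inv_pos h) beta -> (0 < n)%N -> 0 < m * Rn n ->
  is_gamma h m Rn n (gamma n) -> 0 < gamma_tilde s h m Rn gamma n.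
Proof.
move=> S n0 a0 hy; have n0' : 0 < n%:R :> R by rewrite ltr0n.
rewrite /gamma_tilde /=; case: ifPn => [a1|_]; last exact: is_gamma_gt0 S n0 a0 hy.
rewrite mulr_gt0 ?exprn_gt0// mulr_gt0 ?(scale_inv_gt0 S) ?invr_gt0//.
rewrite powR_gt0// mulr_gt0// subr_gt0.
by apply: (le_lt_trans a1); rewrite gtrBl invr_gt0.
Qed.

End final_parameters.

Theorem theorem1p10 (R : realType)
  (mu : probability nat R)
  (hmu0 : mu [set 0%N] = 0%E) (hmu1 : (mu [set 1%N] < 1)%E)
  (m : R) (hm : ('E_mu[fun k : nat => k%:R : R] = m%:E)%E)
  (d : measure_display) (Omega : measurableType d) (P : probability Omega R)
  (N : seq nat -> Omega -> nat) (hN : gw_offspring P mu N)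
  (s q alpha : R) (hs : 0 < s) (hq : q = s + 1)
  (halpha : 1 < alpha <= q)
  (L : R -> R) (hL : slowly_varying L)
  (c1 c2 : R) (hc1 : 0 < c1) (hc2 : 0 < c2)
  (g : R -> R) (hg0 : forall x : R, 0 <= x -> 0 <= g x)
  (hgconc : concave_nneg g)
  (hgbd : exists M : R, forall x : R, 0 <= x -> g x <= M)
  (kappa1 kappa2 : R) (hk1 : 0 < kappa1) (hk2 : 0 < kappa2)
  (hg : forall x : R, 0 < x ->
    x / (1 + kappa1 * x `^ s) `^ s^-1 <= g x <=
    x / (1 + kappa2 * x `^ s) `^ s^-1)
  (Rn : nat -> R) (hR0 : forall n, (0 < n)%N -> 0 < Rn n)
  (hRinf : (0 < ereal_inf [set (m * Rn n)%:E | n in [set n | (0 < n)%N]])%E)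
  (K : R)
  (hRsup : (ereal_sup [set (m * Rn n)%:E | n in [set n | (0 < n)%N]] <= K%:E)%E)
  (h : R -> R) (hh : increasing_bijection_pos h)
  (hhL : h ~_(0^'+) (fun x : R => (L x^-1 * x `^ (alpha - 1))%R))
  (gamma : nat -> R)
  (hgamma : forall n, (0 < n)%N -> is_gamma h m Rn n (gamma n)) :
  exists c c' : R, [/\ 0 < c, 0 < c',
    (forall x : R, 1 <= x ->
       ((c1 * L x * x `^ (q - alpha))%:E <=
        truncated_moment mu q x)%E) ->
    (forall n, (0 < n)%N ->
       (\int[P]_w B_root g Rn N n w <= (c * gamma n)%:E)%E) /\
    limn_esup (fun n =>
      P [set w | ((A * gamma n)%:E <= B_root g Rn N n w)%E])
      @[A --> +oo] --> 0%E
  & (forall x : R, 1 <= x ->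
       (truncated_moment mu q x <=
        (c2 * L x * x `^ (q - alpha))%:E)%E) ->
    (forall n, (0 < n)%N ->
       ((c' * gamma_tilde s h m Rn gamma n)%:E <=
        \int[P]_w B_root g Rn N n w)%E) /\
    limn_esup (fun n =>
      P [set w | (B_root g Rn N n w <=
                  (eps * gamma_tilde s h m Rn gamma n)%:E)%E])
      @[eps --> 0^'+] --> 0%E].
Proof.
have [alpha1 _] := andP halpha.
have hgle x : 0 < x -> g x <= x by exact: (two_sided_le hs hk2 hg).
have hgpos x : 0 < x -> 0 < g x by exact: (two_sided_gt0 hk1 hg).
pose G := extend_nneg g; pose gi := lim (g y @[y --> +oo]).
have HG : conductance G gi := conductance_extend hg0 hgconc hgbd hgle hgpos.
have GE x : 0 < x -> G x = g x by move=> x0; rewrite /G extend_nnegE// ltW.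
have Gub x : 0 < x -> G x <= x / (1 + kappa2 * x `^ s) `^ s^-1.
  by move=> x0; rewrite GE//; have /andP[] := hg x x0.
have Glb x : 0 < x -> x / (1 + kappa1 * x `^ s) `^ s^-1 <= G x.
  by move=> x0; rewrite GE//; have /andP[] := hg x x0.
have Gle x : 0 <= x -> G x <= x.
  rewrite le_eqVlt => /predU1P[<-|x0]; first by rewrite (cond0 HG).
  by rewrite GE// hgle.
have [a0 a00 aK] := ereal_inf_sup_bounds hRinf hRsup.
have K0 : 0 < K by have /andP[h1 h2] := aK 1%N isT; apply: lt_le_trans h2; exact: lt_le_trans h1.
have S := bijection_scale alpha1 hL hh hhL.
have hf := scale_equivalent hL hhL (_ : 0 < 2^-1 :> R).
rewrite invr_gt0 ltr0n in hf; have {}hf := hf isT.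
have [Q QG QE] := gw_offspring_tree hN.
have s10 : 0 < s + 1 by rewrite addr_gt0.
have mR_gt0 n : (0 < n)%N -> 0 < m * Rn n.
  by move=> n0; have /andP[h1 _] := aK n n0; exact: lt_le_trans h1.
have gam_gt0 n : (0 < n)%N -> 0 < gamma n.
  by move=> n0; exact: is_gamma_gt0 S n0 (mR_gt0 n n0) (hgamma n n0).
have gamt_gt0 n : (0 < n)%N -> 0 < gamma_tilde s h m Rn gamma n.
  by move=> n0; exact: gamma_tilde_gt0 S n0 (mR_gt0 n n0) (hgamma n n0).
have Pge0 n (A : set Omega) : (0 <= P A)%E by exact: measure_ge0.
(* the constants precede the moment conditions in the statement: when a
   condition fails, any constant will do *)
have [c [c0 Hc]] : exists c : R, 0 < c /\ ((forall x : R, 1 <= x ->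
       ((c1 * L x * x `^ (q - alpha))%:E <= truncated_moment mu q x)%E) ->
    (forall n, (0 < n)%N ->
       (\int[P]_w B_root g Rn N n w <= (c * gamma n)%:E)%E)).
  have [hl|nhl] := pselect (forall x : R, 1 <= x ->
    ((c1 * L x * x `^ (q - alpha))%:E <= truncated_moment mu q x)%E); last by exists 1.
  have hl' x : 1 <= x -> c1 * L x * x `^ (q - alpha) <= tmoment mu q x.
    move=> x1; have x0 := le_trans ler01 x1.
    by rewrite -lee_fin -(truncated_momentE mu hs hq x0); exact: hl.
  have [C C0 HC] := mean_upper hmu0 hm QG hs hq S hf HG a00 hc1 hk2 K0 Gub hl'.
  exists C; split => // _ [//|n] n0.
  apply: (integral_B_root_le hN hg0 hgconc hgbd hgle hgpos (hR0 _ n0) QE) => X X0.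
  have /andP[h1 h2] := aK _ n0.
  have [A1 A2 A3] := HC X (Rn n.+1) n X0 (hR0 _ n0) h1 h2.
  exact: is_gamma_le (hgamma _ n0) A1 A2 A3.
have [c' [c'0 Hc']] : exists c' : R, 0 < c' /\ ((forall x : R, 1 <= x ->
       (truncated_moment mu q x <= (c2 * L x * x `^ (q - alpha))%:E)%E) ->
    (forall n, (0 < n)%N ->
       ((c' * gamma_tilde s h m Rn gamma n)%:E <=
        \int[P]_w B_root g Rn N n w)%E) /\
    limn_esup (fun n =>
      P [set w | (B_root g Rn N n w <=
                  (eps * gamma_tilde s h m Rn gamma n)%:E)%E])
      @[eps --> 0^'+] --> 0%E).
  have [hu|nhu] := pselect (forall x : R, 1 <= x ->
    (truncated_moment mu q x <= (c2 * L x * x `^ (q - alpha))%:E)%E); last by exists 1.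
  have hu' x : 1 <= x -> tmoment mu q x <= c2 * L x * x `^ (q - alpha).
    move=> x1; have x0 := le_trans ler01 x1.
    by rewrite -lee_fin -(truncated_momentE mu hs hq x0); exact: hu.
  have mu1_lt1 : Ex mu (fun j => (j == 1%N)%:R) < 1.
    rewrite -lte_fin (_ : (fun j => _) = \1_[set 1%N] :> (nat -> R)).
      by rewrite Ex_indic.
    apply/funext => j; rewrite indicE; congr (_ %:R)%R.
    by case: eqP => [->|hj]; [rewrite mem_set | rewrite memNset].
  have [C [e [rho [C0 e0 rho01 HC]]]] := mean_lower hmu0 hm QG hs hq S hf HG
    a00 K0 hc2 hk1 Glb Gle hu' mu1_lt1.
  have low n : (0 < n)%N -> exists X : nat,
      C * gamma_tilde s h m Rn gamma n <= Ex Q (bval G gi X (Rn n) n.-1) /\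
      forall i, (i < n)%N -> Ex Q (fun nu => (bval G gi X (Rn n) n.-1 nu <
        e i * Ex Q (bval G gi X (Rn n) n.-1))%R%:R) <= rho ^+ i.
    case: n => [//|n] n0; have /andP[h1 h2] := aK _ n0.
    have [X X1 [A1 A2 A3 A4]] := HC (Rn n.+1) n (hR0 _ n0) h1 h2.
    exists X; split => [|i i_n]; last exact: A4.
    exact: gamma_tilde_ge (hgamma _ n0) A1 A2 A3.
  exists C; split => // _; split.
    move=> [//|n] n0; have [X [h1 _]] := low _ n0.
    apply: le_trans (integral_B_root_ge hN hg0 hgconc hgbd hgle hgpos (hR0 _ n0) X QE).
    by rewrite lee_fin.
  apply: cvge0_squeeze => [eps|dl dl0].
    by apply: limn_esup_ge0 => n; exact: Pge0.
  have [i hi] := expr_small rho01 dl0.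
  have ei0 : 0 < e i * C by rewrite mulr_gt0.
  near=> eps.
  have epsi : eps < e i * C by near: eps; exact: nbhs_right_lt.
  apply: (@limn_esup_le_near _ _ _ i.+1) => -[//|n] i_n.
  have n0 : (0 < n.+1)%N by [].
  have [X [h1 h2]] := low _ n0.
  have hlt : eps * gamma_tilde s h m Rn gamma n.+1 <
      e i * Ex Q (bval G gi X (Rn n.+1) n).
    apply: (@lt_le_trans _ _ (e i * C * gamma_tilde s h m Rn gamma n.+1)).
      by rewrite ltr_pM2r// gamt_gt0.
    by rewrite -mulrA ler_pM2l.
  apply: (le_trans (B_root_lower_tail hN hg0 hgconc hgbd hgle hgpos (hR0 _ n0) X QE hlt)).
  by rewrite lee_fin; apply: le_trans hi; exact: h2.
exists c, c'; split => // hl; split; first exact: Hc.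
apply: cvge0_squeeze => [A|dl dl0].
  by apply: limn_esup_ge0 => n; exact: Pge0.
near=> A.
have A0 : 0 < A by near: A; exact: nbhs_pinfty_gt.
have cA : c / dl <= A by near: A; apply: nbhs_pinfty_ge; exact: num_real.
apply: (@limn_esup_le_near _ _ _ 1) => -[//|n] n0.
have Ag : 0 < A * gamma n.+1 by rewrite mulr_gt0// gam_gt0.
apply: (le_trans (B_root_markov hN hg0 hgconc hgbd hgle hgpos (hR0 _ n0) Ag (Hc hl _ n0))).
rewrite lee_fin -mulf_div divff ?gt_eqF ?gam_gt0// mulr1.
by rewrite ler_pdivrMr// -ler_pdivrMl// mulrC.
Unshelve. all: by end_near.
Qed.
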